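(* (Within Bishop's constructive mathematics.) Let $N$ be a positive integer and let $\mathbf{S}=(S^{1},S^{0})$ be a measurable complemented set in $\mathbb{R}^{N}$ with positive (possibly infinite) measure, such that $S^{1}$ is convex. Then $S^{1}$ is located in $\mathbb{R}^{N}$.
   Context: The framework is Bishop's constructive mathematics (intuitionistic logic; no law of excluded middle or Markov's principle). $\rho$ is the Euclidean metric on $\mathbb{R}^{N}$ and $\mu$ is Lebesgue measure. For reals, $x\neq y$ means $|x-y|>0$; for points of $\mathbb{R}^{N}$, $x\neq y$ means $\rho(x,y)>0$. A complemented set in $\mathbb{R}^{N}$ is a pair $\mathbf{A}=(A^{1},A^{0})$ of subsets of $\mathbb{R}^{N}$ such that $x\neq y$ whenever $x\in A^{1}$, $y\in A^{0}$. Its characteristic function $\chi_{\mathbf{A}}$ has domain $A^{1}\cup A^{0}$ and $\chi_{\mathbf{A}}(x)=k$ if $x\in A^{k}$. Integration is in the sense of Bishop and Bridges: a real-valued partial function $f$ on $\mathbb{R}^{N}$ is integrable if there is a sequence $(f_n)$ of continuous functions with compact support such that $\sum_n\int|f_n|$ converges and, whenever $\sum_n|f_n(x)|$ converges, $x$ is in the domain of $f$ and $f(x)=\sum_n f_n(x)$; then $\int f=\sum_n\int f_n$ (integrals of the $f_n$ being Riemann integrals). A full set is one that contains the domain of some integrable function. $\mathbf{A}$ is integrable if $\chi_{\mathbf{A}}$ is integrable, and then $\mu(\mathbf{A})=\int\chi_{\mathbf{A}}$. $\mathbf{A}$ is measurable if $\chi_{\mathbf{A}}$ is measurable; a partial function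 $f$ defined on a full set is measurable if for each integrable complemented set $\mathbf{B}$ and each $\varepsilon>0$ there exist an integrable complemented set $\mathbf{C}$ with $\mathbf{C}<\mathbf{B}$ and $\mu(\mathbf{B})-\mu(\mathbf{C})<\varepsilon$, and an integrable function $g$, such that $|f-g|<\varepsilon$ on $C^{1}$. Here $\mathbf{C}<\mathbf{B}$ means $\chi_{\mathbf{C}}\leqslant\chi_{\mathbf{B}}$ (wherever both are defined). $\mathbf{A}$ has positive (possibly infinite) measure if it is measurable and there exists an integrable complemented set $\mathbf{B}$ with $\mathbf{B}<\mathbf{A}$ and $\mu(\mathbf{B})>0$. A subset $S$ of $\mathbb{R}^{N}$ is located in $\mathbb{R}^{N}$ if it is inhabited (contains a constructible element) and for each $x\in\mathbb{R}^{N}$ the distance $\rho(x,S)=\inf\{\rho(x,s):s\in S\}$ exists, i.e. there is a real $m$ with $m\leqslant\rho(x,s)$ for all $s\in S$ and, for each $\varepsilon>0$, some $s\in S$ with $\rho(x,s)<m+\varepsilon$. *)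

(* Defs.v *)
From Stdlib Require Import QArith Qabs Lia Lqa ZArith List Fin.
From Stdlib Require Export ConstructiveReals ConstructiveAbs ConstructiveLimits
  ConstructiveSum ConstructivePower.


Local Open Scope ConstructiveReals.

(* Propositions are read as types: "there exists" is [sigT], "or" is [sum], and
   subsets are [Type]-valued, so that an existence statement carries the
   construction it asserts and countable choice is available, as in Bishop's
   mathematics. Only [==] and [<=], which have no computational content, are
   in [Prop]. *)

(** * Square root *)

Section Sqrt.

Context {R : ConstructiveReals}.

Definition pow2 (n : nat) : positive := Pos.of_nat (2 ^ n).

(* Within 2 of 2^n * sqrt x; 0 for x < 0. *)
Definition sqrt_num (x : CRcarrier R) (n : nat) : Z :=
  Z.sqrt (projT1 (CRfloor (CR_of_Q R (Z.pos (pow2 n * pow2 n) # 1) * x))).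

Definition sqrt_approx (x : CRcarrier R) (n : nat) : Q := sqrt_num x n # pow2 n.

Lemma CR_of_Q_le_inv (q r : Q) : CR_of_Q R q <= CR_of_Q R r -> Qle q r.
Proof.
  intros H. destruct (Qlt_le_dec r q) as [h|h]; [|exact h].
  exfalso. apply H. apply CR_of_Q_lt. exact h.
Qed.

Lemma sqrt_approx_nonneg x n : Qle 0 (sqrt_approx x n).
Proof.
  unfold sqrt_approx, Qle; simpl.
  pose proof (Z.sqrt_nonneg (projT1 (CRfloor (CR_of_Q R (Z.pos (pow2 n * pow2 n) # 1) * x)))).
  fold (sqrt_num x n) in H. lia.
Qed.

Lemma scale_bound (x : CRcarrier R) (p : positive) (z : Z) :
  CR_of_Q R (z # 1) <= CR_of_Q R (Z.pos p # 1) * x -> CR_of_Q R (z # p) <= x.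
Proof.
  intros H. apply (CRmult_le_reg_l (CR_of_Q R (Z.pos p # 1))).
  - apply CR_of_Q_lt. reflexivity.
  - rewrite <- CR_of_Q_mult.
    setoid_replace (Qmult (Z.pos p # 1) (z # p)) with (z # 1).
    + exact H.
    + unfold Qeq, Qmult; cbn [Qnum Qden]; lia.
Qed.

Lemma scale_bound' (x : CRcarrier R) (p : positive) (z : Z) :
  CR_of_Q R (Z.pos p # 1) * x < CR_of_Q R (z # 1) -> x < CR_of_Q R (z # p).
Proof.
  intros H. apply (CRmult_lt_reg_l (CR_of_Q R (Z.pos p # 1))).
  - apply CR_of_Q_lt. reflexivity.
  - rewrite <- CR_of_Q_mult.
    setoid_replace (Qmult (Z.pos p # 1) (z # p)) with (z # 1).
    + exact H.
    + unfold Qeq, Qmult; cbn [Qnum Qden]; lia.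
Qed.

Lemma sqrt_approx_lower x n : 0 <= x ->
  CR_of_Q R (sqrt_approx x n * sqrt_approx x n) <= x.
Proof.
  intros Hx. unfold sqrt_approx, sqrt_num.
  destruct (CRfloor (CR_of_Q R (Z.pos (pow2 n * pow2 n) # 1) * x)) as [z [h1 h2]]; simpl.
  unfold Qmult; simpl.
  destruct (Z_lt_le_dec z 0) as [hz|hz].
  - rewrite (Z.sqrt_neg z hz). simpl.
    apply CRle_trans with (2 := Hx). apply CR_of_Q_le. unfold Qle; simpl; lia.
  - apply scale_bound. apply CRle_trans with (CR_of_Q R (z # 1)).
    + apply CR_of_Q_le. unfold Qle; simpl. pose proof (Z.sqrt_spec z hz) as Hq; cbv zeta in Hq. lia.
    + apply CRlt_asym. exact h1.
Qed.

Lemma sqrt_approx_lower' x n : (0 < sqrt_num x n)%Z ->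
  CR_of_Q R (sqrt_approx x n * sqrt_approx x n) <= x.
Proof.
  unfold sqrt_approx, sqrt_num.
  destruct (CRfloor (CR_of_Q R (Z.pos (pow2 n * pow2 n) # 1) * x)) as [z [h1 h2]]; simpl.
  intros hp. unfold Qmult; simpl.
  apply scale_bound. apply CRle_trans with (CR_of_Q R (z # 1)).
  - apply CR_of_Q_le. unfold Qle; simpl.
    assert (0 < z)%Z by (apply Z.sqrt_pos; exact hp).
    pose proof (Z.sqrt_spec z ltac:(lia)) as Hq; cbv zeta in Hq. lia.
  - apply CRlt_asym. exact h1.
Qed.

Lemma sqrt_approx_upper x n :
  x < CR_of_Q R ((sqrt_approx x n + (2 # pow2 n)) * (sqrt_approx x n + (2 # pow2 n))).
Proof.
  assert (H : x < CR_of_Q R ((sqrt_num x n + 2) * (sqrt_num x n + 2) # (pow2 n * pow2 n))).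
  { unfold sqrt_num.
    destruct (CRfloor (CR_of_Q R (Z.pos (pow2 n * pow2 n) # 1) * x)) as [z [h1 h2]]; simpl.
    apply scale_bound'. apply CRlt_le_trans with (1 := h2).
    rewrite <- CR_of_Q_plus. apply CR_of_Q_le. unfold Qle; simpl.
    destruct (Z_lt_le_dec z 0) as [hz|hz].
    - rewrite (Z.sqrt_neg z hz). lia.
    - pose proof (Z.sqrt_spec z hz) as Hq; cbv zeta in Hq. pose proof (Z.sqrt_nonneg z). nia. }
  apply CRlt_le_trans with (1 := H). apply CR_of_Q_le.
  unfold sqrt_approx. generalize (sqrt_num x n) (pow2 n). intros a p.
  unfold Qle, Qmult, Qplus; simpl. rewrite !Pos2Z.inj_mul. lia.
Qed.

Lemma sqrt_approx_close x n m :
  Qle (sqrt_approx x n) (sqrt_approx x m + (2 # pow2 m)).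
Proof.
  pose proof (sqrt_approx_nonneg x n) as Hn. pose proof (sqrt_approx_nonneg x m) as Hm.
  assert (Hp : Qlt 0 (2 # pow2 m)) by reflexivity.
  destruct (Z_lt_le_dec 0 (sqrt_num x n)) as [h|h].
  - pose proof (CRle_lt_trans _ _ _ (sqrt_approx_lower' x n h) (sqrt_approx_upper x m)) as H.
    apply lt_CR_of_Q in H.
    generalize dependent (sqrt_approx x n). generalize dependent (sqrt_approx x m).
    generalize dependent (2 # pow2 m). intros. nra.
  - assert (Qle (sqrt_approx x n) 0) by (unfold sqrt_approx, Qle; simpl; lia).
    lra.
Qed.

Lemma pow2_small (p : positive) (n : nat) :
  (Pos.to_nat p <= n)%nat -> Qle (2 # pow2 n) (2 # p).
Proof.
  intros H. unfold Qle; simpl. unfold pow2.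
  pose proof (Nat.pow_gt_lin_r 2 n ltac:(lia)). lia.
Qed.

Lemma sqrt_cauchy (x : CRcarrier R) :
  CR_cauchy R (fun n => CR_of_Q R (sqrt_approx x n)).
Proof.
  intros p. exists (Pos.to_nat (2 * p)). intros i j hi hj.
  assert (Hs : Qeq (2 # (2 * p)) (1 # p)) by (unfold Qeq; simpl; lia).
  pose proof (pow2_small _ _ hi) as Hi. pose proof (pow2_small _ _ hj) as Hj.
  rewrite Hs in Hi, Hj.
  pose proof (sqrt_approx_close x i j). pose proof (sqrt_approx_close x j i).
  unfold CRminus. rewrite <- CR_of_Q_opp, <- CR_of_Q_plus, CR_of_Q_abs.
  apply CR_of_Q_le. apply Qabs_Qle_condition. split; lra.
Qed.

Definition CRsqrt (x : CRcarrier R) : CRcarrier R :=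
  projT1 (CR_complete R _ (sqrt_cauchy x)).

Lemma CRsqrt_approx x n :
  CR_of_Q R (sqrt_approx x n - (2 # pow2 n)) <= CRsqrt x /\
  CRsqrt x <= CR_of_Q R (sqrt_approx x n + (2 # pow2 n)).
Proof.
  unfold CRsqrt. destruct (CR_complete R _ (sqrt_cauchy x)) as [l Hl]; simpl.
  assert (Hlow : CR_cv R (fun k => CR_of_Q R (sqrt_approx x k + (2 # pow2 k))) l).
  { apply CR_cv_proper with (l + 0); [|apply CRplus_0_r].
    apply CR_cv_eq with (fun k => CR_of_Q R (sqrt_approx x k) + CR_of_Q R (2 # pow2 k)).
    - intros k. symmetry. apply CR_of_Q_plus.
    - apply CR_cv_plus; [exact Hl|].
      intros p. exists (Pos.to_nat (2 * p)). intros i hi.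
      pose proof (pow2_small _ _ hi) as Hi.
      assert (Hs : Qeq (2 # (2 * p)) (1 # p)) by (unfold Qeq; simpl; lia).
      rewrite Hs in Hi. unfold CRminus.
      rewrite <- CR_of_Q_opp, <- CR_of_Q_plus, CR_of_Q_abs. apply CR_of_Q_le.
      assert (Qlt 0 (2 # pow2 i)) by reflexivity.
      apply Qabs_Qle_condition. split; lra. }
  split.
  - apply (CR_cv_bound_down (fun k => CR_of_Q R (sqrt_approx x k + (2 # pow2 k))) _ l O);
      [|exact Hlow].
    intros k _. apply CR_of_Q_le. pose proof (sqrt_approx_close x n k).
    assert (Qlt 0 (2 # pow2 n)) by reflexivity. lra.
  - apply (CR_cv_bound_up (fun k => CR_of_Q R (sqrt_approx x k)) _ l O); [|exact Hl].
    intros k _. apply CR_of_Q_le. exact (sqrt_approx_close x k n).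
Qed.

Lemma CRsqrt_pos x : 0 <= CRsqrt x.
Proof.
  unfold CRsqrt. destruct (CR_complete R _ (sqrt_cauchy x)) as [l Hl]; simpl.
  apply (CR_cv_bound_down (fun k => CR_of_Q R (sqrt_approx x k)) _ l O); [|exact Hl].
  intros k _. apply CR_of_Q_le. apply sqrt_approx_nonneg.
Qed.

Lemma CR_le_0_of_small (y : CRcarrier R) (c : positive) :
  (forall n, y <= CR_of_Q R ((Z.pos c # 1) * (2 # pow2 n))) -> y <= 0.
Proof.
  intros H h. destruct (CR_Q_dense R _ _ h) as [[a b] [h1 h2]].
  apply lt_CR_of_Q in h1. unfold Qlt in h1; simpl in h1.
  apply (H (Pos.to_nat (2 * c * b))).
  apply CRle_lt_trans with (2 := h2). apply CR_of_Q_le.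
  unfold Qle, Qmult; cbn [Qnum Qden]. unfold pow2.
  set (n := Pos.to_nat (2 * c * b)).
  pose proof (Nat.pow_gt_lin_r 2 n ltac:(lia)) as Hn.
  assert (Hz : (2 * Z.pos c * Z.pos b <= Z.pos (1 * Pos.of_nat (2 ^ n)))%Z) by lia.
  nia.
Qed.

Lemma CR_of_Q_square_le (y : CRcarrier R) (q : Q) :
  0 <= y -> y <= CR_of_Q R q -> y * y <= CR_of_Q R (q * q).
Proof.
  intros h0 h. rewrite CR_of_Q_mult. apply CRle_trans with (y * CR_of_Q R q).
  - apply CRmult_le_compat_l; assumption.
  - apply CRmult_le_compat_r; [apply CRle_trans with y|]; assumption.
Qed.

Lemma CR_of_Q_le_square (y : CRcarrier R) (q : Q) :
  Qle 0 q -> CR_of_Q R q <= y -> CR_of_Q R (q * q) <= y * y.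
Proof.
  intros h0' h. pose proof (CR_of_Q_le (R := R) _ _ h0') as h0. rewrite CR_of_Q_mult.
  apply CRle_trans with (CR_of_Q R q * y).
  - apply CRmult_le_compat_l; assumption.
  - apply CRmult_le_compat_r; [apply CRle_trans with (CR_of_Q R q)|]; assumption.
Qed.

Lemma CRle_of_minus (a b : CRcarrier R) : a - b <= 0 -> a <= b.
Proof.
  intros H. apply CRplus_le_reg_r with (- b). rewrite CRplus_opp_r. exact H.
Qed.

Lemma CRminus_le (a b : CRcarrier R) (q r : Q) :
  a <= CR_of_Q R q -> CR_of_Q R r <= b -> a - b <= CR_of_Q R (q - r).
Proof.
  intros ha hb. unfold Qminus. rewrite CR_of_Q_plus, CR_of_Q_opp.
  apply CRplus_le_compat; [exact ha|]. apply CRopp_ge_le_contravar. exact hb.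
Qed.

Lemma CRsqrt_sqrt x : 0 <= x -> CRsqrt x * CRsqrt x == x.
Proof.
  intros Hx. pose proof (CRsqrt_pos x) as H0.
  destruct (CR_archimedean R (CRsqrt x + CR_of_Q R 4)) as [B HB].
  assert (Hs : forall n, Qle (sqrt_approx x n + (2 # pow2 n)) (Z.pos B # 1)).
  { intros n. apply CR_of_Q_le_inv. apply CRlt_asym. apply CRle_lt_trans with (2 := HB).
    destruct (CRsqrt_approx x n) as [h _].
    apply CRle_trans with (CR_of_Q R (sqrt_approx x n - (2 # pow2 n)) + CR_of_Q R 4).
    - rewrite <- CR_of_Q_plus. apply CR_of_Q_le.
      assert (Qle (2 # pow2 n) 2) by (unfold Qle; simpl; lia). lra.
    - apply CRplus_le_compat_r. exact h. }
  assert (He : forall n, Qlt 0 (2 # pow2 n)) by (intros n; reflexivity).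
  assert (Hc : Qeq (Z.pos (4 * B) # 1) (4 * (Z.pos B # 1))) by reflexivity.
  split; apply CRle_of_minus; apply (CR_le_0_of_small _ (4 * B)); intros n;
    destruct (CRsqrt_approx x n) as [h1 h2]; specialize (Hs n); specialize (He n);
    pose proof (sqrt_approx_nonneg x n) as Hn; rewrite Hc;
    pose proof (CRlt_asym _ _ (sqrt_approx_upper x n)) as Hu;
    pose proof (sqrt_approx_lower x n Hx) as Hl;
    revert h1 h2 Hs He Hn Hu Hl;
    generalize (sqrt_approx x n) (2 # pow2 n) (Z.pos B # 1); intros s e b h1 h2 Hs He Hn Hu Hl.
  - destruct (Qlt_le_dec s e) as [d|d].
    + apply CRle_trans with (CR_of_Q R ((s + e) * (s + e) - 0 * 0)).
      * apply CRminus_le; [exact Hu|]. apply CR_of_Q_le_square; [lra|exact H0].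
      * apply CR_of_Q_le. nra.
    + apply CRle_trans with (CR_of_Q R ((s + e) * (s + e) - (s - e) * (s - e))).
      * apply CRminus_le; [exact Hu|]. apply CR_of_Q_le_square; [lra|exact h1].
      * apply CR_of_Q_le. nra.
  - apply CRle_trans with (CR_of_Q R ((s + e) * (s + e) - s * s)).
    + apply CRminus_le; [|exact Hl]. apply CR_of_Q_square_le; assumption.
    + apply CR_of_Q_le. nra.
Qed.

End Sqrt.

Set Implicit Arguments.
Unset Strict Implicit.
Unset Printing Implicit Defensive.

(** * The metric space R^N *)

Section Space.

Context {R : ConstructiveReals}.

Fixpoint fin_sum (n : nat) : (Fin.t n -> CRcarrier R) -> CRcarrier R :=
  match n with
  | O => fun _ => 0
  | S m => fun u => u F1 + fin_sum (fun i => u (FS i))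
  end.

Fixpoint fin_prod (n : nat) : (Fin.t n -> CRcarrier R) -> CRcarrier R :=
  match n with
  | O => fun _ => 1
  | S m => fun u => u F1 * fin_prod (fun i => u (FS i))
  end.

Definition point (N : nat) : Set := Fin.t N -> CRcarrier R.

Definition point_eq {N} (x y : point N) : Prop := forall i, x i == y i.

Definition dist {N} (x y : point N) : CRcarrier R :=
  CRsqrt (fin_sum (fun i => (x i - y i) * (x i - y i))).

Lemma fin_sum_0 n (u : Fin.t n -> CRcarrier R) : (forall i, u i == 0) -> fin_sum u == 0.
Proof.
  induction n as [|n IH]; simpl; intros H; [reflexivity|].
  rewrite (H F1), IH; [apply CRplus_0_l|]. intros i. apply H.
Qed.

Lemma dist_point_eq N (x y : point N) : point_eq x y -> dist x y <= 0.
Proof.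
  intros H h. unfold dist in h.
  set (q := fin_sum (fun i => (x i - y i) * (x i - y i))) in h.
  assert (Hq : q == 0).
  { apply fin_sum_0. intros i. rewrite (H i). unfold CRminus.
    rewrite CRplus_opp_r. apply CRmult_0_l. }
  pose proof (CRmult_lt_0_compat R _ _ h h) as h'.
  rewrite (CRsqrt_sqrt q) in h'.
  - destruct Hq as [_ Hq]. exact (Hq h').
  - destruct Hq as [Hq _]. exact Hq.
Qed.

End Space.

Arguments point R N : clear implicits.

(* Subsets respect the equality of R^N. *)
Record subset (R : ConstructiveReals) (N : nat) := Subset {
  mem :> point R N -> Type;
  mem_ext : forall x y, point_eq x y -> mem x -> mem y
}.

Section Topology.

Context {R : ConstructiveReals} {N : nat}.
Implicit Types (S K : subset R N) (x y : point R N) (f : point R N -> CRcarrier R).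

Definition inhabited S : Type := {x : point R N & S x}.

(* The distance from x to S exists and equals m. *)
Definition is_dist_to x S (m : CRcarrier R) : Type :=
  (forall s, S s -> m <= dist x s) *
  (forall eps, 0 < eps -> {s : point R N & S s * (dist x s < (m + eps)%ConstructiveReals)})%type.

Definition located S : Type :=
  inhabited S * (forall x, {m : CRcarrier R & is_dist_to x S m}).

Definition convex S : Type :=
  forall x y t, S x -> S y -> 0 <= t -> t <= 1 ->
    S (fun i => t * x i + (1 - t) * y i).

Definition pt_cauchy (u : nat -> point R N) : Type :=
  forall eps, 0 < eps ->
    {n : nat | forall i j, (n <= i)%nat -> (n <= j)%nat -> dist (u i) (u j) <= eps}.

Definition pt_cv (u : nat -> point R N) (l : point R N) : Type :=
  forall eps, 0 < eps ->
    {n : nat | forall i, (n <= i)%nat -> dist (u i) l <= eps}.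

Definition complete K : Type :=
  forall u, (forall n, K (u n)) -> pt_cauchy u -> {l : point R N & K l * pt_cv u l}%type.

Definition totally_bounded K : Type :=
  forall eps, 0 < eps ->
    {n : nat & {a : Fin.t n -> point R N &
      (forall k, K (a k)) * (forall x, K x -> {k : Fin.t n & dist x (a k) < eps})}}%type.

Definition compact K : Type := (complete K * totally_bounded K)%type.

Definition uniformly_continuous_on K f : Type :=
  forall eps, 0 < eps ->
    {delta : CRcarrier R & (0 < delta) *
      (forall x y, K x -> K y -> dist x y <= delta -> CRabs R (f x - f y) <= eps)}%type.

Definition continuous f : Type :=
  forall K, compact K -> uniformly_continuous_on K f.

(* Points at positive distance from K. *)
Definition metric_complement K x : Type :=
  {r : CRcarrier R & (0 < r) * (forall y, K y -> r <= dist x y)}%type.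

Definition compactly_supported f : Type :=
  {K : subset R N & compact K * (forall x, metric_complement K x -> f x == 0)}%type.

Record test_function f : Type := {
  test_ext : forall x y, point_eq x y -> f x == f y;
  test_continuous : continuous f;
  test_support : compactly_supported f
}.

End Topology.

(** * The Riemann integral over R^N *)

(* A partition of [a, b]: part_pt 0 <= ... <= part_pt (S part_last), with cells
   numbered 0, ..., part_last. *)
Record partition (R : ConstructiveReals) (a b : CRcarrier R) : Set := {
  part_last : nat;
  part_pt : nat -> CRcarrier R;
  part_first_pt : part_pt 0 == a;
  part_last_pt : part_pt (S part_last) == b;
  part_mono : forall j, (j <= part_last)%nat -> part_pt j <= part_pt (S j)
}.

(* The multi-index (a, u_1, ..., u_n). *)
Definition fin_cons {A : Type} n (a : A) (u : Fin.t n -> A) (i : Fin.t (S n)) : A :=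
  Fin.caseS' i (fun _ => A) a u.

Section Riemann.

Context {R : ConstructiveReals} {N : nat}.

(* Sum of F over the multi-indices k with k i <= d i for all i
   ([CRsum u d] has the d + 1 terms u 0, ..., u d). *)
Fixpoint grid_sum (n : nat) :
    (Fin.t n -> nat) -> ((Fin.t n -> nat) -> CRcarrier R) -> CRcarrier R :=
  match n with
  | O => fun d F => F d
  | S m => fun d F =>
      CRsum (fun j => grid_sum (fun i => d (FS i)) (fun k => F (fin_cons j k))) (d F1)
  end.

Variable M : CRcarrier R.

(* A partition of the cube [-M, M]^N into boxes indexed by multi-indices. *)
Let grid : Set := Fin.t N -> partition (- M) M.

Definition grid_index (P : grid) (k : Fin.t N -> nat) : Prop :=
  forall i, (k i <= part_last (P i))%nat.

Definition cell_volume (P : grid) (k : Fin.t N -> nat) : CRcarrier R :=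
  fin_prod (fun i => part_pt (P i) (S (k i)) - part_pt (P i) (k i)).

Definition mesh_le (P : grid) (delta : CRcarrier R) : Prop :=
  forall i j, (j <= part_last (P i))%nat ->
    part_pt (P i) (S j) - part_pt (P i) j <= delta.

Definition tags (P : grid) (xi : (Fin.t N -> nat) -> point R N) : Prop :=
  forall k, grid_index P k ->
  forall i, part_pt (P i) (k i) <= xi k i <= part_pt (P i) (S (k i)).

Definition riemann_sum (P : grid) (xi : (Fin.t N -> nat) -> point R N)
    (f : point R N -> CRcarrier R) : CRcarrier R :=
  grid_sum (fun i => part_last (P i)) (fun k => f (xi k) * cell_volume P k).

End Riemann.

(* The integral over R^N of a function vanishing outside some cube [-M, M]^N,
   as the limit of tagged Riemann sums when the mesh tends to 0. *)
Definition riemann_integral {R : ConstructiveReals} {N : nat}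
    (f : point R N -> CRcarrier R) (v : CRcarrier R) : Type :=
  {M : CRcarrier R &
    (0 < M) *
    (forall x i, M < CRabs R (x i) -> f x == 0) *
    (forall eps, 0 < eps ->
      {delta : CRcarrier R & (0 < delta) *
        (forall (P : Fin.t N -> partition (- M) M) xi,
          mesh_le P delta -> tags P xi ->
          CRabs R (riemann_sum P xi f - v) <= eps)})}%type.

(** * Integrable and measurable partial functions *)

Record partial_function (R : ConstructiveReals) (N : nat) := PartialFunction {
  dom : subset R N;
  val : forall x, dom x -> CRcarrier R;
  val_ext : forall x y (hx : dom x) (hy : dom y), point_eq x y -> val hx == val hy
}.

Section Integration.

Context {R : ConstructiveReals} {N : nat}.
Implicit Types (f g : partial_function R N).

Definition series_converges (u : nat -> CRcarrier R) : Type :=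
  {s : CRcarrier R & series_cv u s}.

Definition has_integral f (v : CRcarrier R) : Type :=
  {fn : nat -> point R N -> CRcarrier R &
  {I : nat -> CRcarrier R & {J : nat -> CRcarrier R &
    (forall n, test_function (fn n)) *
    (forall n, riemann_integral (fun x => CRabs R (fn n x)) (I n)) *
    (forall n, riemann_integral (fn n) (J n)) *
    series_converges I *
    (forall x, series_converges (fun n => CRabs R (fn n x)) ->
       {hx : dom f x & series_cv (fun n => fn n x) (val hx)}) *
    series_cv J v}}}%type.

Definition integrable f : Type := {v : CRcarrier R & has_integral f v}.

Definition integral f (hf : integrable f) : CRcarrier R := projT1 hf.

Definition full (D : subset R N) : Type :=
  {g : partial_function R N & integrable g * (forall x, dom g x -> D x)}%type.

End Integration.

Record complemented_set (R : ConstructiveReals) (N : nat) := ComplementedSet {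
  cs1 : subset R N;
  cs0 : subset R N;
  cs_apart : forall x y, cs1 x -> cs0 y -> 0 < dist x y
}.

Section Measure.

Context {R : ConstructiveReals} {N : nat}.
Implicit Types (A B C : complemented_set R N) (f g : partial_function R N).

Definition chi_dom A : subset R N :=
  @Subset R N (fun x => (cs1 A x + cs0 A x)%type)
    (fun x y e h => match h with
                    | inl h1 => inl (mem_ext e h1)
                    | inr h0 => inr (mem_ext e h0)
                    end).

Definition chi_val A x (h : chi_dom A x) : CRcarrier R :=
  match h with inl _ => 1 | inr _ => 0 end.

Lemma chi_val_ext A x y (hx : chi_dom A x) (hy : chi_dom A y) :
  point_eq x y -> chi_val hx == chi_val hy.
Proof.
  intros e. destruct hx as [hx|hx], hy as [hy|hy]; simpl; try reflexivity; exfalso.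
  - exact (dist_point_eq e (cs_apart hx hy)).
  - apply (dist_point_eq (x := y) (y := x)).
    + intros i. symmetry. apply e.
    + exact (cs_apart hy hx).
Qed.

Definition chi A : partial_function R N := PartialFunction (@chi_val_ext A).

(* C < B *)
Definition cs_lt C B : Type :=
  forall x (hC : dom (chi C) x) (hB : dom (chi B) x), val hC <= val hB.

Definition integrable_set A : Type := integrable (chi A).

Definition mu A (hA : integrable_set A) : CRcarrier R := integral hA.

(* As for the order of complemented sets, |f - g| < eps on C^1 is required at
   the points of C^1 where f and g are both defined. *)
Definition measurable_function f : Type :=
  (full (dom f) *
   (forall B (hB : integrable_set B) eps, 0 < eps ->
     {C : complemented_set R N & {hC : integrable_set C &
     {g : partial_function R N &
       cs_lt C B * (mu hB - mu hC < eps) * integrable g *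
       (forall x, cs1 C x -> forall (hf : dom f x) (hg : dom g x),
          CRabs R (val hf - val hg) < eps)}}}))%type.

Definition measurable A : Type := measurable_function (chi A).

Definition positive_measure A : Type :=
  (measurable A *
   {B : complemented_set R N & {hB : integrable_set B & cs_lt B A * (0 < mu hB)}})%type.

End Measure.

(* Main.v *)
(* Fix x and a < b. If s is a point of S^1 with d(x, s) < a, then by convexity the homothety of
   centre s and small ratio 2^-q maps a bounded part of T^1 (T < S of positive measure) into the
   points of S^1 at distance less than b from x, and the image has measure at least
   2^(-qN) tau, where q and tau do not depend on s. Measurability of S, applied to a large cube,
   approximates the measure of the part of S^1 near x: if it is positive there is a point of S^1
   at distance less than b from x, and if it is less than 2^(-qN) tau there is no s as above. This
   decides between the two alternatives that are needed to construct the infimum.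

   Points are found by one positivity principle: if f_n >= 0 and the sum of the integrals of the
   f_n is less than the integral of F, all over a cube, then at some point of the cube the series
   of the f_n converges to a sum less than F; the point is obtained by successive halving of
   the cube. It is applied to partial sums of the series that represent the integrable functions,
   with the tails of these series among the f_n.

   The integral over a cube is its volume times the limit [avg] of the averages over dyadic grids.
   Averages are exactly compatible with homotheties and with halving of the cube. *)

(* The obstacle is that the point s to be refuted is arbitrary: an approximation of chi_S in measure
   says nothing about a single point. Convexity replaces s by a set of points of S^1 whose measure
   has a lower bound known before s is given, so that one comparison of two reals settles all s at
   once.

   Membership in C^1 or C^0, the value of g, and the order of two complemented sets are pointwise
   facts, available only where the representing series converge. One point must therefore lie in
   several domains at once, with a controlled error in each. This is why tails are added in the
   positivity principle: where the tail of the series of f sums absolutely to t, the point is in the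
   domain of f and the partial sum is within t of the value. At the image of the homothety it is
   convexity that puts the point in S^1, so that the closeness of g to chi_S on C^1 applies
   there. *)
Require Import Defs.
From Stdlib Require Import QArith Lia ZArith List Fin Ring.
From Stdlib Require Import ConstructiveMinMax.
Import ListNotations.
Local Open Scope ConstructiveReals.

(** * Linear arithmetic *)

(* [lin (H1, ..., Hn)] proves a linear consequence of order hypotheses, products counting as
   unknowns. The multipliers come from a Fourier-Motzkin elimination with no correctness proof;
   [ring] verifies the resulting linear combination. *)

Inductive lexp := LC (q : Q) | LV (n : nat) | LAdd (a b : lexp) | LSub (a b : lexp)
  | LMul (a b : lexp) | LOpp (a : lexp).

(** A monomial is the sorted list of its atoms, with repetition. [nil] is the monomial 1, so
    [lcoef nil] reads off the constant term. *)
Definition lmono := list nat.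
Definition lpoly := list (lmono * Q).

Fixpoint lmono_cmp (a b : lmono) : comparison :=
  match a, b with
  | nil, nil => Eq
  | nil, _ => Lt
  | _, nil => Gt
  | x :: a', y :: b' => match Nat.compare x y with Eq => lmono_cmp a' b' | c => c end
  end.

Fixpoint linsert (n : nat) (l : lmono) : lmono :=
  match l with
  | nil => [n]
  | x :: l' => if Nat.leb n x then n :: l else x :: linsert n l'
  end.

Fixpoint lpoly_add1 (m : lmono) (q : Q) (p : lpoly) : lpoly :=
  match p with
  | nil => [(m, q)]
  | (m', q') :: p' =>
    match lmono_cmp m m' with
    | Eq => (m, Qred (q + q')) :: p'
    | Lt => (m, q) :: p
    | Gt => (m', q') :: lpoly_add1 m q p'
    end
  end.

Definition lpoly_clean (p : lpoly) := filter (fun t => negb (Qeq_bool (snd t) 0)) p.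

Definition lpoly_add (a b : lpoly) : lpoly :=
  lpoly_clean (fold_right (fun t acc => lpoly_add1 (fst t) (snd t) acc) b a).

Definition lpoly_scale (c : Q) (p : lpoly) : lpoly :=
  lpoly_clean (map (fun t => (fst t, Qred (c * snd t))) p).

Definition lpoly_mul (a b : lpoly) : lpoly :=
  fold_right (fun t acc =>
    lpoly_add (map (fun u => (fold_right linsert (fst u) (fst t), Qred (snd t * snd u))) b) acc)
    nil a.

(* The products above need not be sorted, so each term is re-inserted. *)
Definition lpoly_sort (p : lpoly) : lpoly := lpoly_add p nil.

Fixpoint lnorm (e : lexp) : lpoly :=
  match e with
  | LC q => lpoly_clean [(nil, Qred q)]
  | LV n => [([n], 1%Q)]
  | LAdd a b => lpoly_add (lnorm a) (lnorm b)
  | LSub a b => lpoly_add (lpoly_scale (-1) (lnorm b)) (lnorm a)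
  | LOpp a => lpoly_scale (-1) (lnorm a)
  | LMul a b => lpoly_sort (lpoly_mul (lnorm a) (lnorm b))
  end.

Inductive lkind := KLe | KLt | KEq.

(* A constraint [poly >= 0], [> 0] or [= 0], with its coefficients over the hypotheses. *)
Record lcon := LCon { lc_kind : lkind; lc_poly : lpoly; lc_cert : list Q }.

Fixpoint lcert_add (a b : list Q) : list Q :=
  match a, b with
  | x :: a', y :: b' => Qred (x + y) :: lcert_add a' b'
  | nil, _ => b
  | _, nil => a
  end.

Definition lkind_add (a b : lkind) : lkind :=
  match a, b with
  | KLt, _ | _, KLt => KLt
  | KLe, _ | _, KLe => KLe
  | KEq, KEq => KEq
  end.

Definition lcon_comb (x : Q) (a : lcon) (y : Q) (b : lcon) : lcon :=
  LCon (lkind_add (lc_kind a) (lc_kind b))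
    (lpoly_add (lpoly_scale x (lc_poly a)) (lpoly_scale y (lc_poly b)))
    (lcert_add (map (fun q => Qred (x * q)) (lc_cert a))
               (map (fun q => Qred (y * q)) (lc_cert b))).

Fixpoint lcoef (m : lmono) (p : lpoly) : Q :=
  match p with
  | nil => 0
  | (m', q) :: p' => match lmono_cmp m m' with Eq => q | _ => lcoef m p' end
  end.

Fixpoint lvar (p : lpoly) : option lmono :=
  match p with
  | nil => None
  | (nil, _) :: p' => lvar p'
  | (m, _) :: _ => Some m
  end.

Definition lcontra (c : lcon) : bool :=
  match lvar (lc_poly c) with
  | Some _ => false
  | None => let k := lcoef nil (lc_poly c) in
      match lc_kind c with
      | KLe => negb (Qle_bool 0 k)
      | KLt => Qle_bool k 0
      | KEq => false
      end
  end.

(** An equation containing [m] is preferred as a pivot: substitution adds no constraints, whereas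
    pairing [pos] with [neg] multiplies their numbers. The pivot reduces itself to 0 = 0 and is
    dropped; 0 > 0 is kept, being a contradiction. *)
Definition lelim (m : lmono) (cs : list lcon) : list lcon :=
  match find (fun c => match lc_kind c with KEq => negb (Qeq_bool (lcoef m (lc_poly c)) 0) | _ => false end) cs with
  | Some e =>
    let a := lcoef m (lc_poly e) in
    filter (fun c => match lc_poly c with nil => match lc_kind c with KLt => true | _ => false end | _ => true end)
    (map (fun c => let b := lcoef m (lc_poly c) in
      if Qeq_bool b 0 then c else lcon_comb 1 c (- b / a) e) cs)
  | None =>
    let pos := filter (fun c => negb (Qle_bool (lcoef m (lc_poly c)) 0)) cs in
    let neg := filter (fun c => negb (Qle_bool 0 (lcoef m (lc_poly c)))) cs in
    let zer := filter (fun c => Qeq_bool (lcoef m (lc_poly c)) 0) cs in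
    flat_map (fun p => map (fun n =>
      lcon_comb (- lcoef m (lc_poly n)) p (lcoef m (lc_poly p)) n) neg) pos ++ zer
  end.

Definition lcost (m : lmono) (cs : list lcon) : nat :=
  if existsb (fun c => match lc_kind c with KEq => negb (Qeq_bool (lcoef m (lc_poly c)) 0) | _ => false end) cs
  then O else
  S (length (filter (fun c => negb (Qle_bool (lcoef m (lc_poly c)) 0)) cs) *
   length (filter (fun c => negb (Qle_bool 0 (lcoef m (lc_poly c)))) cs)).

Definition lvars (cs : list lcon) : list lmono :=
  flat_map (fun c => filter (fun m => match m with nil => false | _ => true end) (map fst (lc_poly c))) cs.

Definition lbest (cs : list lcon) : option lmono :=
  match lvars cs with
  | nil => None
  | m :: ms => Some (fst (fold_left (fun b m' => let k := lcost m' cs in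
      if Nat.ltb k (snd b) then (m', k) else b) ms (m, lcost m cs)))
  end.

Fixpoint lsearch (fuel : nat) (cs : list lcon) : option (list Q) :=
  match find lcontra cs with
  | Some c => Some (lc_cert c)
  | None => match fuel with
    | O => None
    | S f => match lbest cs with None => None | Some m => lsearch f (lelim m cs) end
    end
  end.

Definition lhyps (hs : list (lkind * lexp)) : list lcon :=
  let n := length hs in
  map (fun t => LCon (fst (snd t)) (lnorm (snd (snd t)))
        (map (fun j => if Nat.eqb j (fst t) then 1%Q else 0%Q) (seq 0 n)))
    (combine (seq 0 n) hs).

Definition lsolve (hs : list (lkind * lexp)) : option (list Q) := lsearch 40 (lhyps hs).

(** * Soundness of linear combinations of order hypotheses *)

Section LinTheory.

Context {R : ConstructiveReals}.
Implicit Types a b S : CRcarrier R.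

Lemma CR_ring_theory : ring_theory (CR_of_Q R 0) (CR_of_Q R 1) (CRplus R) (CRmult R)
  (CRminus R) (CRopp R) (CReq R).
Proof. exact (CRisRing R). Qed.

Lemma CR_Q_morph : ring_morph (CR_of_Q R 0) (CR_of_Q R 1) (CRplus R) (CRmult R)
  (CRminus R) (CRopp R) (CReq R) 0%Q 1%Q Qplus Qmult Qminus Qopp Qeq_bool (CR_of_Q R).
Proof.
  split; try reflexivity; intros.
  - apply CR_of_Q_plus.
  - unfold Qminus. rewrite CR_of_Q_plus, CR_of_Q_opp. reflexivity.
  - apply CR_of_Q_mult.
  - apply CR_of_Q_opp.
  - apply CR_of_Q_morph. apply Qeq_bool_eq. assumption.
Qed.

(** [S] accumulates the combination one hypothesis at a time. [lin_lt] gains strictness, and the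
    primed versions preserve strictness already gained. *)
Lemma lin_le S a b c : 0 <= S -> a <= b -> Qle_bool 0 c = true -> 0 <= S + CR_of_Q R c * (b - a).
Proof.
  intros h1 h2 h3. apply CRle_trans with (0 + 0).
  - rewrite CRplus_0_l. apply CRle_refl.
  - apply CRplus_le_compat; [exact h1|]. apply CRmult_le_0_compat.
    + apply CR_of_Q_le. apply Qle_bool_iff. exact h3.
    + apply CRle_minus. exact h2.
Qed.

Lemma lin_le' S a b c : 0 < S -> a <= b -> Qle_bool 0 c = true -> 0 < S + CR_of_Q R c * (b - a).
Proof.
  intros h1 h2 h3. apply CRlt_le_trans with (S + 0).
  - rewrite CRplus_0_r. exact h1.
  - apply CRplus_le_compat_l. apply CRmult_le_0_compat.
    + apply CR_of_Q_le. apply Qle_bool_iff. exact h3.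
    + apply CRle_minus. exact h2.
Qed.

Lemma lin_lt S a b c : 0 <= S -> a < b -> negb (Qle_bool c 0) = true ->
  0 < S + CR_of_Q R c * (b - a).
Proof.
  intros h1 h2 h3. apply CRle_lt_trans with (S + 0).
  - rewrite CRplus_0_r. exact h1.
  - apply CRplus_lt_compat_l. apply CRmult_lt_0_compat.
    + apply CR_of_Q_lt. apply Qnot_le_lt. intros h. apply Qle_bool_iff in h.
      rewrite h in h3. discriminate.
    + apply CRlt_minus. exact h2.
Qed.

Lemma lin_lt' S a b c : 0 < S -> a < b -> negb (Qle_bool c 0) = true ->
  0 < S + CR_of_Q R c * (b - a).
Proof. intros h. apply lin_lt. apply CRlt_asym. exact h. Qed.

Lemma lin_eq S a b c : 0 <= S -> a == b -> 0 <= S + CR_of_Q R c * (b - a).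
Proof.
  intros h1 h2. rewrite h2. unfold CRminus. rewrite CRplus_opp_r, CRmult_0_r, CRplus_0_r. exact h1.
Qed.

Lemma lin_eq' S a b c : 0 < S -> a == b -> 0 < S + CR_of_Q R c * (b - a).
Proof.
  intros h1 h2. rewrite h2. unfold CRminus. rewrite CRplus_opp_r, CRmult_0_r, CRplus_0_r. exact h1.
Qed.

Lemma lin_start (k : Q) : Qle_bool 0 k = true -> 0 <= CR_of_Q R k.
Proof. intros h. apply CR_of_Q_le. apply Qle_bool_iff. exact h. Qed.

Lemma lin_start' (k : Q) : negb (Qle_bool k 0) = true -> 0 < CR_of_Q R k.
Proof.
  intros h3. apply CR_of_Q_lt. apply Qnot_le_lt. intros h. apply Qle_bool_iff in h.
  rewrite h in h3. discriminate.
Qed.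

Lemma lin_end_le S a b c : 0 <= S -> negb (Qle_bool c 0) = true ->
  CR_of_Q R c * (b - a) == S -> a <= b.
Proof.
  intros h1 h2 h3. apply lin_start' in h2. apply CRle_of_minus.
  apply (CRmult_le_reg_l (CR_of_Q R c)); [exact h2|].
  rewrite CRmult_0_r. apply CRopp_ge_le_contravar in h1. rewrite CRopp_0 in h1.
  rewrite <- h3 in h1. rewrite CRopp_mult_distr_r in h1. unfold CRminus in *.
  rewrite CRopp_plus_distr, CRopp_involutive, CRplus_comm in h1. exact h1.
Qed.

Lemma lin_end_lt S a b c : 0 < S -> negb (Qle_bool c 0) = true ->
  CR_of_Q R c * (b - a) == S -> a < b.
Proof.
  intros h1 h2 h3. apply lin_start' in h2. rewrite <- h3 in h1.
  rewrite <- (CRmult_0_r (CR_of_Q R c)) in h1.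
  apply CRmult_lt_reg_l in h1; [|exact h2].
  apply (CRplus_lt_compat_r a) in h1. unfold CRminus in h1.
  rewrite CRplus_0_l, CRplus_assoc, CRplus_opp_l, CRplus_0_r in h1. exact h1.
Qed.

Lemma lin_end_false S : 0 < S -> S == 0 -> False.
Proof. intros h e. rewrite e in h. exact (CRle_refl _ h). Qed.

End LinTheory.

(** * Reification of order hypotheses and goals *)

Ltac lin_isQ q :=
  lazymatch q with
  | Qmake ?z ?p =>
    let b := isZcst z in
    lazymatch b with true => isPcst p | _ => b end
  | _ => constr:(false)
  end.
Ltac CR_cst t :=
  lazymatch t with
  | CR_of_Q _ ?q => let b := lin_isQ q in lazymatch b with true => q | _ => constr:(NotConstant) end
  | _ => constr:(NotConstant)
  end.

Ltac lin_mem x l :=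
  lazymatch l with
  | nil => constr:(false)
  | cons x _ => constr:(true)
  | cons _ ?l' => lin_mem x l'
  end.
Ltac lin_add x l := let b := lin_mem x l in lazymatch b with true => l | _ => constr:(cons x l) end.
Ltac lin_idx x l :=
  lazymatch l with
  | cons x _ => constr:(O)
  | cons _ ?l' => let n := lin_idx x l' in constr:(S n)
  end.
Ltac lin_atoms e l :=
  lazymatch e with
  | CRplus _ ?a ?b => let l := lin_atoms a l in lin_atoms b l
  | CRminus _ ?a ?b => let l := lin_atoms a l in lin_atoms b l
  | CRmult _ ?a ?b => let l := lin_atoms a l in lin_atoms b l
  | CRopp _ ?a => lin_atoms a l
  | CR_of_Q _ ?q => let b := lin_isQ q in lazymatch b with true => l | _ => lin_add e l end
  | _ => lin_add e l
  end.
Ltac lin_reify e l :=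
  lazymatch e with
  | CRplus _ ?a ?b => let x := lin_reify a l in let y := lin_reify b l in constr:(LAdd x y)
  | CRminus _ ?a ?b => let x := lin_reify a l in let y := lin_reify b l in constr:(LSub x y)
  | CRmult _ ?a ?b => let x := lin_reify a l in let y := lin_reify b l in constr:(LMul x y)
  | CRopp _ ?a => let x := lin_reify a l in constr:(LOpp x)
  | CR_of_Q _ ?q => let b := lin_isQ q in
      lazymatch b with true => constr:(LC q) | _ => let n := lin_idx e l in constr:(LV n) end
  | _ => let n := lin_idx e l in constr:(LV n)
  end.

Ltac lin_sides t k :=
  lazymatch t with
  | CRle _ ?a ?b => k KLe a b
  | CRlt _ ?a ?b => k KLt a b
  | CReq _ ?a ?b => k KEq a b
  end.
Ltac lin_flat H acc :=
  let t := type of H in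
  lazymatch t with
  | prod ?A ?B => lazymatch H with
      | pair ?x ?y => let acc := lin_flat x acc in lin_flat y acc
      | _ => let acc := lin_flat constr:(fst H) acc in lin_flat constr:(snd H) acc
      end
  | CReq _ _ _ => constr:(pair H acc)
  | CRle _ ?a ?b => constr:(pair H acc)
  | CRlt _ ?a ?b => constr:(pair H acc)
  | and _ _ => let acc := lin_flat constr:(proj1 H) acc in lin_flat constr:(proj2 H) acc
  | True => acc
  | _ => fail 100 "lin: not an order hypothesis" t
  end.
Ltac lin_hatoms hs l :=
  lazymatch hs with
  | tt => l
  | pair ?h ?r => let t := type of h in
    let l := lin_sides t ltac:(fun k a b => let l := lin_atoms a l in lin_atoms b l) in
    lin_hatoms r l
  end.
Ltac lin_hreify hs l :=
  lazymatch hs with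
  | tt => constr:(@nil (lkind * lexp))
  | pair ?h ?r => let t := type of h in
    let x := lin_sides t ltac:(fun k a b =>
      let x := lin_reify a l in let y := lin_reify b l in constr:((k, LSub y x))) in
    let r := lin_hreify r l in constr:(cons x r)
  end.
Ltac lin_comb hs cs acc :=
  lazymatch hs with
  | tt => acc
  | pair ?h ?r => lazymatch cs with
    | cons ?c ?cs' =>
      let z := eval vm_compute in (Qeq_bool c 0) in
      let acc := lazymatch z with
      | true => acc
      | _ =>
        let th := type of h in let ta := type of acc in
        lazymatch ta with
        | CRle _ _ _ => lazymatch th with
          | CRle _ _ _ => constr:(lin_le _ _ _ c acc h (eq_refl true))
          | CRlt _ _ _ => constr:(lin_lt _ _ _ c acc h (eq_refl true))
          | _ => constr:(lin_eq _ _ _ c acc h)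
          end
        | _ => lazymatch th with
          | CRle _ _ _ => constr:(lin_le' _ _ _ c acc h (eq_refl true))
          | CRlt _ _ _ => constr:(lin_lt' _ _ _ c acc h (eq_refl true))
          | _ => constr:(lin_eq' _ _ _ c acc h)
          end
        end
      end in lin_comb r cs' acc
    end
  end.
(** Minus the constant to which the combination reduces. When [S] starts from this value, the
    closing identity is exact and [ring] can check it. *)
Definition lin_const (hs : list (lkind * lexp)) (cs : list Q) : Q :=
  Qred (- lcoef nil (fold_right lpoly_add nil
    (map (fun t => lpoly_scale (fst t) (lnorm (snd (snd t)))) (combine cs hs)))).
Ltac lin_begin R k :=
  let p := eval vm_compute in (Qle_bool k 0) in
  lazymatch p with
  | true => constr:(lin_start (R := R) k (eq_refl true))
  | _ => constr:(lin_start' (R := R) k (eq_refl true))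
  end.
Ltac lin_weaken acc :=
  let t := type of acc in
  lazymatch t with CRlt _ _ _ => constr:(CRlt_asym _ _ acc) | _ => acc end.

(** The negated goal serves only to find the certificate. Its multiplier [c0] is then moved to the
    other side, which turns the refutation into a direct proof, valid for strict goals too. If [c0]
    is 0, the hypotheses already contradict each other. *)
Ltac lin_core H :=
  let hs := lin_flat H constr:(tt) in
  lazymatch goal with
  | |- False =>
    let l := lazymatch hs with pair ?h _ => let t := type of h in
      lazymatch t with CRle ?R _ _ => constr:(@nil (CRcarrier R)) | CRlt ?R _ _ => constr:(@nil (CRcarrier R))
                     | CReq ?R _ _ => constr:(@nil (CRcarrier R)) end end in
    let R := lazymatch type of l with list (CRcarrier ?R) => R end in
    let l := lin_hatoms hs l in
    let rs := lin_hreify hs l in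
    let sol := eval vm_compute in (match lsolve rs with Some c => Some (c, lin_const rs c) | None => None end) in
    lazymatch sol with
    | Some (?cs, ?k) =>
      let st := lin_begin R k in
      let acc := lin_comb hs cs st in
      refine (lin_end_false _ acc _); ring
    | None => fail 1 "lin: no certificate"
    end
  | |- CReq _ _ _ => split; lin_core H
  | |- and _ _ => split; lin_core H
  | |- prod _ _ => split; lin_core H
  | |- ?g =>
    let kg := lazymatch g with CRle _ _ _ => KLt | CRlt _ _ _ => KLe end in
    let R := lazymatch g with CRle ?R _ _ => R | CRlt ?R _ _ => R end in
    let a := lazymatch g with CRle _ ?a _ => a | CRlt _ ?a _ => a end in
    let b := lazymatch g with CRle _ _ ?b => b | CRlt _ _ ?b => b end in
    let l := lin_atoms a constr:(@nil (CRcarrier R)) in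
    let l := lin_atoms b l in
    let l := lin_hatoms hs l in
    let rs := lin_hreify hs l in
    let ra := lin_reify a l in let rb := lin_reify b l in
    let rs := constr:(cons (kg, LSub ra rb) rs) in
    let sol := eval vm_compute in (match lsolve rs with Some c => Some (c, lin_const rs c) | None => None end) in
    lazymatch sol with
    | Some (cons ?c0 ?cs, ?k) =>
      let z := eval vm_compute in (Qeq_bool c0 0) in
      lazymatch z with
      | true => exfalso; lin_core H
      | _ =>
        let st := lin_begin R k in
        let acc := lin_comb hs cs st in
        lazymatch g with
        | CRle _ _ _ => let acc := lin_weaken acc in refine (lin_end_le _ _ _ c0 acc (eq_refl true) _); ring
        | CRlt _ _ _ => refine (lin_end_lt _ _ _ c0 acc (eq_refl true) _); ring
        end
      end
    | None => fail 1 "lin: no certificate"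
    end
  end.
Tactic Notation "lin" := lin_core I.
Tactic Notation "lin" uconstr(H) := let h := constr:(H) in lin_core h.

Set Implicit Arguments.
Unset Strict Implicit.
Unset Printing Implicit Defensive.

Section Development.

Context {R : ConstructiveReals}.

Add Ring CR_ring : (@CR_ring_theory R) (morphism (@CR_Q_morph R), constants [CR_cst]).

Local Notation CR := (CRcarrier R).
Local Notation half := (CR_of_Q R (1#2)).
Local Notation INR := (@INR R).

(** * Order and elementary real arithmetic *)

(* [a <= b] is a negation, so it may be proved by comparing arbitrary reals. *)
Lemma CRle_by_cases (x y a b : CR) : (x < y -> a <= b) -> (y <= x -> a <= b) -> a <= b.
Proof.
  intros h1 h2 h. apply h2; [|exact h]. intros h3. exact (h1 h3 h).
Qed.

Lemma CRlt_or (x y z : CR) : x < y -> (x < z) + (z < y).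
Proof. intros h. destruct (CRltLinear R) as [_ c]. exact (c _ _ _ h). Qed.

Lemma CRabs_le_iff (x y : CR) : CRabs R x <= y <-> (- y <= x /\ x <= y).
Proof.
  split.
  - intros h. apply CRabs_def in h. destruct h as [h1 h2]. split; [lin h2|exact h1].
  - intros [h1 h2]. apply (proj1 (CRabs_def R x y)). split; [exact h2|lin h1].
Qed.

Lemma CRabs_bound (x : CR) : - CRabs R x <= x /\ x <= CRabs R x.
Proof. apply CRabs_le_iff. apply CRle_refl. Qed.

Lemma CRle_eps (x y : CR) : (forall e, 0 < e -> x <= y + e) -> x <= y.
Proof.
  intros h k. apply (h (CR_of_Q R (1#2) * (x - y))); lin k.
Qed.

Lemma CRpow_le (x y : CR) n : 0 <= x -> x <= y -> CRpow x n <= CRpow y n.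
Proof.
  intros h0 h. induction n as [|n IH]; simpl; [apply CRle_refl|].
  apply CRle_trans with (x * CRpow y n).
  - apply CRmult_le_compat_l; assumption.
  - apply CRmult_le_compat_r; [|exact h]. apply CRpow_ge_zero. lin (h0, h).
Qed.

Lemma CRmult_le0 (x y : CR) : 0 <= x -> 0 <= y -> 0 <= x * y.
Proof. apply CRmult_le_0_compat. Qed.

Lemma INR_S n : INR (S n) == INR n + 1.
Proof.
  unfold INR. rewrite <- CR_of_Q_plus. apply CR_of_Q_morph. unfold Qeq; cbn [Qnum Qden Qplus]. lia.
Qed.

Lemma INR_0 : INR 0 == 0.
Proof. reflexivity. Qed.

Lemma INR_plus a b : INR (a + b) == INR a + INR b.
Proof.
  unfold INR. rewrite <- CR_of_Q_plus. apply CR_of_Q_morph. unfold Qeq; cbn [Qnum Qden Qplus]. lia.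
Qed.

Lemma INR_pos n : 0 <= INR n.
Proof. apply CR_of_Q_le. unfold Qle; simpl; lia. Qed.

Lemma INR_le a b : (a <= b)%nat -> INR a <= INR b.
Proof. intros h. apply CR_of_Q_le. unfold Qle; simpl; lia. Qed.

(** * Powers of 1/2 and of 2, and the Archimedean property *)

Definition hpow (k : nat) : CR := CRpow (CR_of_Q R (1#2)) k.
Definition tpow (k : nat) : CR := CRpow (CR_of_Q R 2) k.

Lemma hpow_S k : hpow (S k) == CR_of_Q R (1#2) * hpow k.
Proof. reflexivity. Qed.
Lemma tpow_S k : tpow (S k) == CR_of_Q R 2 * tpow k.
Proof. reflexivity. Qed.
Lemma hpow_0 : hpow 0 == 1.
Proof. reflexivity. Qed.
Lemma tpow_0 : tpow 0 == 1.
Proof. reflexivity. Qed.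

Lemma half_pos : 0 < CR_of_Q R (1#2).
Proof. apply CR_of_Q_lt. reflexivity. Qed.

Lemma hpow_pos k : 0 < hpow k.
Proof. apply CRpow_gt_zero. apply half_pos. Qed.

Lemma tpow_pos k : 0 < tpow k.
Proof. apply CRpow_gt_zero. apply CR_of_Q_lt. reflexivity. Qed.

Lemma hpow_tpow k : hpow k * tpow k == 1.
Proof.
  unfold hpow, tpow. rewrite CRpow_mult.
  rewrite (CRpow_proper _ 1).
  - apply CRpow_one.
  - ring.
Qed.

Lemma hpow_plus a b : hpow (a + b) == hpow a * hpow b.
Proof. symmetry. apply CRpow_plus_distr. Qed.
Lemma tpow_plus a b : tpow (a + b) == tpow a * tpow b.
Proof. symmetry. apply CRpow_plus_distr. Qed.

Lemma INR_pow2 k : INR (2 ^ k) == tpow k.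
Proof.
  induction k as [|k IH]; [reflexivity|].
  replace (2 ^ S k)%nat with (2 ^ k + 2 ^ k)%nat by (simpl; lia).
  rewrite tpow_S, INR_plus, IH. ring.
Qed.

Lemma pow2_nz k : (0 < 2 ^ k)%nat.
Proof. pose proof (Nat.pow_nonzero 2 k). lia. Qed.

Lemma INR_lt_tpow n : INR n < tpow n.
Proof.
  rewrite <- INR_pow2. apply CR_of_Q_lt. unfold Qlt; simpl.
  pose proof (Nat.pow_gt_lin_r 2 n). lia.
Qed.

Lemma hpow_le a b : (a <= b)%nat -> hpow b <= hpow a.
Proof.
  intros h. induction h as [|b h IH]; [apply CRle_refl|].
  rewrite hpow_S. pose proof (CRlt_asym _ _ (hpow_pos b)). lin (IH, H).
Qed.

Lemma tpow_le a b : (a <= b)%nat -> tpow a <= tpow b.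
Proof.
  intros h. induction h as [|b h IH]; [apply CRle_refl|].
  rewrite tpow_S. pose proof (tpow_pos b). lin (IH, H).
Qed.

Lemma tpow_above (x : CR) : {k : nat & x < tpow k}.
Proof.
  destruct (CRup_nat x) as [n h]. exists n. pose proof (INR_lt_tpow n). unfold INR in H.
  apply (CRlt_trans _ _ _ h H).
Qed.

Lemma hpow_below (y e : CR) : 0 < e -> {k : nat & hpow k * y < e}.
Proof.
  intros he. assert (hne : CRapart R e 0) by (right; exact he).
  pose proof (CRinv_l R e hne) as hi. pose proof (CRinv_0_lt_compat R e hne he) as hp.
  destruct (tpow_above (CRinv R e hne * y)) as [k hk]. exists k.
  apply (CRmult_lt_compat_l e) in hk; [|exact he].
  apply (CRmult_lt_compat_l (hpow k)) in hk; [|apply hpow_pos].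
  setoid_replace (hpow k * (e * (CRinv R e hne * y))) with (hpow k * y * (CRinv R e hne * e)) in hk by ring.
  rewrite hi in hk.
  setoid_replace (hpow k * (e * tpow k)) with (e * (hpow k * tpow k)) in hk by ring.
  rewrite hpow_tpow in hk. lin hk.
Qed.

Lemma hpow_small (e : CR) : 0 < e -> {k : nat & hpow k < e}.
Proof.
  intros h. destruct (hpow_below 1 h) as [k hk]. exists k. lin hk.
Qed.

(** [CRsum u d] has d + 1 terms, so a sum of n > 0 terms is written with [pred n]; all dyadic grids
    below follow this convention. *)
Lemma CRsum_pred_S (u : nat -> CR) n : (0 < n)%nat ->
  CRsum u (pred (S n)) == CRsum u (pred n) + u n.
Proof. destruct n as [|n]; [lia|]. intros _. reflexivity. Qed.

Lemma CRsum_split (u : nat -> CR) a b : (0 < a)%nat -> (0 < b)%nat ->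
  CRsum u (pred (a + b)) == CRsum u (pred a) + CRsum (fun j => u (a + j)%nat) (pred b).
Proof.
  destruct a as [|a]; [lia|]. destruct b as [|b]; [lia|]. intros _ _.
  replace (pred (S a + S b)) with (S a + b)%nat by lia. apply sum_assoc.
Qed.

(** * Sums over grids *)

Lemma grid_sum_le n (d : Fin.t n -> nat) (F G : (Fin.t n -> nat) -> CR) :
  (forall k, (forall i, (k i <= d i)%nat) -> F k <= G k) -> grid_sum d F <= grid_sum d G.
Proof.
  revert d F G. induction n as [|n IH]; simpl; intros d F G h.
  - apply h. intros i. lia.
  - apply sum_Rle. intros j hj. apply IH. intros k hk. apply h.
    intros i. apply (Fin.caseS' i); [exact hj|exact hk].
Qed.

Lemma grid_sum_eq n (d : Fin.t n -> nat) (F G : (Fin.t n -> nat) -> CR) :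
  (forall k, (forall i, (k i <= d i)%nat) -> F k == G k) -> grid_sum d F == grid_sum d G.
Proof.
  intros h. split; apply grid_sum_le; intros k hk; destruct (h k hk); assumption.
Qed.

Lemma grid_sum_plus n (d : Fin.t n -> nat) (F G : (Fin.t n -> nat) -> CR) :
  grid_sum d (fun k => F k + G k) == grid_sum d F + grid_sum d G.
Proof.
  revert d F G. induction n as [|n IH]; simpl; intros d F G; [reflexivity|].
  rewrite <- sum_plus. apply CRsum_eq. intros j _. apply IH.
Qed.

Lemma grid_sum_scale n (d : Fin.t n -> nat) a (F : (Fin.t n -> nat) -> CR) :
  grid_sum d (fun k => a * F k) == a * grid_sum d F.
Proof.
  revert d F. induction n as [|n IH]; simpl; intros d F; [reflexivity|].
  rewrite (CRmult_comm a), <- sum_scale. apply CRsum_eq. intros j _. rewrite IH. ring.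
Qed.

Lemma grid_sum_const n m (a : CR) :
  grid_sum (fun _ : Fin.t n => m) (fun _ => a) == a * CRpow (INR (S m)) n.
Proof.
  induction n as [|n IH]; simpl; [ring|].
  rewrite (CRsum_eq _ (fun _ => a * CRpow (INR (S m)) n)).
  - rewrite sum_const. ring.
  - intros _ _. exact IH.
Qed.

(** * Sums over the 2^n halves of a cube *)

Fixpoint hsum (n : nat) : ((Fin.t n -> bool) -> CR) -> CR :=
  match n with
  | O => fun G => G (fun _ => false)
  | S m => fun G => hsum (fun h => G (fin_cons false h)) + hsum (fun h => G (fin_cons true h))
  end.

Lemma hsum_le n (G H : (Fin.t n -> bool) -> CR) : (forall h, G h <= H h) -> hsum G <= hsum H.
Proof.
  revert G H. induction n as [|n IH]; simpl; intros G H h; [apply h|].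
  apply CRplus_le_compat; apply IH; intros; apply h.
Qed.

Lemma hsum_eq n (G H : (Fin.t n -> bool) -> CR) : (forall h, G h == H h) -> hsum G == hsum H.
Proof. intros h. split; apply hsum_le; intros k; apply h. Qed.

Lemma hsum_plus n (G H : (Fin.t n -> bool) -> CR) :
  hsum (fun h => G h + H h) == hsum G + hsum H.
Proof.
  revert G H. induction n as [|n IH]; simpl; intros G H; [reflexivity|]. rewrite !IH. ring.
Qed.

Lemma hsum_scale n a (G : (Fin.t n -> bool) -> CR) : hsum (fun h => a * G h) == a * hsum G.
Proof.
  revert G. induction n as [|n IH]; simpl; intros G; [reflexivity|]. rewrite !IH. ring.
Qed.

Lemma hsum_const n (a : CR) : hsum (fun _ : Fin.t n -> bool => a) == tpow n * a.
Proof.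
  induction n as [|n IH]; simpl; [rewrite tpow_0; ring|]. rewrite !IH, tpow_S. ring.
Qed.

(** The sign of a given term is undecidable, but cotransitivity applied to the positive sum leads to
    some positive term. This is the choice made at each halving of a cube. *)
Lemma hsum_pick n (G : (Fin.t n -> bool) -> CR) : 0 < hsum G -> {h : Fin.t n -> bool & 0 < G h}.
Proof.
  revert G. induction n as [|n IH]; simpl; intros G h; [eexists; exact h|].
  destruct (@CRlt_or 0 _ (hsum (fun h => G (fin_cons false h))) h) as [h1|h1].
  - destruct (IH _ h1) as [k hk]. eexists; exact hk.
  - destruct (IH (fun h => G (fin_cons true h))) as [k hk]; [lin h1|]. eexists; exact hk.
Qed.

(** [G] is assumed extensional because rebuilding [h0] from its head and its tail gives a function
    that is only pointwise equal to it. [idx_ext] has the same purpose for multi-indices. *)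
Lemma hsum_term n (G : (Fin.t n -> bool) -> CR) h0 :
  (forall h h', (forall i, h i = h' i) -> G h == G h') ->
  (forall h, 0 <= G h) -> G h0 <= hsum G.
Proof.
  revert G h0. induction n as [|n IH]; simpl; intros G h0 he hp.
  - rewrite (he h0 (fun _ => false)); [apply CRle_refl|]. intros i. inversion i.
  - assert (hz : forall b, 0 <= hsum (fun h => G (fin_cons b h))).
    { intros b. rewrite <- (CRmult_0_r (tpow n)), <- (hsum_const n 0). apply hsum_le. intros; apply hp. }
    assert (hI : G h0 <= hsum (fun h => G (fin_cons (h0 F1) h))).
    { rewrite (he h0 (fin_cons (h0 F1) (fun i => h0 (FS i)))).
      - apply (IH (fun h => G (fin_cons (h0 F1) h))); [|intros; apply hp].
        intros h h' hh. apply he. intros i. apply (Fin.caseS' i); [reflexivity|exact hh].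
      - intros i. apply (Fin.caseS' i); reflexivity. }
    destruct (h0 F1); [pose proof (hz false) as hh|pose proof (hz true) as hh]; lin (hI, hh).
Qed.

Lemma CRsum_hsum n m (G : nat -> (Fin.t n -> bool) -> CR) :
  CRsum (fun j => hsum (G j)) m == hsum (fun h => CRsum (fun j => G j h) m).
Proof.
  induction m as [|m IH]; simpl; [reflexivity|]. rewrite IH, <- hsum_plus. reflexivity.
Qed.

Definition idx_ext n (F : (Fin.t n -> nat) -> CR) : Prop :=
  forall k k', (forall i, k i = k' i) -> F k == F k'.

Lemma grid_sum_split n m (F : (Fin.t n -> nat) -> CR) : (0 < m)%nat -> idx_ext F ->
  grid_sum (fun _ => pred (m + m)) F ==
  hsum (fun h => grid_sum (fun _ => pred m) (fun k => F (fun i => (if h i then m else O) + k i)%nat)).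
Proof.
  intros hm. revert F. induction n as [|n IH]; simpl; intros F hF.
  - apply hF. intros i. inversion i.
  - rewrite CRsum_split by exact hm.
    assert (e : forall (b : bool) j,
      grid_sum (fun _ => pred (m + m)) (fun k => F (fin_cons ((if b then m else O) + j)%nat k)) ==
      hsum (fun h => grid_sum (fun _ => pred m)
        (fun k => F (fun i => (if fin_cons b h i then m else O) + fin_cons j k i)%nat))).
    { intros b j. rewrite (IH (fun k => F (fin_cons ((if b then m else O) + j)%nat k))).
      - apply hsum_eq. intros h. apply grid_sum_eq. intros k _. apply hF.
        intros i. apply (Fin.caseS' i); reflexivity.
      - intros k k' hk. apply hF. intros i. apply (Fin.caseS' i); [reflexivity|exact hk]. }
    apply CRplus_morph.
    + rewrite (CRsum_eq _ (fun j => hsum (fun h => grid_sum (fun _ => pred m)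
        (fun k => F (fun i => (if fin_cons false h i then m else O) + fin_cons j k i)%nat)))).
      * apply CRsum_hsum.
      * intros j _. exact (e false j).
    + rewrite (CRsum_eq _ (fun j => hsum (fun h => grid_sum (fun _ => pred m)
        (fun k => F (fun i => (if fin_cons true h i then m else O) + fin_cons j k i)%nat)))).
      * apply CRsum_hsum.
      * intros j _. exact (e true j).
Qed.

Lemma CRsum_sub (u : nat -> CR) j n m : (0 < n)%nat -> (j + n <= m)%nat ->
  (forall i, (i < m)%nat -> 0 <= u i) -> CRsum (fun i => u (j + i)%nat) (pred n) <= CRsum u (pred m).
Proof.
  intros hn h hu.
  assert (h1 : forall a b, (0 < a)%nat -> (a <= b)%nat -> (b <= m)%nat -> CRsum u (pred a) <= CRsum u (pred b)).
  { intros a b ha hab hb. induction hab as [|b hab IH]; [apply CRle_refl|].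
    rewrite CRsum_pred_S by lia. pose proof (hu b ltac:(lia)) as h0. pose proof (IH ltac:(lia)) as h1.
    lin (h0, h1). }
  apply CRle_trans with (CRsum u (pred (j + n))); [|apply h1; lia].
  destruct j as [|j]; [apply CRle_refl|]. rewrite (@CRsum_split u (S j) n) by lia.
  assert (0 <= CRsum u (pred (S j))).
  { simpl. assert (hj : (S j <= m)%nat) by lia. clear - hu hj. induction j as [|j IH]; simpl.
    - apply hu. lia.
    - pose proof (IH ltac:(lia)) as h0. pose proof (hu (S j) ltac:(lia)) as h1. lin (h0, h1). }
  lin H.
Qed.

Lemma grid_sum_nonneg n (d : Fin.t n -> nat) (F : (Fin.t n -> nat) -> CR) :
  (forall k, (forall i, (k i <= d i)%nat) -> 0 <= F k) -> 0 <= grid_sum d F.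
Proof.
  revert d F. induction n as [|n IH]; simpl; intros d F h.
  - apply h. intros i. lia.
  - assert (h0 : forall j, (j <= d F1)%nat -> 0 <= grid_sum (fun i => d (FS i)) (fun k => F (fin_cons j k))).
    { intros j hj. apply IH. intros k hk. apply h.
      intros i. apply (Fin.caseS' i); [exact hj|exact hk]. }
    rewrite <- (@sum_eq_R0 R (fun _ => 0) (d F1)) by reflexivity. apply sum_Rle. exact h0.
Qed.

Lemma grid_sum_sub n (j : Fin.t n -> nat) a m (F : (Fin.t n -> nat) -> CR) : (0 < a)%nat ->
  (forall i, (j i + a <= m)%nat) -> idx_ext F ->
  (forall k, (forall i, (k i < m)%nat) -> 0 <= F k) ->
  grid_sum (fun _ => pred a) (fun k => F (fun i => j i + k i)%nat) <= grid_sum (fun _ => pred m) F.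
Proof.
  intros ha. revert j F. induction n as [|n IH]; simpl; intros j F hj he hF.
  - rewrite (he _ (fun _ => pred m)); [apply CRle_refl|]. intros i. inversion i.
  - assert (hm : (0 < m)%nat) by (specialize (hj F1); lia).
    apply CRle_trans with (CRsum (fun i => grid_sum (fun _ => pred m) (fun k => F (fin_cons (j F1 + i)%nat k))) (pred a)).
    + apply sum_Rle. intros i hi.
      rewrite (@grid_sum_eq n _ _ (fun k => F (fin_cons (j F1 + i)%nat (fun i => (j (FS i) + k i)%nat)))).
      * apply (IH (fun i => j (FS i)) (fun k => F (fin_cons (j F1 + i)%nat k))).
        -- intros i'. apply hj.
        -- intros k k' hk. apply he. intros i'. apply (Fin.caseS' i'); [reflexivity|exact hk].
        -- intros k hk. apply hF. intros i'. specialize (hj F1). apply (Fin.caseS' i'); [simpl; lia|exact hk].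
      * intros k _. apply he. intros i'. apply (Fin.caseS' i'); reflexivity.
    + apply (@CRsum_sub (fun i => grid_sum (fun _ => pred m) (fun k => F (fin_cons i k)))); [exact ha|apply hj|].
      intros i hi. apply grid_sum_nonneg. intros k hk. apply hF. intros i'.
      apply (Fin.caseS' i'); [exact hi|]. intros p. specialize (hk p). simpl. lia.
Qed.

(** * Averages of uniformly continuous functions over cubes *)

Section Space.

Context {N : nat}.
Implicit Types (x y c s : point R N) (l : CR).

Lemma fin_bound n (u : Fin.t n -> CR) : {B : CR & (0 <= B) * (forall i, u i <= B)}%type.
Proof.
  induction n as [|n IH].
  - exists 0. split; [lin|]. intros i. inversion i.
  - destruct (IH (fun i => u (FS i))) as [B [h0 hB]].
    exists (CRmax (u F1) B). pose proof (CRmax_l (u F1) B). pose proof (CRmax_r (u F1) B).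
    split; [lin (h0, H0)|]. intros i. apply (Fin.caseS' i); [exact H|].
    intros p. specialize (hB p). lin (hB, H0).
Qed.

(** Uniform continuity on bounded sets, in coordinates and hence free of square roots. Test
    functions have it because balls of the sup norm are compact. *)
Definition ucont (f : point R N -> CR) : Type :=
  forall B e, 0 < e -> {d : CR & (0 < d) * (forall x y,
    (forall i, CRabs R (x i) <= B) -> (forall i, CRabs R (y i) <= B) ->
    (forall i, CRabs R (x i - y i) <= d) -> CRabs R (f x - f y) <= e)}%type.

Lemma CRabs_diff_eq (a b : CR) : (forall e, 0 < e -> CRabs R (a - b) <= e) -> a == b.
Proof.
  intros h. split; apply CRle_eps; intros e he; destruct (proj1 (CRabs_le_iff _ _) (h e he)) as [h1 h2'].
  - lin h1.
  - lin h2'.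
Qed.

Lemma ucont_ext f x y : ucont f -> point_eq x y -> f x == f y.
Proof.
  intros hf e. destruct (fin_bound (fun i => CRabs R (x i))) as [B [h0 hB]].
  apply CRabs_diff_eq. intros eps he. destruct (hf B eps he) as [d [hd H]]. apply H.
  - exact hB.
  - intros i. rewrite <- (e i). apply hB.
  - intros i. rewrite (e i). unfold CRminus. rewrite CRplus_opp_r, CRabs_right; [|apply CRle_refl].
    apply CRlt_asym. exact hd.
Qed.

(** The modulus is bundled with the function so that [avg] is a total operation. *)
Record cfun := CFun { cf :> point R N -> CR; cf_uc : ucont cf }.

Lemma cf_ext (f : cfun) x y : point_eq x y -> f x == f y.
Proof. apply ucont_ext. apply cf_uc. Qed.

Lemma CRmin_pos (a b : CR) : 0 < a -> 0 < b -> 0 < CRmin a b.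
Proof. apply CRmin_lt. Qed.

Lemma ucont_combine (f g F : point R N -> CR) : ucont f -> ucont g ->
  (forall x y, CRabs R (F x - F y) <= CRabs R (f x - f y) + CRabs R (g x - g y)) -> ucont F.
Proof.
  intros hf hg h B e he.
  assert (he2 : 0 < half * e) by lin he.
  destruct (hf B _ he2) as [d [hd H]]. destruct (hg B _ he2) as [d' [hd' H']].
  exists (CRmin d d'). split; [apply CRmin_pos; assumption|].
  intros x y hx hy hxy. pose proof (CRmin_l d d') as hl. pose proof (CRmin_r d d') as hr.
  specialize (h x y).
  assert (e1 : CRabs R (f x - f y) <= half * e) by (apply H; try assumption; intros i; apply (CRle_trans _ _ _ (hxy i) hl)).
  assert (e2 : CRabs R (g x - g y) <= half * e) by (apply H'; try assumption; intros i; apply (CRle_trans _ _ _ (hxy i) hr)).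
  lin (h, e1, e2).
Qed.

Lemma ucont_const (a : CR) : ucont (fun _ => a).
Proof.
  intros B e he. exists 1. split; [lin|]. intros x y _ _ _.
  unfold CRminus. rewrite CRplus_opp_r, CRabs_right; [apply CRlt_asym; exact he|apply CRle_refl].
Qed.

Lemma ucont_scale a f : ucont f -> ucont (fun x => a * f x).
Proof.
  intros hf B e he. pose proof (CRabs_pos a) as ha.
  (* Unlike |a|, the number 1 + |a| is certainly invertible. *)
  assert (hp : 0 < 1 + CRabs R a) by lin ha.
  assert (hne : CRapart R (1 + CRabs R a) 0) by (right; exact hp).
  pose proof (CRinv_l R _ hne) as hi. pose proof (CRinv_0_lt_compat R _ hne hp) as hip.
  set (v := CRinv R (1 + CRabs R a) hne) in *.
  destruct (hf B (v * e)) as [d [hd H]]; [apply CRmult_lt_0_compat; assumption|].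
  exists d. split; [exact hd|]. intros x y hx hy hxy.
  setoid_replace (a * f x - a * f y) with (a * (f x - f y)) by ring.
  rewrite CRabs_mult. specialize (H x y hx hy hxy).
  apply CRle_trans with (CRabs R a * (v * e)); [apply CRmult_le_compat_l; assumption|].
  assert (hve : 0 <= v * e) by (apply CRlt_asym; apply CRmult_lt_0_compat; assumption).
  setoid_replace e with ((v * (1 + CRabs R a)) * e) at 2 by (rewrite hi; ring). lin hve.
Qed.

Lemma ucont_plus f g : ucont f -> ucont g -> ucont (fun x => f x + g x).
Proof.
  intros hf hg. apply (ucont_combine hf hg). intros x y.
  setoid_replace (f x + g x - (f y + g y)) with ((f x - f y) + (g x - g y)) by ring. apply CRabs_triang.
Qed.

Lemma CRmax_lip (a b a' b' : CR) :
  CRabs R (CRmax a b - CRmax a' b') <= CRabs R (a - a') + CRabs R (b - b').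
Proof.
  pose proof (CRmax_contract a a' b) as h1. pose proof (CRmax_contract b b' a') as h2'.
  rewrite (CRmax_sym b), (CRmax_sym b') in h2'.
  setoid_replace (CRmax a b - CRmax a' b') with ((CRmax a b - CRmax a' b) + (CRmax a' b - CRmax a' b')) by ring.
  pose proof (CRabs_triang (CRmax a b - CRmax a' b) (CRmax a' b - CRmax a' b')) as h3. lin (h1, h2', h3).
Qed.

Lemma CRmin_lip (a b a' b' : CR) :
  CRabs R (CRmin a b - CRmin a' b') <= CRabs R (a - a') + CRabs R (b - b').
Proof.
  pose proof (CRmin_contract a a' b) as h1. pose proof (CRmin_contract b b' a') as h2'.
  rewrite (CRmin_sym b), (CRmin_sym b') in h2'.
  setoid_replace (CRmin a b - CRmin a' b') with ((CRmin a b - CRmin a' b) + (CRmin a' b - CRmin a' b')) by ring.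
  pose proof (CRabs_triang (CRmin a b - CRmin a' b) (CRmin a' b - CRmin a' b')) as h3. lin (h1, h2', h3).
Qed.

Lemma ucont_max f g : ucont f -> ucont g -> ucont (fun x => CRmax (f x) (g x)).
Proof. intros hf hg. apply (ucont_combine hf hg). intros x y. apply CRmax_lip. Qed.

Lemma ucont_min f g : ucont f -> ucont g -> ucont (fun x => CRmin (f x) (g x)).
Proof. intros hf hg. apply (ucont_combine hf hg). intros x y. apply CRmin_lip. Qed.

Lemma ucont_abs f : ucont f -> ucont (fun x => CRabs R (f x)).
Proof.
  intros hf B e he. destruct (hf B e he) as [d [hd H]]. exists d. split; [exact hd|].
  intros x y hx hy hxy. apply CRle_trans with (2 := H x y hx hy hxy). apply CRabs_triang_inv2.
Qed.

Definition shrink q s x : point R N := fun i => hpow q * x i + (1 - hpow q) * s i.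

Lemma hpow_le1 q : hpow q <= 1.
Proof. rewrite <- (hpow_0). apply hpow_le. lia. Qed.

Lemma CRabs_prod_le (a b B : CR) : 0 <= a -> CRabs R b <= B -> CRabs R (a * b) <= a * B.
Proof.
  intros ha hb. rewrite CRabs_mult, (CRabs_right a ha). apply CRmult_le_compat_l; assumption.
Qed.

Lemma ucont_shrink q s f : ucont f -> ucont (fun x => f (shrink q s x)).
Proof.
  intros hf B e he. destruct (fin_bound (fun i => CRabs R (s i))) as [D [h0 hD]].
  destruct (hf (CRmax B 0 + D) e he) as [d [hd H]]. exists d. split; [exact hd|].
  pose proof (hpow_pos q) as hq. pose proof (@hpow_le1 q) as hq1.
  pose proof (CRmax_l B 0) as hm. pose proof (CRmax_r B 0) as hm0.
  assert (bnd : forall x, (forall i, CRabs R (x i) <= B) -> forall i, CRabs R (shrink q s x i) <= CRmax B 0 + D).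
  { intros x hx i. unfold shrink. apply CRle_trans with (1 := CRabs_triang _ _).
    assert (k1 : CRabs R (hpow q * x i) <= hpow q * CRmax B 0).
    { apply CRabs_prod_le; [apply CRlt_asym; exact hq|]. apply CRle_trans with B; [apply hx|exact hm]. }
    assert (k2 : CRabs R ((1 - hpow q) * s i) <= (1 - hpow q) * D).
    { apply CRabs_prod_le; [lin hq1|apply hD]. }
    assert (k3 : 0 <= (1 - hpow q) * CRmax B 0) by (apply CRmult_le0; [lin hq1|exact hm0]).
    assert (k4 : 0 <= hpow q * D) by (apply CRmult_le0; [lin hq|exact h0]).
    lin (k1, k2, k3, k4). }
  intros x y hx hy hxy. apply H.
  - apply bnd. exact hx.
  - apply bnd. exact hy.
  - intros i. unfold shrink.
    setoid_replace (hpow q * x i + (1 - hpow q) * s i - (hpow q * y i + (1 - hpow q) * s i)) with (hpow q * (x i - y i)) by ring.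
    apply CRle_trans with (hpow q * d); [apply CRabs_prod_le; [apply CRlt_asym; exact hq|apply hxy]|].
    assert (0 <= (1 - hpow q) * d) by (apply CRmult_le0; [lin hq1|lin hd]). lin H0.
Qed.

Definition cconst a : cfun := CFun (ucont_const a).
Definition cadd (f g : cfun) : cfun := CFun (ucont_plus (cf_uc f) (cf_uc g)).
Definition cscale a (f : cfun) : cfun := CFun (ucont_scale a (cf_uc f)).
Definition csub (f g : cfun) : cfun := cadd f (cscale (-(1)) g).
Definition cmax (f g : cfun) : cfun := CFun (ucont_max (cf_uc f) (cf_uc g)).
Definition cmin (f g : cfun) : cfun := CFun (ucont_min (cf_uc f) (cf_uc g)).
Definition cabs (f : cfun) : cfun := CFun (ucont_abs (cf_uc f)).
Definition cshrink q s (f : cfun) : cfun := CFun (ucont_shrink q s (cf_uc f)).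
Fixpoint csum (f : nat -> cfun) (n : nat) : cfun :=
  match n with O => f O | S m => cadd (csum f m) (f (S m)) end.

Lemma csum_val f n x : csum f n x = CRsum (fun k => f k x) n.
Proof. induction n as [|n IH]; simpl; [reflexivity|]. rewrite IH. reflexivity. Qed.

(** * Averages over dyadic grids and their limit *)

Definition in_cube c l x : Prop := forall i, c i <= x i /\ x i <= c i + l.

Definition gpt c l k (j : Fin.t N -> nat) : point R N := fun i => c i + l * (hpow k * INR (j i)).

(* The average of f over the lower corners of the 2^(kN) dyadic subcubes of the cube. *)
Definition avgk k (f : point R N -> CR) c l : CR :=
  CRpow (hpow k) N * grid_sum (fun _ => pred (2 ^ k)) (fun j => f (gpt c l k j)).

Lemma frac_range k j : (j <= pred (2 ^ k))%nat -> 0 <= hpow k * INR j /\ hpow k * INR j <= 1.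
Proof.
  intros h. pose proof (hpow_pos k) as hp. split.
  - apply CRmult_le0; [lin hp|apply INR_pos].
  - rewrite <- (hpow_tpow k), <- INR_pow2. apply CRmult_le_compat_l; [lin hp|].
    apply INR_le. pose proof (pow2_nz k). lia.
Qed.

Lemma gpt_cube c l k j : 0 <= l -> (forall i, (j i <= pred (2 ^ k))%nat) -> in_cube c l (gpt c l k j).
Proof.
  intros hl hj i. destruct (frac_range (hj i)) as [h0 h1]. unfold gpt.
  set (u := hpow k * INR (j i)) in *.
  pose proof (CRmult_le0 hl h0) as a. assert (b : 0 <= l * (1 - u)) by (apply CRmult_le0; [exact hl|lin h1]).
  split; [lin a|lin b].
Qed.

Lemma gpt_ball c l k j : (forall i, (j i <= pred (2 ^ k))%nat) ->
  forall i, CRabs R (gpt c l k j i - c i) <= CRabs R l.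
Proof.
  intros hj i. destruct (frac_range (hj i)) as [h0 h1]. unfold gpt.
  set (u := hpow k * INR (j i)) in *.
  setoid_replace (c i + l * u - c i) with (u * l) by ring.
  rewrite CRabs_mult, (CRabs_right u h0).
  assert (0 <= (1 - u) * CRabs R l) by (apply CRmult_le0; [lin h1|apply CRabs_pos]). lin H.
Qed.

Lemma avgk_norm k : CRpow (hpow k) N * CRpow (INR (S (pred (2 ^ k)))) N == 1.
Proof.
  replace (S (pred (2 ^ k))) with (2 ^ k)%nat by (pose proof (pow2_nz k); lia).
  rewrite CRpow_mult, (CRpow_proper _ 1); [apply CRpow_one|]. rewrite INR_pow2. apply hpow_tpow.
Qed.

Lemma hpow_nonneg k : 0 <= CRpow (hpow k) N.
Proof. apply CRpow_ge_zero. apply CRlt_asym, hpow_pos. Qed.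

Lemma avgk_const k a c l : avgk k (fun _ => a) c l == a.
Proof.
  unfold avgk. rewrite grid_sum_const.
  setoid_replace (CRpow (hpow k) N * (a * CRpow (INR (S (pred (2 ^ k)))) N)) with
    (a * (CRpow (hpow k) N * CRpow (INR (S (pred (2 ^ k)))) N)) by ring.
  rewrite avgk_norm. ring.
Qed.

Lemma avgk_mono_grid k f g c l : (forall j, (forall i, (j i <= pred (2 ^ k))%nat) ->
  f (gpt c l k j) <= g (gpt c l k j)) -> avgk k f c l <= avgk k g c l.
Proof.
  intros h. unfold avgk. apply CRmult_le_compat_l; [apply hpow_nonneg|].
  apply grid_sum_le. exact h.
Qed.

Lemma avgk_le k f g c l : 0 <= l -> (forall x, in_cube c l x -> f x <= g x) ->
  avgk k f c l <= avgk k g c l.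
Proof. intros hl h. apply avgk_mono_grid. intros j hj. apply h. apply gpt_cube; assumption. Qed.

Lemma avgk_plus k f g c l : avgk k (fun x => f x + g x) c l == avgk k f c l + avgk k g c l.
Proof. unfold avgk. rewrite grid_sum_plus. ring. Qed.

Lemma avgk_scale k a f c l : avgk k (fun x => a * f x) c l == a * avgk k f c l.
Proof. unfold avgk. rewrite grid_sum_scale. ring. Qed.

Definition child c l (h : Fin.t N -> bool) : point R N :=
  fun i => c i + (if h i then half * l else 0).

(** Because only lower corners are sampled, the grid of level k + 1 is exactly the disjoint union of
    the level k grids of the 2^N halves. *)
Lemma avgk_halve k (f : cfun) c l :
  tpow N * avgk (S k) f c l == hsum (fun h => avgk k f (child c l h) (half * l)).
Proof.
  unfold avgk. replace (2 ^ S k)%nat with (2 ^ k + 2 ^ k)%nat by (simpl; lia).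
  rewrite grid_sum_split.
  - rewrite hsum_scale.
    setoid_replace (CRpow (hpow (S k)) N) with (hpow N * CRpow (hpow k) N).
    + setoid_replace (tpow N * (hpow N * CRpow (hpow k) N *
        hsum (fun h => grid_sum (fun _ => pred (2 ^ k)) (fun k0 => f (gpt c l (S k) (fun i => ((if h i then (2 ^ k)%nat else 0%nat) + k0 i)%nat))))))
      with ((hpow N * tpow N) * CRpow (hpow k) N *
        hsum (fun h => grid_sum (fun _ => pred (2 ^ k)) (fun k0 => f (gpt c l (S k) (fun i => ((if h i then (2 ^ k)%nat else 0%nat) + k0 i)%nat))))) by ring.
      rewrite hpow_tpow, CRmult_1_l. apply CRmult_morph; [reflexivity|].
      apply hsum_eq. intros h. apply grid_sum_eq. intros j _. apply cf_ext.
      intros i. unfold gpt, child. rewrite INR_plus, hpow_S. destruct (h i).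
      * rewrite INR_pow2.
        setoid_replace (c i + l * (half * hpow k * (tpow k + INR (j i)))) with
          (c i + half * l * (hpow k * tpow k) + half * l * (hpow k * INR (j i))) by ring.
        rewrite hpow_tpow. ring.
      * rewrite INR_0. ring.
    + unfold hpow. rewrite CRpow_mult. apply CRpow_proper. reflexivity.
  - apply pow2_nz.
  - intros j j' hj. apply cf_ext. intros i. unfold gpt. rewrite (hj i). reflexivity.
Qed.

Lemma CRabs_half l : CRabs R (half * l) == half * CRabs R l.
Proof. rewrite CRabs_mult, CRabs_right; [reflexivity|]. pose proof (half_pos). lin H. Qed.

(** Halving both averages passes from k to k - 1 on each half; at level 0 the average is the value
    at the corner [c]. The hypothesis involves |l| because averages are defined for sides of any
    sign. *)
Lemma avgk_osc k p (f : cfun) c l e : (k <= p)%nat ->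
  (forall x y, (forall i, CRabs R (x i - c i) <= CRabs R l) -> (forall i, CRabs R (y i - c i) <= CRabs R l) ->
     (forall i, CRabs R (x i - y i) <= CRabs R l * hpow k) -> CRabs R (f x - f y) <= e) ->
  CRabs R (avgk p f c l - avgk k f c l) <= e.
Proof.
  revert p c l. induction k as [|k IH]; intros p c l hp H.
  - assert (h0 : forall i, CRabs R (c i - c i) <= CRabs R l).
    { intros i. unfold CRminus. rewrite CRplus_opp_r, CRabs_right; [apply CRabs_pos|apply CRle_refl]. }
    assert (e0 : avgk 0 f c l == f c).
    { rewrite <- (avgk_const 0 (f c) c l). unfold avgk. apply CRmult_morph; [reflexivity|].
      apply grid_sum_eq. intros j hj. apply cf_ext. intros i. unfold gpt.
      specialize (hj i). replace (j i) with O by (simpl in hj; lia). rewrite INR_0. ring. }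
    assert (hb : forall j, (forall i, (j i <= pred (2 ^ p))%nat) -> CRabs R (f (gpt c l p j) - f c) <= e).
    { intros j hj. apply H.
      - apply gpt_ball. exact hj.
      - exact h0.
      - intros i. rewrite hpow_0, CRmult_1_r. apply gpt_ball. exact hj. }
    rewrite e0. apply CRabs_le_iff. split.
    + assert (f c - e <= avgk p f c l); [|lin H0].
      rewrite <- (avgk_const p (f c - e) c l). apply avgk_mono_grid. intros j hj.
      destruct (proj1 (CRabs_le_iff _ _) (hb j hj)) as [a _]. lin a.
    + assert (avgk p f c l <= f c + e); [|lin H0].
      rewrite <- (avgk_const p (f c + e) c l). apply avgk_mono_grid. intros j hj.
      destruct (proj1 (CRabs_le_iff _ _) (hb j hj)) as [_ a]. lin a.
  - destruct p as [|p]; [lia|].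
    assert (hc : forall h, CRabs R (avgk p f (child c l h) (half * l) - avgk k f (child c l h) (half * l)) <= e).
    { intros h. apply IH; [lia|]. 
      assert (hh : forall x, (forall i, CRabs R (x i - child c l h i) <= CRabs R (half * l)) ->
                forall i, CRabs R (x i - c i) <= CRabs R l).
      { intros x hx i. specialize (hx i). unfold child in hx.
        set (w := if h i then half * l else 0) in hx.
        assert (hw : CRabs R w <= half * CRabs R l).
        { unfold w. destruct (h i); [rewrite CRabs_half; apply CRle_refl|].
          rewrite CRabs_right by apply CRle_refl. pose proof (CRabs_pos l). lin H0. }
        rewrite CRabs_half in hx. pose proof (CRabs_triang (x i - (c i + w)) w) as ht.
        setoid_replace (x i - (c i + w) + w) with (x i - c i) in ht by ring. lin (hx, hw, ht). }
      intros x y hx hy hxy. apply H.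
      - apply hh. exact hx.
      - apply hh. exact hy.
      - intros i. specialize (hxy i). rewrite CRabs_half in hxy. rewrite hpow_S. lin hxy. }
    pose proof (avgk_halve p f c l) as a1. pose proof (avgk_halve k f c l) as a2.
    pose proof (tpow_pos N) as ht.
    apply CRabs_le_iff. split; apply (CRmult_le_reg_l (tpow N)); try exact ht.
    + assert (hsum (fun h => avgk k f (child c l h) (half * l) + (-e)) <= hsum (fun h => avgk p f (child c l h) (half * l))).
      { apply hsum_le. intros h. destruct (proj1 (CRabs_le_iff _ _) (hc h)) as [u _]. lin u. }
      rewrite hsum_plus, hsum_const in H0. lin (a1, a2, H0).
    + assert (hsum (fun h => avgk p f (child c l h) (half * l)) <= hsum (fun h => avgk k f (child c l h) (half * l) + e)).
      { apply hsum_le. intros h. destruct (proj1 (CRabs_le_iff _ _) (hc h)) as [_ u]. lin u. }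
      rewrite hsum_plus, hsum_const in H0. lin (a1, a2, H0).
Qed.

Lemma avgk_modulus (f : cfun) c l e : 0 < e ->
  {k : nat | forall p, (k <= p)%nat -> CRabs R (avgk p f c l - avgk k f c l) <= e}.
Proof.
  intros he. destruct (fin_bound (fun i => CRabs R (c i))) as [B [h0 hB]].
  destruct (cf_uc f (B + CRabs R l) he) as [d [hd H]].
  destruct (hpow_below (CRabs R l) hd) as [k hk]. exists k. intros p hp.
  apply avgk_osc; [exact hp|].
  assert (bnd : forall x, (forall i, CRabs R (x i - c i) <= CRabs R l) -> forall i, CRabs R (x i) <= B + CRabs R l).
  { intros x hx i. pose proof (CRabs_triang (x i - c i) (c i)) as ht.
    setoid_replace (x i - c i + c i) with (x i) in ht by ring. specialize (hx i). specialize (hB i). lin (ht, hx, hB). }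
  intros x y hx hy hxy. apply H; [apply bnd; exact hx|apply bnd; exact hy|].
  intros i. specialize (hxy i). lin (hxy, hk).
Qed.

Lemma avg_cauchy (f : cfun) c l : CR_cauchy R (fun k => avgk k f c l).
Proof.
  intros p. assert (he : 0 < CR_of_Q R (1 # (2 * p))) by (apply CR_of_Q_lt; reflexivity).
  destruct (@avgk_modulus f c l _ he) as [k hk]. exists k. intros i j hi hj.
  pose proof (hk i hi) as a. pose proof (hk j hj) as b. rewrite CRabs_minus_sym in b.
  pose proof (CRabs_triang (avgk i f c l - avgk k f c l) (avgk k f c l - avgk j f c l)) as t.
  setoid_replace (avgk i f c l - avgk k f c l + (avgk k f c l - avgk j f c l)) with (avgk i f c l - avgk j f c l) in t by ring.
  assert (q : CR_of_Q R (1 # p) == CR_of_Q R (1 # (2 * p)) + CR_of_Q R (1 # (2 * p))).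
  { rewrite <- CR_of_Q_plus. apply CR_of_Q_morph. unfold Qeq; cbn [Qnum Qden Qplus]; lia. }
  rewrite q. lin (a, b, t).
Qed.

Definition avg (f : cfun) c l : CR := projT1 (CR_complete R _ (@avg_cauchy f c l)).

Lemma avg_cv (f : cfun) c l : CR_cv R (fun k => avgk k f c l) (avg f c l).
Proof. exact (projT2 (CR_complete R _ (@avg_cauchy f c l))). Qed.

Lemma avg_unique (f : cfun) c l v : CR_cv R (fun k => avgk k f c l) v -> avg f c l == v.
Proof. intros h. apply (CR_cv_unique _ _ _ (@avg_cv f c l) h). Qed.

Lemma avg_plus (f g : cfun) c l : avg (cadd f g) c l == avg f c l + avg g c l.
Proof.
  apply avg_unique. apply CR_cv_eq with (fun k => avgk k f c l + avgk k g c l).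
  - intros k. symmetry. exact (avgk_plus k f g c l).
  - apply CR_cv_plus; apply avg_cv.
Qed.

Lemma avg_scale a (f : cfun) c l : avg (cscale a f) c l == a * avg f c l.
Proof.
  apply avg_unique. apply CR_cv_eq with (fun k => avgk k f c l * a).
  - intros k. rewrite CRmult_comm. symmetry. exact (avgk_scale k a f c l).
  - rewrite CRmult_comm. apply CR_cv_scale. apply avg_cv.
Qed.

Lemma avg_sub (f g : cfun) c l : avg (csub f g) c l == avg f c l - avg g c l.
Proof. unfold csub. rewrite avg_plus, avg_scale. ring. Qed.

Lemma avg_const a c l : avg (cconst a) c l == a.
Proof.
  apply avg_unique. apply CR_cv_eq with (fun _ => a); [|apply CR_cv_const].
  intros k. symmetry. exact (avgk_const k a c l).
Qed.

Lemma avg_le (f g : cfun) c l : 0 <= l -> (forall x, in_cube c l x -> f x <= g x) ->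
  avg f c l <= avg g c l.
Proof.
  intros hl h. apply (CR_cv_le (fun k => avgk k f c l) (fun k => avgk k g c l)); try apply avg_cv.
  intros k. apply avgk_le; assumption.
Qed.

Lemma avg_nonneg (f : cfun) c l : 0 <= l -> (forall x, in_cube c l x -> 0 <= f x) -> 0 <= avg f c l.
Proof.
  intros hl h. rewrite <- (avg_const 0 c l). apply avg_le; [exact hl|]. exact h.
Qed.

Lemma avg_eq (f g : cfun) c l : (forall x, f x == g x) -> avg f c l == avg g c l.
Proof.
  intros h. apply avg_unique. apply CR_cv_eq with (fun k => avgk k g c l); [|apply avg_cv].
  intros k. unfold avgk. apply CRmult_morph; [reflexivity|]. apply grid_sum_eq. intros; symmetry; apply h.
Qed.

Lemma avg_csum (f : nat -> cfun) n c l : avg (csum f n) c l == CRsum (fun k => avg (f k) c l) n.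
Proof. induction n as [|n IH]; simpl; [reflexivity|]. rewrite avg_plus, IH. reflexivity. Qed.

Lemma hsum_cv n (G : nat -> (Fin.t n -> bool) -> CR) (g : (Fin.t n -> bool) -> CR) :
  (forall h, CR_cv R (fun k => G k h) (g h)) -> CR_cv R (fun k => hsum (G k)) (hsum g).
Proof.
  revert G g. induction n as [|n IH]; simpl; intros G g h; [apply h|].
  apply CR_cv_plus.
  - apply (IH (fun k h => G k (fin_cons false h))). intros; apply h.
  - apply (IH (fun k h => G k (fin_cons true h))). intros; apply h.
Qed.

Lemma avg_halve (f : cfun) c l :
  tpow N * avg f c l == hsum (fun h => avg f (child c l h) (half * l)).
Proof.
  apply (CR_cv_unique (fun k => avgk (S k) f c l * tpow N)).
  - rewrite CRmult_comm. apply CR_cv_scale.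
    apply CR_cv_eq with (fun n => avgk (n + 1) f c l); [intros n; rewrite Nat.add_1_r; reflexivity|].
    apply (CR_cv_shift' (fun n => avgk n f c l)). apply avg_cv.
  - apply CR_cv_eq with (fun k => hsum (fun h => avgk k f (child c l h) (half * l))).
    + intros k. rewrite <- avgk_halve. ring.
    + apply (hsum_cv (G := fun k h => avgk k f (child c l h) (half * l))). intros h. apply avg_cv.
Qed.

Lemma avg_shrink q s (f : cfun) c l :
  avg (cshrink q s f) c l == avg f (shrink q s c) (hpow q * l).
Proof.
  apply avg_unique. apply CR_cv_eq with (fun k => avgk k f (shrink q s c) (hpow q * l)); [|apply avg_cv].
  intros k. unfold avgk. apply CRmult_morph; [reflexivity|]. apply grid_sum_eq. intros j _.
  apply (cf_ext f). intros i. unfold shrink, gpt. ring.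
Qed.

Lemma avg_point_eq (f : cfun) c c' l l' : point_eq c c' -> l == l' -> avg f c l == avg f c' l'.
Proof.
  intros hc hl. apply avg_unique. apply CR_cv_eq with (fun k => avgk k f c' l'); [|apply avg_cv].
  intros k. unfold avgk. apply CRmult_morph; [reflexivity|]. apply grid_sum_eq. intros j _.
  apply cf_ext. intros i. unfold gpt. rewrite (hc i), hl. reflexivity.
Qed.

End Space.

(** * Points of convergence of a series dominated in mean *)

Section Positivity.

Context {N : nat}.
Implicit Types (x y c s : point R N) (l : CR).

Lemma CRsum_nonneg_le (u : nat -> CR) V n : (forall k, 0 <= u k) -> series_cv u V -> CRsum u n <= V.
Proof.
  intros h0 h. apply (growing_ineq (CRsum u)); [|exact h].
  intros k. simpl. specialize (h0 (S k)). lin h0.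
Qed.

Lemma cube_osc (f : cfun (N := N)) c l e : 0 < e ->
  {d : CR & (0 < d) * (forall x y, in_cube c l x -> in_cube c l y ->
     (forall i, CRabs R (x i - y i) <= d) -> CRabs R (f x - f y) <= e)}%type.
Proof.
  intros he. destruct (fin_bound (fun i => CRabs R (c i))) as [B [h0 hB]].
  destruct (cf_uc f (B + CRabs R l) he) as [d [hd H]]. exists d. split; [exact hd|].
  assert (hb : forall x, in_cube c l x -> forall i, CRabs R (x i) <= B + CRabs R l).
  { intros x hx i. destruct (hx i) as [a b]. specialize (hB i).
    pose proof (CRabs_bound (c i)) as cb. pose proof (CRabs_bound l) as lb.
    apply CRabs_le_iff. split; lin (a, b, hB, cb, lb). }
  intros x y hx hy. apply H; apply hb; assumption.
Qed.

(** * Successive halving of a cube *)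

Section Nested.

Variables (F : cfun (N := N)) (H : nat -> cfun (N := N)) (c : point R N) (l : CR).
Hypothesis hl : 0 <= l.
Hypothesis hH : forall n x, in_cube c l x -> 0 <= H n x.

(** The invariant of the halving. Only the strictness of [V < avg F] is carried along, with no lower
    bound for the margin, which is why the limit point satisfies a weak inequality. *)
Definition nested_state (k : nat) : Type :=
  {c' : point R N & {V : CR &
    prod (prod (series_cv (fun n => avg (H n) c' (hpow k * l)) V) (V < avg F c' (hpow k * l)))
    (forall i, c i <= c' i /\ c' i + hpow k * l <= c i + l)}}.

(** 2^N times an average is the sum of the averages over the halves, for [F] and for the sum of the
    [H n] alike. Hence the margins over the halves add up to 2^N times a positive number, and one of
    them can be found positive. *)
Lemma nested_step k (st : nested_state k) :
  {st' : nested_state (S k) & forall i, projT1 st i <= projT1 st' i /\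
     projT1 st' i + hpow (S k) * l <= projT1 st i + hpow k * l}.
Proof.
  destruct st as [c' [V [[hV hlt] hin]]].
  set (l' := hpow k * l) in *.
  assert (hl' : 0 <= l') by (apply CRmult_le0; [apply CRlt_asym, hpow_pos|exact hl]).
  assert (hchild : forall h i, c' i <= child c' l' h i /\ child c' l' h i + half * l' <= c' i + l').
  { intros h i. unfold child. destruct (h i); split; lin hl'. }
  assert (hnn : forall n h, 0 <= avg (H n) (child c' l' h) (half * l')).
  { intros n h. apply avg_nonneg; [lin hl'|]. intros x hx. apply hH. intros i.
    specialize (hx i). specialize (hchild h i). specialize (hin i). split; lin (hx, hchild, hin). }
  assert (hext : forall (f : cfun) h h', (forall i, h i = h' i) ->
    avg f (child c' l' h) (half * l') == avg f (child c' l' h') (half * l')).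
  { intros f h h' e. apply avg_point_eq; [|reflexivity]. intros i. unfold child. rewrite (e i). reflexivity. }
  (* By positivity, the average over a half is at most 2^N times the average over the whole cube. *)
  assert (hcv : forall h, {W : CR & series_cv (fun n => avg (H n) (child c' l' h) (half * l')) W}).
  { intros h. destruct (@series_cv_maj R (fun n => avg (H n) (child c' l' h) (half * l'))
      (fun n => avg (H n) c' l' * tpow N) (V * tpow N)) as [W [hW _]].
    - intros n. rewrite CRabs_right by apply hnn. rewrite (CRmult_comm (avg (H n) c' l')), avg_halve.
      apply (hsum_term (G := fun h => avg (H n) (child c' l' h) (half * l'))).
      + apply hext.
      + apply hnn.
    - apply series_cv_scale. exact hV.
    - exists W. exact hW. }
  assert (hs : hsum (fun h => projT1 (hcv h)) == tpow N * V).
  { apply (CR_cv_unique (fun n => hsum (fun h => CRsum (fun j => avg (H j) (child c' l' h) (half * l')) n))).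
    - apply (hsum_cv (G := fun n h => CRsum (fun j => avg (H j) (child c' l' h) (half * l')) n)).
      intros h. exact (projT2 (hcv h)).
    - apply CR_cv_proper with (V * tpow N); [|ring].
      apply CR_cv_eq with (fun n => CRsum (fun j => avg (H j) c' l') n * tpow N).
      + intros n. rewrite <- sum_scale. rewrite <- (CRsum_hsum n (fun j h => avg (H j) (child c' l' h) (half * l'))).
        apply CRsum_eq. intros j _. rewrite (CRmult_comm (avg (H j) c' l')). apply avg_halve.
      + apply CR_cv_scale. exact hV. }
  destruct (@hsum_pick N (fun h => avg F (child c' l' h) (half * l') + (-(1)) * projT1 (hcv h))) as [h hh].
  { rewrite hsum_plus, hsum_scale, hs, <- avg_halve.
    apply (CRmult_lt_compat_l (tpow N)) in hlt; [|apply tpow_pos]. lin hlt. }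
  assert (he : half * l' == hpow (S k) * l) by (rewrite hpow_S; unfold l'; ring).
  unshelve eexists.
  - exists (child c' l' h), (projT1 (hcv h)). split; [split|].
    + apply series_cv_eq with (fun n => avg (H n) (child c' l' h) (half * l')); [|exact (projT2 (hcv h))].
      intros n. apply avg_point_eq; [intros i; reflexivity|exact he].
    + rewrite <- (avg_point_eq (c := child c' l' h) (c' := child c' l' h) F (fun i => CReq_refl _) he). lin hh.
    + intros i. specialize (hchild h i). specialize (hin i). split; lin (hchild, hin, he).
  - intros i. cbn [projT1]. specialize (hchild h i). split; lin (hchild, he).
Qed.

Fixpoint nested_seq (st0 : nested_state 0) (k : nat) : nested_state k :=
  match k with O => st0 | S m => projT1 (nested_step (nested_seq st0 m)) end.

(** Averages control values through continuity, which is at hand only for finitely many [H n]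
    together. The conclusion therefore bounds the partial sums; convergence is obtained separately
    in [convergence_point]. *)
Lemma nested_point (st0 : nested_state 0) :
  {x : point R N & in_cube c l x * (forall K, CRsum (fun n => H n x) K <= F x)}%type.
Proof.
  set (cc := fun k => projT1 (nested_seq st0 k)).
  assert (hlk : forall k, 0 <= hpow k * l) by (intros k; apply CRmult_le0; [apply CRlt_asym, hpow_pos|exact hl]).
  assert (hstep : forall k p, (k <= p)%nat -> forall i, cc k i <= cc p i /\ cc p i + hpow p * l <= cc k i + hpow k * l).
  { intros k p h. induction h as [|p h IH]; intros i; [split; lin|].
    specialize (IH i). pose proof (projT2 (nested_step (nested_seq st0 p)) i) as hp.
    change (projT1 (projT1 (nested_step (nested_seq st0 p)))) with (cc (S p)) in hp.
    change (projT1 (nested_seq st0 p)) with (cc p) in hp. split; lin (IH, hp). }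
  assert (hcau : forall i, CR_cauchy R (fun k => cc k i)).
  { intros i p. destruct (@hpow_below l (CR_of_Q R (1 # p))) as [k hk]; [apply CR_of_Q_lt; reflexivity|].
    exists k. intros a b ha hb. pose proof (hstep k a ha i). pose proof (hstep k b hb i).
    pose proof (hlk a). pose proof (hlk b).
    apply CRabs_le_iff. split; lin (H0, H1, H2, H3, hk). }
  set (x := fun i => projT1 (CR_complete R _ (hcau i))).
  assert (hx : forall k, in_cube (cc k) (hpow k * l) x).
  { intros k i. pose proof (projT2 (CR_complete R _ (hcau i))) as hc. split.
    - apply (CR_cv_bound_down _ _ _ k) with (2 := hc). intros p hp. apply (hstep k p hp i).
    - apply (CR_cv_bound_up _ _ _ k) with (2 := hc). intros p hp.
      pose proof (hstep k p hp i). pose proof (hlk p). lin (H0, H1). }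
  assert (hin : forall k i, c i <= cc k i /\ cc k i + hpow k * l <= c i + l).
  { intros k i. unfold cc. destruct (nested_seq st0 k) as [c' [V [[? ?] hin]]]. apply hin. }
  assert (hsub : forall k y, in_cube (cc k) (hpow k * l) y -> in_cube c l y).
  { intros k y hy i. specialize (hy i). specialize (hin k i). split; lin (hy, hin). }
  exists x. split; [apply (hsub O); apply hx|].
  intros K. apply CRle_eps. intros e he.
  (* On every cube of the sequence the average of [Psi] is nonnegative, and on a small enough one
     [Psi] is at most Psi x + e. *)
  set (Psi := csub F (csum H K)).
  destruct (cube_osc Psi c l he) as [d [hd hosc]].
  destruct (@hpow_below l d hd) as [k hk].
  assert (hpos : 0 <= avg Psi (cc k) (hpow k * l)).
  { unfold Psi. rewrite avg_sub, avg_csum. unfold cc.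
    pose proof (fun y => hsub k y) as hs'. unfold cc in hs'.
    destruct (nested_seq st0 k) as [c' [V [[hV hlt] ?]]]. cbn [projT1] in *.
    assert (CRsum (fun n => avg (H n) c' (hpow k * l)) K <= V).
    { apply (CRsum_nonneg_le (u := fun n => avg (H n) c' (hpow k * l))); [|exact hV].
      intros n. apply avg_nonneg; [apply hlk|]. intros y hy. apply hH. apply hs'. exact hy. }
    lin (hlt, H0). }
  assert (hup : avg Psi (cc k) (hpow k * l) <= Psi x + e).
  { rewrite <- (avg_const (Psi x + e) (cc k) (hpow k * l)). apply avg_le; [apply hlk|].
    intros y hy. change (Psi y <= Psi x + e).
    assert (hd' : CRabs R (Psi y - Psi x) <= e).
    { apply hosc; [apply (hsub k); exact hy|apply (hsub k); apply hx|].
      intros i. specialize (hy i). pose proof (hx k i) as hxi. apply CRabs_le_iff. split; lin (hy, hxi, hk). }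
    apply CRabs_le_iff in hd'. lin hd'. }
  assert (hv : Psi x == F x - CRsum (fun n => H n x) K).
  { unfold Psi. cbn [csub cadd cscale cf]. rewrite csum_val. ring. }
  rewrite hv in hup. lin (hpos, hup).
Qed.

End Nested.

Lemma dominated_point (F : cfun (N := N)) (H : nat -> cfun) c l (u : nat -> CR) U : 0 <= l ->
  (forall n x, in_cube c l x -> 0 <= H n x) ->
  (forall n, avg (H n) c l <= u n) -> series_cv u U -> U < avg F c l ->
  {x : point R N & in_cube c l x * (forall K, CRsum (fun n => H n x) K <= F x)}%type.
Proof.
  intros hl hH hu hU hlt. apply (nested_point hl hH).
  destruct (@series_cv_maj R (fun n => avg (H n) c l) u U) as [V [hV hVU]]; [|exact hU|].
  - intros n. rewrite CRabs_right; [apply hu|]. apply avg_nonneg; [exact hl|apply hH].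
  - assert (e : l == hpow 0 * l) by (rewrite hpow_0; ring).
    exists c, V. split; [split|].
    + apply series_cv_eq with (2 := hV). intros n. apply avg_point_eq; [intros i; reflexivity|exact e].
    + rewrite <- (avg_point_eq F (fun i => CReq_refl (c i)) e). lin (hVU, hlt).
    + intros i. split; lin e.
Qed.

(** A strictly increasing majorant of the moduli [md], so that the blocks it delimits exhaust the
    series. *)
Fixpoint block_end (md : nat -> nat) (k : nat) : nat :=
  match k with O => md O | S j => Nat.max (S (block_end md j)) (md (S j)) end.

Lemma block_end_ge md k : (md k <= block_end md k)%nat.
Proof. destruct k as [|k]; [apply le_n|apply Nat.le_max_r]. Qed.

Lemma block_end_lt md k : (block_end md k < block_end md (S k))%nat.
Proof. exact (Nat.le_max_l (S (block_end md k)) (md (S k))). Qed.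

Lemma block_end_id md k : (k <= block_end md k)%nat.
Proof. induction k as [|k IH]; [lia|]. pose proof (block_end_lt md k). lia. Qed.

(* Grouping the terms in blocks of mean at most e/4^k and giving the k-th block the weight 2^k
   turns boundedness of the weighted partial sums into convergence. *)
Lemma convergence_point (F : cfun (N := N)) (f : nat -> cfun) c l (u : nat -> CR) U : 0 <= l ->
  (forall n x, in_cube c l x -> 0 <= f n x) ->
  (forall n, avg (f n) c l <= u n) -> series_cv u U -> U < avg F c l ->
  {x : point R N & in_cube c l x * {s : CR & series_cv (fun n => f n x) s * (s < F x)}}%type.
Proof.
  intros hl hf hu hU hlt.
  assert (hu0 : forall n, 0 <= u n).
  { intros n. apply CRle_trans with (2 := hu n). apply avg_nonneg; [exact hl|apply hf]. }
  (* The weighted blocks have total mean at most U + 2e, and another e is subtracted from [F] to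
     make the final inequality strict; U + 3e is still below the average of [F]. *)
  set (e := CR_of_Q R (1#4) * (avg F c l - U)).
  assert (he : 0 < e) by (unfold e; lin hlt).
  assert (hmod : forall k, {m : nat & forall i, (m <= i)%nat -> CRabs R (CRsum u i - U) < hpow k * (hpow k * e)}).
  { intros k. apply Un_cv_nat_real; [exact hU|].
    apply CRmult_lt_0_compat; [apply hpow_pos|]. apply CRmult_lt_0_compat; [apply hpow_pos|exact he]. }
  set (m := block_end (fun k => projT1 (hmod k))).
  assert (hm : forall k, U - CRsum u (m k) <= hpow k * (hpow k * e)).
  { intros k. pose proof (CRlt_asym _ _ (projT2 (hmod k) (m k) (block_end_ge _ k))) as h.
    apply CRabs_le_iff in h. lin h. }
  assert (mono : forall x, in_cube c l x -> forall a b, (a <= b)%nat -> CRsum (fun n => f n x) a <= CRsum (fun n => f n x) b).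
  { intros x hx a b hab. induction hab as [|b hab IH]; [apply CRle_refl|]. simpl.
    pose proof (hf (S b) x hx). lin (IH, H). }
  set (b := fun k => match k with O => csum f (m O) | S j => csub (csum f (m (S j))) (csum f (m j)) end).
  assert (hbv : forall k x, b (S k) x == CRsum (fun n => f n x) (m (S k)) - CRsum (fun n => f n x) (m k)).
  { intros k x. unfold b. cbn [csub cadd cscale cf]. rewrite !csum_val. ring. }
  assert (hb0 : forall k x, in_cube c l x -> 0 <= b k x).
  { intros k x hx. destruct k as [|k].
    - unfold b. rewrite csum_val. apply CRle_trans with (f O x); [apply hf; exact hx|].
      apply (mono x hx 0%nat). lia.
    - rewrite hbv. pose proof (mono x hx (m k) (m (S k))) as h.
      assert (h' := h ltac:(apply Nat.lt_le_incl, block_end_lt)). lin h'. }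
  (* Block j + 1 lies beyond the index [m j], so its mean is at most e/4^j and its weight is 2^j.
     Block 0, of mean at most U, has weight 1. *)
  set (H := fun k => match k with O => b O | S j => cscale (tpow j) (b (S j)) end).
  assert (hH0 : forall k x, in_cube c l x -> b k x <= H k x).
  { intros k x hx. destruct k as [|k]; [apply CRle_refl|]. unfold H. cbn [cscale cf].
    assert (0 <= (tpow k - 1) * b (S k) x).
    { apply CRmult_le0; [|apply hb0; exact hx]. pose proof (@tpow_le 0 k ltac:(lia)) as h. rewrite tpow_0 in h. lin h. }
    lin H0. }
  set (v := fun k => match k with O => U | S j => hpow j * e end).
  destruct (@dominated_point (csub F (cconst e)) H c l v (CR_of_Q R 2 * e + U) hl) as [x [hx hK]].
  { intros n x hx. apply CRle_trans with (b n x); [apply hb0; exact hx|apply hH0; exact hx]. }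
  { assert (hle : forall a k, (a <= k)%nat -> CRsum (fun n => avg (f n) c l) k - CRsum (fun n => avg (f n) c l) a <= CRsum u k - CRsum u a).
    { intros a k h. induction h as [|k h IH]; [lin|]. simpl. pose proof (hu (S k)) as h'. lin (IH, h'). }
    assert (hUs : forall k, CRsum u k <= U) by (intros k; apply (CRsum_nonneg_le hu0 hU)).
    intros [|k].
    - unfold H, b, v. rewrite avg_csum. apply CRle_trans with (CRsum u (m 0%nat)); [|apply hUs].
      apply sum_Rle. intros; apply hu.
    - unfold H, v. rewrite avg_scale. unfold b. rewrite avg_sub, !avg_csum.
      pose proof (hle (m k) (m (S k)) ltac:(apply Nat.lt_le_incl, block_end_lt)) as h1.
      pose proof (hUs (m (S k))) as h2'. specialize (hm k).
      assert (h3 : CRsum (fun n => avg (f n) c l) (m (S k)) - CRsum (fun n => avg (f n) c l) (m k) <= hpow k * (hpow k * e)) by lin (h1, h2', hm).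
      apply (CRmult_le_compat_l (tpow k)) in h3; [|apply CRlt_asym, tpow_pos].
      apply CRle_trans with (1 := h3).
      setoid_replace (tpow k * (hpow k * (hpow k * e))) with ((hpow k * tpow k) * (hpow k * e)) by ring.
      rewrite hpow_tpow. lin. }
  { apply (@series_cv_shift R v 0). apply series_cv_eq with (fun n => hpow n * e); [intros n; reflexivity|].
    apply series_cv_scale. apply GeoHalfTwo. }
  { rewrite avg_sub, avg_const. unfold e in *. lin hlt. }
  exists x. split; [exact hx|].
  change (forall K, CRsum (fun n => H n x) K <= F x + -(1) * e) in hK.
  set (C := F x - e).
  assert (hHn : forall k, 0 <= H k x).
  { intros n. apply CRle_trans with (b n x); [apply hb0; exact hx|apply hH0; exact hx]. }
  assert (hC : 0 <= C).
  { specialize (hK O). specialize (hHn O). cbn [CRsum] in hK. unfold C. lin (hK, hHn). }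
  assert (hbk : forall k, b (S k) x <= hpow k * C).
  { intros k. assert (h : H (S k) x <= C).
    { unfold C. apply CRle_trans with (CRsum (fun n => H n x) (S k)).
      - apply (selectOneInSum (fun n => H n x) (S k) (S k)); [lia|exact hHn].
      - specialize (hK (S k)). lin hK. }
    apply (CRmult_le_compat_l (hpow k)) in h; [|apply CRlt_asym, hpow_pos].
    unfold H in h. cbn [cscale cf] in h.
    setoid_replace (hpow k * (tpow k * b (S k) x)) with ((hpow k * tpow k) * b (S k) x) in h by ring.
    rewrite hpow_tpow in h. lin h. }
  set (s := CRsum (fun n => f n x)).
  (* A weighted block is at most C at [x], so block p + 1 is at most C/2^p, which is twice the
     decrease from C/2^p to C/2^(p+1). *)
  assert (hsm : forall k p, (k <= p)%nat -> s (m p) - s (m k) <= CR_of_Q R 2 * (hpow k - hpow p) * C).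
  { intros k p h. induction h as [|p h IH]; [lin|].
    specialize (hbk p). rewrite hbv in hbk. fold s in hbk. rewrite hpow_S. lin (IH, hbk). }
  assert (hnear : forall k i, (m k <= i)%nat -> s (m k) <= s i /\ s i <= s (m k) + CR_of_Q R 2 * (hpow k * C)).
  { intros k i hi. split; [apply (mono x hx); exact hi|].
    pose proof (mono x hx i (m i) (block_end_id _ i)) as h1. fold s in h1.
    assert (h2' : s (m (Nat.max k i)) - s (m k) <= CR_of_Q R 2 * (hpow k - hpow (Nat.max k i)) * C) by (apply hsm; lia).
    pose proof (mono x hx i (m (Nat.max k i))) as h3. fold s in h3.
    assert (h4 := h3 ltac:(pose proof (block_end_id (fun k => projT1 (hmod k)) (Nat.max k i)); unfold m; lia)).
    assert (h5 : 0 <= hpow (Nat.max k i) * C) by (apply CRmult_le0; [apply CRlt_asym, hpow_pos|exact hC]).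
    lin (h2', h4, h5). }
  assert (hcau : CR_cauchy R s).
  { intros p. destruct (@hpow_below (CR_of_Q R 2 * C) (CR_of_Q R (1 # p))) as [k hk]; [apply CR_of_Q_lt; reflexivity|].
    exists (m k). intros i j hi hj. pose proof (hnear k i hi). pose proof (hnear k j hj).
    apply CRabs_le_iff. split; lin (H0, H1, hk). }
  destruct (CR_complete R s hcau) as [sl hsl]. exists sl. split; [exact hsl|].
  assert (sl <= C); [|unfold C in H0; lin (H0, he)].
  apply (CR_cv_bound_up s C sl 0) with (2 := hsl). intros i _.
  apply CRle_trans with (s (m i)); [apply (mono x hx), block_end_id|].
  assert (hsb : s (m i) == CRsum (fun k => b k x) i).
  { induction i as [|i IH]; cbn [CRsum].
    - unfold b, s. rewrite csum_val. reflexivity.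
    - rewrite <- IH, hbv. unfold s. ring. }
  rewrite hsb. apply CRle_trans with (CRsum (fun k => H k x) i).
  - apply sum_Rle. intros k _. apply hH0. exact hx.
  - specialize (hK i). unfold C. lin hK.
Qed.

End Positivity.

(** * Comparison of averages, and the Riemann integral *)

Section Riemann.

Context {N : nat}.
Implicit Types (x y c s : point R N) (l : CR).

(** The error is 2 because [CRfloor] encloses a real in an interval of length 2. A negative floor is
    replaced by 0. *)
Lemma approx_index (y : CR) (m : nat) : 0 <= y -> y <= INR m ->
  {j : nat & (j <= m)%nat /\ CRabs R (y - INR j) <= CR_of_Q R 2}.
Proof.
  intros h0 h1. destruct (CRfloor y) as [z [a b]].
  assert (hz : (z <= Z.of_nat m)%Z).
  { assert (h : CR_of_Q R (z # 1) < INR m) by lin (a, h1).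
    unfold INR in h. apply lt_CR_of_Q in h. unfold Qlt in h; simpl in h. lia. }
  exists (Z.to_nat z). split; [lia|].
  destruct (Z_lt_le_dec z 0) as [hn|hn].
  - replace (Z.to_nat z) with O by lia. rewrite INR_0.
    assert (h : CR_of_Q R (z # 1) <= 0) by (apply CR_of_Q_le; unfold Qle; simpl; lia).
    apply CRabs_le_iff. split; lin (h0, b, h).
  - unfold INR. rewrite Z2Nat.id by lia. apply CRabs_le_iff. split; lin (a, b).
Qed.

Lemma CRpow_le1 n (a : CR) : 0 <= a -> a <= 1 -> CRpow a n <= 1.
Proof. intros h0 h1. rewrite <- (CRpow_one n). apply CRpow_le; assumption. Qed.

(** The corner [c'] need not be a grid point of the large cube. It is moved by at most two cells on
    each axis to one, at a cost controlled by uniform continuity; by positivity the moved subgrid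
    then contributes no more than the whole grid. *)
Lemma avg_subcube (f : cfun (N := N)) c l q c' : 0 < l ->
  (forall x, in_cube c l x -> 0 <= f x) ->
  (forall i, c i <= c' i /\ c' i + hpow q * l <= c i + l) ->
  CRpow (hpow q) N * avg f c' (hpow q * l) <= avg f c l.
Proof.
  intros hl hf hin. apply CRle_eps. intros e' he'.
  set (e := CR_of_Q R (1#3) * e'). assert (he : 0 < e) by (unfold e; lin he').
  destruct (cube_osc f c l he) as [d [hd hosc]].
  destruct (@hpow_below (CR_of_Q R 2 * l) d hd) as [k0 hk0].
  destruct (Un_cv_nat_real _ _ (@avg_cv N f c' (hpow q * l)) e he) as [k1 hk1].
  destruct (Un_cv_nat_real _ _ (@avg_cv N f c l) e he) as [k2 hk2].
  (* Level p in the large cube and level k in the subcube have the same mesh l/2^p. *)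
  set (k := (k0 + k1 + k2)%nat). set (p := (k + q)%nat).
  specialize (hk1 k ltac:(unfold k; lia)). specialize (hk2 p ltac:(unfold p, k; lia)).
  assert (hkp : CR_of_Q R 2 * l * hpow p <= d).
  { pose proof (@hpow_le k0 p ltac:(unfold p, k; lia)) as h.
    apply (CRmult_le_compat_l (CR_of_Q R 2 * l)) in h; [lin (h, hk0)|lin hl]. }
  assert (hne : CRapart R l 0) by (right; exact hl).
  pose proof (CRinv_l R l hne) as hi. pose proof (CRinv_0_lt_compat R l hne hl) as hip.
  set (v := CRinv R l hne) in *.
  assert (hpk : hpow p == hpow k * hpow q) by (apply hpow_plus).
  assert (tpk : tpow p == tpow k * tpow q) by (apply tpow_plus).
  (* The bound 2^p - 2^k keeps all 2^k points of the moved subgrid inside the grid. *)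
  assert (hJ : forall i, {j : nat & (j <= 2 ^ p - 2 ^ k)%nat /\ CRabs R ((c' i - c i) * v * tpow p - INR j) <= CR_of_Q R 2}).
  { intros i. destruct (hin i) as [a b]. apply approx_index.
    - apply CRmult_le0; [|apply CRlt_asym, tpow_pos]. apply CRmult_le0; [lin a|apply CRlt_asym; exact hip].
    - assert (hw : INR (2 ^ p - 2 ^ k) == tpow p - tpow k).
      { rewrite <- (INR_pow2 p), <- (INR_pow2 k). assert (INR (2 ^ p) == INR (2 ^ p - 2 ^ k) + INR (2 ^ k)); [|lin H].
        rewrite <- INR_plus. replace (2 ^ p - 2 ^ k + 2 ^ k)%nat with (2 ^ p)%nat; [reflexivity|].
        assert (2 ^ k <= 2 ^ p)%nat by (apply Nat.pow_le_mono_r; unfold p; lia). lia. }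
      rewrite hw.
      assert (h1 : c' i - c i <= l * (1 - hpow q)) by lin b.
      apply (CRmult_le_compat_l (v * tpow p)) in h1; [|apply CRmult_le0; apply CRlt_asym; [exact hip|apply tpow_pos]].
      setoid_replace (v * tpow p * (l * (1 - hpow q))) with ((v * l) * (tpow p - hpow q * tpow p)) in h1 by ring.
      rewrite hi, tpk in h1.
      setoid_replace (hpow q * (tpow k * tpow q)) with ((hpow q * tpow q) * tpow k) in h1 by ring.
      rewrite hpow_tpow in h1. rewrite tpk. lin h1. }
  set (J := fun i => projT1 (hJ i)).
  assert (hJb : forall i, (J i + 2 ^ k <= 2 ^ p)%nat).
  { intros i. destruct (projT2 (hJ i)) as [h _]. fold (J i) in h.
    assert (2 ^ k <= 2 ^ p)%nat by (apply Nat.pow_le_mono_r; unfold p; lia). lia. }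
  assert (hJe : forall i, CRabs R (c' i - (c i + l * (hpow p * INR (J i)))) <= d).
  { intros i. destruct (projT2 (hJ i)) as [_ h]. fold (J i) in h.
    setoid_replace (c' i - (c i + l * (hpow p * INR (J i)))) with
      ((v * l) * (hpow p * tpow p) * (c' i - c i) - l * (hpow p * INR (J i))) by (rewrite hi, hpow_tpow; ring).
    setoid_replace ((v * l) * (hpow p * tpow p) * (c' i - c i) - l * (hpow p * INR (J i))) with
      ((l * hpow p) * ((c' i - c i) * v * tpow p - INR (J i))) by ring.
    apply CRle_trans with ((l * hpow p) * CR_of_Q R 2); [|lin hkp].
    apply CRabs_prod_le; [|exact h]. apply CRmult_le0; apply CRlt_asym; [exact hl|apply hpow_pos]. }
  assert (hmain : CRpow (hpow q) N * avgk k f c' (hpow q * l) <= avgk p f c l + e).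
  { unfold avgk.
    setoid_replace (CRpow (hpow q) N * (CRpow (hpow k) N * grid_sum (fun _ => pred (2 ^ k)) (fun j => f (gpt c' (hpow q * l) k j))))
      with (CRpow (hpow p) N * grid_sum (fun _ => pred (2 ^ k)) (fun j => f (gpt c' (hpow q * l) k j))).
    2:{ rewrite (CRpow_proper _ _ N hpk), <- CRpow_mult. ring. }
    apply CRle_trans with (CRpow (hpow p) N * grid_sum (fun _ => pred (2 ^ k))
      (fun j => f (gpt c l p (fun i => (J i + j i)%nat)) + e)).
    - apply CRmult_le_compat_l; [apply hpow_nonneg|]. apply grid_sum_le. intros j hj.
      assert (hd' : CRabs R (f (gpt c' (hpow q * l) k j) - f (gpt c l p (fun i => (J i + j i)%nat))) <= e).
      { apply hosc.
        - intros i. assert (hql : 0 <= hpow q * l) by (apply CRmult_le0; apply CRlt_asym; [apply hpow_pos|exact hl]).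
          pose proof (gpt_cube c' hql hj i) as h. specialize (hin i). split; lin (h, hin).
        - apply gpt_cube; [apply CRlt_asym; exact hl|]. intros i. specialize (hJb i). specialize (hj i).
          pose proof (pow2_nz k). cbv beta. lia.
        - intros i. unfold gpt. rewrite INR_plus.
          setoid_replace (c' i + hpow q * l * (hpow k * INR (j i)) - (c i + l * (hpow p * (INR (J i) + INR (j i)))))
            with (c' i - (c i + l * (hpow p * INR (J i)))); [apply hJe|]. rewrite hpk. ring. }
      apply CRabs_le_iff in hd'. lin hd'.
    - rewrite grid_sum_plus, grid_sum_const, CRmult_plus_distr_l. apply CRplus_le_compat.
      + apply CRmult_le_compat_l; [apply hpow_nonneg|].
        apply CRle_trans with (grid_sum (fun _ : Fin.t N => pred (2 ^ k)) (fun j => f (gpt c l p (fun i => (J i + j i)%nat)))).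
        * apply CRle_refl.
        * assert (hs := @grid_sum_sub N J (2 ^ k) (2 ^ p) (fun j => f (gpt c l p j)) (pow2_nz k) hJb).
          apply hs.
          -- intros j j' hj. apply cf_ext. intros i. unfold gpt. rewrite (hj i). reflexivity.
          -- intros j hj. apply hf. apply gpt_cube; [apply CRlt_asym; exact hl|]. intros i. specialize (hj i). lia.
      + setoid_replace (CRpow (hpow p) N * (e * CRpow (INR (S (pred (2 ^ k)))) N))
          with (CRpow (hpow q) N * (e * (CRpow (hpow k) N * CRpow (INR (S (pred (2 ^ k)))) N))).
        * rewrite (avgk_norm (N := N) k), CRmult_1_r.
          assert (0 <= (1 - CRpow (hpow q) N) * e); [|lin H].
          apply CRmult_le0; [|apply CRlt_asym; exact he].
          pose proof (@CRpow_le1 N (hpow q) (CRlt_asym _ _ (hpow_pos q)) (@hpow_le1 q)) as h. lin h.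
        * rewrite (CRpow_proper _ _ N hpk), <- CRpow_mult. ring. }
  assert (a1 := proj1 (CRabs_le_iff _ _) (CRlt_asym _ _ hk1)).
  assert (a2 := proj1 (CRabs_le_iff _ _) (CRlt_asym _ _ hk2)).
  assert (a3 : avg f c' (hpow q * l) <= avgk k f c' (hpow q * l) + e) by lin a1.
  apply (CRmult_le_compat_l (CRpow (hpow q) N)) in a3; [|apply hpow_nonneg].
  assert (a4 : 0 <= (1 - CRpow (hpow q) N) * e).
  { apply CRmult_le0; [|apply CRlt_asym; exact he].
    pose proof (@CRpow_le1 N (hpow q) (CRlt_asym _ _ (hpow_pos q)) (@hpow_le1 q)) as h. lin h. }
  assert (e3 : e' == CR_of_Q R 3 * e) by (unfold e; ring).
  rewrite e3. lin (a2, a3, a4, hmain).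
Qed.

Lemma fin_prod_bounds n (u v : Fin.t n -> CR) : (forall i, 0 <= u i /\ u i <= v i) ->
  0 <= fin_prod u /\ fin_prod u <= fin_prod v.
Proof.
  induction n as [|n IH]; simpl; intros h; [split; lin|].
  destruct (IH (fun i => u (FS i)) (fun i => v (FS i))) as [a b]; [intros i; apply h|].
  destruct (h F1) as [h0 h1]. split; [apply CRmult_le0; assumption|].
  apply CRle_trans with (u F1 * fin_prod (fun i => v (FS i))).
  - apply CRmult_le_compat_l; assumption.
  - apply CRmult_le_compat_r; [lin (a, b)|exact h1].
Qed.

Lemma fin_prod_eq n (u v : Fin.t n -> CR) : (forall i, u i == v i) -> fin_prod u == fin_prod v.
Proof.
  induction n as [|n IH]; simpl; intros h; [reflexivity|].
  rewrite (h F1). apply CRmult_morph; [reflexivity|]. apply IH. intros; apply h.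
Qed.

Lemma fin_prod_const n (a : CR) : fin_prod (fun _ : Fin.t n => a) == CRpow a n.
Proof. induction n as [|n IH]; simpl; [reflexivity|]. rewrite IH. reflexivity. Qed.

(** * Dyadic averages as Riemann sums *)

Definition clamp (M t : CR) : CR := CRmax (CRmin t M) (- M).

Lemma clamp_le (M a b : CR) : a <= b -> clamp M a <= clamp M b.
Proof.
  intros h. unfold clamp. apply CRmax_lub; [|apply CRmax_r].
  apply CRle_trans with (CRmin b M); [|apply CRmax_l].
  apply CRmin_glb; [|apply CRmin_r]. pose proof (CRmin_l a M). lin (H, h).
Qed.

Lemma clamp_lip (M a b : CR) : a <= b -> clamp M b - clamp M a <= b - a.
Proof.
  intros h. unfold clamp. pose proof (CRmax_contract (CRmin b M) (CRmin a M) (- M)) as h1.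
  pose proof (CRmin_contract b a M) as h3.
  apply CRle_trans with (1 := CRle_abs _). apply CRle_trans with (1 := h1). apply CRle_trans with (1 := h3).
  rewrite CRabs_right; [apply CRle_refl|lin h].
Qed.

Lemma clamp_id (M t : CR) : - M <= t -> t <= M -> clamp M t == t.
Proof.
  intros h1 h3. unfold clamp. rewrite CRmin_left by exact h3. apply CRmax_left. exact h1.
Qed.

Lemma clamp_low (M t : CR) : 0 <= M -> t <= - M -> clamp M t == - M.
Proof.
  intros h0 h1. unfold clamp. rewrite CRmin_left by lin (h0, h1). apply CRmax_right. exact h1.
Qed.

Lemma clamp_high (M t : CR) : 0 <= M -> M <= t -> clamp M t == M.
Proof.
  intros h0 h1. unfold clamp. rewrite CRmin_right by exact h1. apply CRmax_left. lin h0.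
Qed.

Lemma clamp_range (M t : CR) : 0 <= M -> - M <= clamp M t /\ clamp M t <= M.
Proof.
  intros h0. unfold clamp. split; [apply CRmax_r|]. apply CRmax_lub; [apply CRmin_r|lin h0].
Qed.

(** Serves to leave the cube [-M, M]^N along one axis, to a place where [f] vanishes. *)
Definition upd x (i : Fin.t N) (a : CR) : point R N := fun i' => if Fin.eq_dec i i' then a else x i'.

Lemma upd_same x i a : upd x i a i = a.
Proof. unfold upd. destruct (Fin.eq_dec i i) as [_|h]; [reflexivity|destruct (h eq_refl)]. Qed.

(* The lower corner of [-2^J, 2^J]^N, a cube of side 2^(J+1). *)
Definition origin_cube J : point R N := fun _ => - tpow J.
Definition cube_vol J : CR := CRpow (tpow (S J)) N.

Section Link.

Variables (f : cfun (N := N)) (M : CR) (J : nat).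
Hypothesis hM : 0 < M.
Hypothesis hf : forall x i, M < CRabs R (x i) -> f x == 0.
Hypothesis hJ : M <= tpow J.

Let step k : CR := tpow (S J) * hpow k.
Let gp k j : CR := - tpow J + step k * INR j.

Lemma step_pos k : 0 < step k.
Proof. apply CRmult_lt_0_compat; [apply tpow_pos|apply hpow_pos]. Qed.

Lemma gp_S k j : gp k (S j) == gp k j + step k.
Proof. unfold gp. rewrite INR_S. ring. Qed.

Definition clamped_partition (k : nat) : Defs.partition (- M) M.
Proof.
  refine (Build_partition (part_last := pred (2 ^ k)) (part_pt := fun j => clamp M (gp k j)) _ _ _).
  - apply clamp_low; [apply CRlt_asym; exact hM|]. unfold gp. rewrite INR_0. lin hJ.
  - apply clamp_high; [apply CRlt_asym; exact hM|]. unfold gp.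
    replace (S (pred (2 ^ k))) with (2 ^ k)%nat by (pose proof (pow2_nz k); lia).
    rewrite INR_pow2. unfold step.
    setoid_replace (tpow (S J) * hpow k * tpow k) with (tpow (S J) * (hpow k * tpow k)) by ring.
    rewrite hpow_tpow, tpow_S. lin hJ.
  - intros j _. apply clamp_le. rewrite gp_S. pose proof (step_pos k). lin H.
Defined.

(* The dyadic grid of [-2^J, 2^J]^N clamped to [-M, M]^N is a partition of the latter; only the
   cells that meet the boundary of [-M, M]^N are altered, and there f is small. *)
Lemma clamped_sum_close e : 0 < e -> {k0 : nat & forall k, (k0 <= k)%nat ->
  mesh_le (fun _ : Fin.t N => clamped_partition k) (step k) /\
  tags (fun _ : Fin.t N => clamped_partition k) (fun (j : Fin.t N -> nat) (i : Fin.t N) => clamp M (gp k (j i))) /\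
  CRabs R (riemann_sum (fun _ : Fin.t N => clamped_partition k) (fun (j : Fin.t N -> nat) (i : Fin.t N) => clamp M (gp k (j i))) f
    - cube_vol J * avgk k f (origin_cube J) (tpow (S J))) <= CR_of_Q R 2 * e * cube_vol J}.
Proof.
  intros he. destruct (cf_uc f (tpow J + CR_of_Q R 2) he) as [d0 [hd0 hosc]].
  set (d := CRmin d0 1).
  assert (hd : 0 < d) by (apply CRmin_pos; [exact hd0|lin]).
  assert (hdd : d <= d0) by apply CRmin_l. assert (hd1 : d <= 1) by apply CRmin_r.
  destruct (@hpow_below (tpow (S J)) (half * d)) as [k0 hk0]; [lin hd|].
  exists k0. intros k hk.
  assert (hst : step k <= half * d).
  { pose proof (@hpow_le k0 k hk) as h. apply (CRmult_le_compat_l (tpow (S J))) in h; [|apply CRlt_asym, tpow_pos].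
    unfold step. lin (h, hk0). }
  pose proof (step_pos k) as hsp.
  assert (hcell : forall j, 0 <= clamp M (gp k (S j)) - clamp M (gp k j) /\
                            clamp M (gp k (S j)) - clamp M (gp k j) <= step k).
  { intros j. pose proof (gp_S k j) as h. assert (h' : gp k j <= gp k (S j)) by lin (h, hsp).
    pose proof (@clamp_le M _ _ h'). pose proof (@clamp_lip M _ _ h'). split; lin (H, H0, h). }
  split; [|split].
  - intros i j _. apply hcell.
  - intros j _ i. split; [apply CRle_refl|]. destruct (hcell (j i)) as [h _]. cbn [clamped_partition part_pt]. lin h.
  - assert (hvol : cube_vol J * avgk k f (origin_cube J) (tpow (S J)) ==
      grid_sum (fun _ => pred (2 ^ k)) (fun j => CRpow (step k) N * f (gpt (origin_cube J) (tpow (S J)) k j))).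
    { rewrite grid_sum_scale. unfold avgk, cube_vol, step. rewrite <- CRpow_mult. ring. }
    rewrite hvol. unfold riemann_sum. cbn [clamped_partition part_last].
    assert (hterm : forall j : Fin.t N -> nat, (forall i, (j i <= pred (2 ^ k))%nat) ->
      CRabs R (f (fun i => clamp M (gp k (j i))) * cell_volume (fun _ => clamped_partition k) j -
        CRpow (step k) N * f (gpt (origin_cube J) (tpow (S J)) k j)) <= CR_of_Q R 2 * e * CRpow (step k) N).
    { intros j hj.
      set (xi := (fun i => clamp M (gp k (j i))) : point R N).
      set (g := gpt (origin_cube J) (tpow (S J)) k j).
      assert (hg : forall i, g i == gp k (j i)) by (intros i; unfold g, gpt, gp, origin_cube, step; ring).
      assert (hV : 0 <= cell_volume (fun _ => clamped_partition k) j /\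
                   cell_volume (fun _ => clamped_partition k) j <= CRpow (step k) N).
      { unfold cell_volume. rewrite <- fin_prod_const. apply fin_prod_bounds. intros i. apply hcell. }
      set (V := cell_volume (fun _ => clamped_partition k) j) in *.
      set (W := CRpow (step k) N) in *.
      assert (hxiB : forall i, CRabs R (xi i) <= tpow J).
      { intros i. pose proof (@clamp_range M (gp k (j i)) (CRlt_asym _ _ hM)) as h.
        apply CRabs_le_iff. unfold xi. split; lin (h, hJ). }
      assert (hgB : forall i, CRabs R (g i) <= tpow J).
      { intros i. pose proof (@gpt_cube N (origin_cube J) (tpow (S J)) k j (CRlt_asym _ _ (tpow_pos _)) hj i) as h.
        fold g in h. unfold origin_cube in h.
        pose proof (@tpow_S J) as ht. apply CRabs_le_iff. split; lin (h, ht). }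
      assert (hupd : forall x i a, (forall i, CRabs R (x i) <= tpow J) -> M < CRabs R a -> CRabs R (x i - a) <= d ->
                CRabs R (f x) <= e).
      { intros x i a hx ha hxa.
        assert (h0 : f (upd x i a) == 0) by (apply (hf (i := i)); rewrite upd_same; exact ha).
        setoid_replace (f x) with (f x - f (upd x i a)) by (rewrite h0; ring).
        apply hosc.
        - intros i'. specialize (hx i'). lin hx.
        - intros i'. unfold upd. destruct (Fin.eq_dec i i') as [<-|_]; [|specialize (hx i'); lin hx].
          pose proof (CRabs_triang (a - x i) (x i)) as ht. setoid_replace (a - x i + x i) with a in ht by ring.
          rewrite CRabs_minus_sym in ht. specialize (hx i). lin (ht, hx, hxa, hd1).
        - intros i'. unfold upd. destruct (Fin.eq_dec i i') as [<-|_]; [lin (hxa, hdd)|].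
          unfold CRminus. rewrite CRplus_opp_r, CRabs_right; [lin hd0|apply CRle_refl]. }
      (* In a cell at the boundary the clamped volume [V] and the full volume [W] may differ, so the
         two summands are bounded separately. *)
      assert (hout : CRabs R (f xi) <= e -> CRabs R (f g) <= e ->
        CRabs R (f xi * V - W * f g) <= CR_of_Q R 2 * e * W).
      { intros h1 h3. apply CRle_trans with (CRabs R (f xi * V) + CRabs R (- (W * f g))); [apply CRabs_triang|].
        rewrite CRabs_opp, !CRabs_mult, (CRabs_right V) by apply hV.
        rewrite (CRabs_right W) by lin hV.
        assert (a1 : CRabs R (f xi) * V <= e * V) by (apply CRmult_le_compat_r; [apply hV|exact h1]).
        assert (a2 : e * V <= e * W) by (apply CRmult_le_compat_l; [apply CRlt_asym; exact he|apply hV]).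
        assert (a3 : W * CRabs R (f g) <= W * e) by (apply CRmult_le_compat_l; [lin hV|exact h3]).
        lin (a1, a2, a3). }
      (* The claim is a negation, so its failure may be assumed. A cell that is not inside [-M, M]^N
         would give two small values and thereby the claim; hence the cell is inside, where clamping
         changes nothing. *)
      intros habs.
      assert (hinside : forall i, - M <= gp k (j i) /\ gp k (S (j i)) <= M).
      { intros i. split; intros hlt; revert habs; apply hout.
        - apply (hupd xi i (- M - d)); [exact hxiB| |].
          + rewrite CRabs_left; lin (hM, hd).
          + unfold xi. rewrite (@clamp_low M (gp k (j i))); [|lin hM|lin hlt].
            apply CRabs_le_iff. split; lin hd.
        - assert (h0 : f g == 0).
          { apply (hf (i := i)). rewrite hg, CRabs_left; lin (hlt, hM). }
          rewrite h0, CRabs_right; [lin he|apply CRle_refl].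
        (* Here [xi] may be one step below M, and a step is at most d/2, so M + d/2 is still within
           d of it. *)
        - apply (hupd xi i (M + half * d)); [exact hxiB| |].
          + rewrite CRabs_right; lin (hM, hd).
          + unfold xi. destruct (hcell (j i)) as [c1 c2].
            rewrite (@clamp_high M (gp k (S (j i)))) in c1, c2; [|lin hM|lin hlt|lin hM|lin hlt].
            apply CRabs_le_iff. split; lin (c1, c2, hst, hd).
        - apply (hupd g i (gp k (S (j i)))); [exact hgB| |].
          + rewrite CRabs_right; lin (hlt, hM).
          + rewrite hg, gp_S. apply CRabs_le_iff. split; lin (hst, hsp, hd). }
      revert habs.
      assert (exi : f xi == f g).
      { apply cf_ext. intros i. rewrite hg. unfold xi. pose proof (hinside i) as h. pose proof (gp_S k (j i)) as h'.
        apply clamp_id; lin (h, h', hsp). }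
      assert (eV : V == W).
      { unfold V, W, cell_volume. rewrite <- fin_prod_const. apply fin_prod_eq. intros i.
        cbn [clamped_partition part_pt]. pose proof (hinside i) as h. pose proof (gp_S k (j i)) as h'.
        rewrite (@clamp_id M (gp k (S (j i)))) by lin (h, h', hsp).
        rewrite (@clamp_id M (gp k (j i))) by lin (h, h', hsp). lin h'. }
      change (CRabs R (f xi * V - W * f g) <= CR_of_Q R 2 * e * W).
      rewrite exi, eV.
      rewrite CRabs_right; [|lin]. assert (0 <= e * W) by (apply CRmult_le0; [lin he|lin hV]). lin H. }
    assert (hW : grid_sum (fun _ : Fin.t N => pred (2 ^ k)) (fun _ => CR_of_Q R 2 * e * CRpow (step k) N) ==
                 CR_of_Q R 2 * e * cube_vol J).
    { rewrite grid_sum_const. unfold step, cube_vol. rewrite <- CRpow_mult.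
      setoid_replace (CR_of_Q R 2 * e * (CRpow (tpow (S J)) N * CRpow (hpow k) N) * CRpow (INR (S (pred (2 ^ k)))) N)
        with (CR_of_Q R 2 * e * CRpow (tpow (S J)) N * (CRpow (hpow k) N * CRpow (INR (S (pred (2 ^ k)))) N)) by ring.
      rewrite (avgk_norm (N := N) k). ring. }
    apply CRabs_le_iff. split.
    + assert (h : grid_sum (fun _ => pred (2 ^ k)) (fun j => CRpow (step k) N * f (gpt (origin_cube J) (tpow (S J)) k j))
        <= grid_sum (fun _ => pred (2 ^ k)) (fun j => f (fun i => clamp M (gp k (j i))) * cell_volume (fun _ => clamped_partition k) j
            + CR_of_Q R 2 * e * CRpow (step k) N)).
      { apply grid_sum_le. intros j hj. pose proof (proj1 (CRabs_le_iff _ _) (hterm j hj)) as h. lin h. }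
      rewrite grid_sum_plus, hW in h. lin h.
    + assert (h : grid_sum (fun _ => pred (2 ^ k)) (fun j => f (fun i => clamp M (gp k (j i))) * cell_volume (fun _ => clamped_partition k) j)
        <= grid_sum (fun _ => pred (2 ^ k)) (fun j => CRpow (step k) N * f (gpt (origin_cube J) (tpow (S J)) k j)
            + CR_of_Q R 2 * e * CRpow (step k) N)).
      { apply grid_sum_le. intros j hj. pose proof (proj1 (CRabs_le_iff _ _) (hterm j hj)) as h. lin h. }
      rewrite grid_sum_plus, hW in h. lin h.
Qed.

End Link.

Lemma cube_vol_pos J : 0 < cube_vol J.
Proof. apply CRpow_gt_zero. apply tpow_pos. Qed.

(** The clamped dyadic partitions have mesh tending to 0, and their Riemann sums approach the volume
    times the average. Every J from some [J0] on is allowed, so that finitely many integrals can be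
    taken over one common cube. *)
Lemma riemann_avg (f : cfun (N := N)) v : riemann_integral f v ->
  {J0 : nat & forall J, (J0 <= J)%nat -> cube_vol J * avg f (origin_cube J) (tpow (S J)) == v}.
Proof.
  intros [M [[hM hf] hint]]. destruct (tpow_above M) as [J0 hJ0]. exists J0. intros J hJ.
  assert (hMJ : M <= tpow J) by (pose proof (@tpow_le J0 J hJ) as h; lin (h, hJ0)).
  pose proof (cube_vol_pos J) as hV.
  apply CRabs_diff_eq. intros e he.
  set (e3 := CR_of_Q R (1#4) * e). assert (he3 : 0 < e3) by (unfold e3; lin he).
  destruct (hint e3 he3) as [d [hd hsum]].
  assert (hne : CRapart R (cube_vol J) 0) by (right; exact hV).
  pose proof (CRinv_l R _ hne) as hi. pose proof (CRinv_0_lt_compat R _ hne hV) as hip.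
  set (iv := CRinv R (cube_vol J) hne) in *.
  assert (hiv : 0 < iv * e3) by (apply CRmult_lt_0_compat; assumption).
  destruct (clamped_sum_close hM hf hMJ hiv) as [k0 hk0].
  destruct (@hpow_below (tpow (S J)) d hd) as [k1 hk1].
  destruct (Un_cv_nat_real _ _ (@avg_cv N f (origin_cube J) (tpow (S J))) (iv * e3) hiv) as [k2 hk2].
  set (k := (k0 + k1 + k2)%nat).
  destruct (hk0 k ltac:(unfold k; lia)) as [hmesh [htag hcl]].
  specialize (hk2 k ltac:(unfold k; lia)).
  assert (hm : mesh_le (fun _ : Fin.t N => clamped_partition hM hMJ k) d).
  { intros i j hj. apply CRle_trans with (1 := hmesh i j hj).
    pose proof (@hpow_le k1 k ltac:(unfold k; lia)) as h.
    apply (CRmult_le_compat_l (tpow (S J))) in h; [|apply CRlt_asym, tpow_pos]. lin (h, hk1). }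
  pose proof (proj1 (CRabs_le_iff _ _) (hsum _ _ hm htag)) as b1.
  pose proof (proj1 (CRabs_le_iff _ _) hcl) as b2.
  pose proof (proj1 (CRabs_le_iff _ _) (CRlt_asym _ _ hk2)) as b3.
  setoid_replace (CR_of_Q R 2 * (iv * e3) * cube_vol J) with (CR_of_Q R 2 * e3 * (iv * cube_vol J)) in b2 by ring.
  rewrite hi in b2.
  assert (b4 : cube_vol J * (avgk k f (origin_cube J) (tpow (S J)) - avg f (origin_cube J) (tpow (S J))) <= cube_vol J * (iv * e3))
    by (apply CRmult_le_compat_l; [apply CRlt_asym; exact hV|apply b3]).
  assert (b5 : cube_vol J * - (iv * e3) <= cube_vol J * (avgk k f (origin_cube J) (tpow (S J)) - avg f (origin_cube J) (tpow (S J))))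
    by (apply CRmult_le_compat_l; [apply CRlt_asym; exact hV|apply b3]).
  setoid_replace (cube_vol J * (iv * e3)) with ((iv * cube_vol J) * e3) in b4 by ring.
  setoid_replace (cube_vol J * - (iv * e3)) with (- ((iv * cube_vol J) * e3)) in b5 by ring.
  rewrite hi in b4, b5. unfold e3 in *.
  apply CRabs_le_iff. split; lin (b1, b2, b4, b5).
Qed.

End Riemann.

(** * The Euclidean metric and test functions *)

Section Metric.

Lemma fin_sum_le n (u v : Fin.t n -> CR) : (forall i, u i <= v i) -> fin_sum u <= fin_sum v.
Proof.
  induction n as [|n IH]; simpl; intros h; [apply CRle_refl|].
  apply CRplus_le_compat; [apply h|]. apply IH. intros; apply h.
Qed.

Lemma fin_sum_eq n (u v : Fin.t n -> CR) : (forall i, u i == v i) -> fin_sum u == fin_sum v.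
Proof. intros h. split; apply fin_sum_le; intros i; apply h. Qed.

Lemma fin_sum_plus n (u v : Fin.t n -> CR) : fin_sum (fun i => u i + v i) == fin_sum u + fin_sum v.
Proof. induction n as [|n IH]; simpl; [ring|]. rewrite IH. ring. Qed.

Lemma fin_sum_scale n a (u : Fin.t n -> CR) : fin_sum (fun i => a * u i) == a * fin_sum u.
Proof. induction n as [|n IH]; simpl; [ring|]. rewrite IH. ring. Qed.

Lemma fin_sum_nonneg n (u : Fin.t n -> CR) : (forall i, 0 <= u i) -> 0 <= fin_sum u.
Proof. intros h. rewrite <- (@fin_sum_0 R n (fun _ => 0)) by reflexivity. apply fin_sum_le. exact h. Qed.

Lemma fin_sum_const n (a : CR) : fin_sum (fun _ : Fin.t n => a) == INR n * a.
Proof. induction n as [|n IH]; simpl; [rewrite INR_0; ring|]. rewrite IH, INR_S. ring. Qed.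

Lemma fin_sum_term n (u : Fin.t n -> CR) i : (forall i, 0 <= u i) -> u i <= fin_sum u.
Proof.
  revert u i. induction n as [|n IH]; intros u i h; [inversion i|]. simpl.
  pose proof (h F1) as h0. pose proof (fin_sum_nonneg (u := fun i => u (FS i)) (fun i => h (FS i))) as hs.
  revert u h h0 hs. apply (Fin.caseS' i); intros.
  - lin hs.
  - pose proof (IH (fun i => u (FS i)) p (fun i => h (FS i))) as hI. cbv beta in hI. lin (hI, h0).
Qed.

Lemma CRsquare_nonneg (x : CR) : 0 <= x * x.
Proof.
  apply (CRle_by_cases (x := 0) (y := x)); intros h.
  - apply CRmult_le0; apply CRlt_asym; exact h.
  - assert (0 <= (- x) * (- x)) by (apply CRmult_le0; lin h). lin H.
Qed.

Lemma CRsquare_le_inv (a b : CR) : 0 <= b -> a * a <= b * b -> a <= b.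
Proof.
  intros hb h hlt. apply h. apply CRle_lt_trans with (b * a).
  - apply CRmult_le_compat_l; [exact hb|apply CRlt_asym; exact hlt].
  - apply CRmult_lt_compat_r; [lin (hb, hlt)|exact hlt].
Qed.

Context {N : nat}.
Implicit Types (x y z c s : point R N) (l : CR).

Definition norm (u : Fin.t N -> CR) : CR := CRsqrt (fin_sum (fun i => u i * u i)).

Lemma norm_nonneg u : 0 <= norm u.
Proof. apply CRsqrt_pos. Qed.

Lemma norm_square u : norm u * norm u == fin_sum (fun i => u i * u i).
Proof. apply CRsqrt_sqrt. apply fin_sum_nonneg. intros; apply CRsquare_nonneg. Qed.

Lemma norm_coord u i : CRabs R (u i) <= norm u.
Proof.
  apply CRsquare_le_inv; [apply norm_nonneg|]. rewrite norm_square.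
  rewrite <- CRabs_mult, CRabs_right by apply CRsquare_nonneg.
  apply (fin_sum_term (u := fun i => u i * u i)). intros; apply CRsquare_nonneg.
Qed.

Lemma norm_eq u v : (forall i, u i == v i) -> norm u == norm v.
Proof.
  intros h. assert (e : fin_sum (fun i => u i * u i) == fin_sum (fun i => v i * v i)).
  { apply fin_sum_eq. intros i. rewrite (h i). reflexivity. }
  split; apply CRsquare_le_inv; try apply norm_nonneg; rewrite !norm_square; apply e.
Qed.

(* Cauchy-Schwarz, from the square of |v| u - |u| v. *)
Lemma dot_le u v : fin_sum (fun i => u i * v i) <= norm u * norm v.
Proof.
  set (P := fin_sum (fun i => u i * v i)). set (A := norm u). set (B := norm v).
  assert (hA : 0 <= A) by apply norm_nonneg. assert (hB : 0 <= B) by apply norm_nonneg.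
  assert (h : 0 <= fin_sum (fun i => (B * u i - A * v i) * (B * u i - A * v i))).
  { apply fin_sum_nonneg. intros; apply CRsquare_nonneg. }
  rewrite (fin_sum_eq (v := fun i => (B * B) * (u i * u i) + ((A * A) * (v i * v i) + (CR_of_Q R (-2) * A * B) * (u i * v i)))) in h
    by (intros i; ring).
  rewrite !fin_sum_plus, !fin_sum_scale, <- !norm_square in h. fold A B P in h.
  intros hlt.
  assert (hP : 0 < P) by (pose proof (CRmult_le0 hA hB) as h0; lin (h0, hlt)).
  assert (hAB : 0 <= A * B) by (apply CRmult_le0; assumption).
  assert (h3 : A * B * P <= A * B * (A * B)) by lin h.
  (* Dividing by |u||v| would require it to be nonzero. If it is positive, [h3] contradicts [hlt];
     otherwise u or v vanishes, hence so does P. *)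
  assert (hz : A * B <= 0).
  { intros hpos. apply (CRmult_lt_compat_l (A * B)) in hlt; [|exact hpos]. exact (h3 hlt). }
  assert (hA0 : A <= 0).
  { intros hApos. assert (hB0 : B <= 0).
    { intros hBpos. apply hz. apply CRmult_lt_0_compat; assumption. }
    apply (@CRle_refl R P).
    assert (P == 0); [|lin (H, hP)]. apply fin_sum_0. intros i.
    assert (v i == 0); [|rewrite H; ring].
    pose proof (proj1 (CRabs_le_iff _ _) (@norm_coord v i)) as hv. fold B in hv. split; lin (hv, hB0). }
  assert (P == 0); [|lin (H, hP)]. apply fin_sum_0. intros i.
  assert (u i == 0); [|rewrite H; ring].
  pose proof (proj1 (CRabs_le_iff _ _) (@norm_coord u i)) as hv. fold A in hv. split; lin (hv, hA0).
Qed.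

Lemma norm_triang u v : norm (fun i => u i + v i) <= norm u + norm v.
Proof.
  pose proof (@norm_nonneg u) as hA. pose proof (@norm_nonneg v) as hB.
  apply CRsquare_le_inv; [lin (hA, hB)|]. rewrite norm_square.
  rewrite (fin_sum_eq (v := fun i => u i * u i + (v i * v i + CR_of_Q R 2 * (u i * v i)))) by (intros i; ring).
  rewrite !fin_sum_plus, fin_sum_scale, <- !norm_square. pose proof (@dot_le u v) as h. lin h.
Qed.

Lemma dist_norm x y : dist x y = norm (fun i => x i - y i).
Proof. reflexivity. Qed.

Lemma dist_nonneg x y : 0 <= dist x y.
Proof. apply CRsqrt_pos. Qed.

Lemma dist_triang x y z : dist x z <= dist x y + dist y z.
Proof.
  rewrite !dist_norm. rewrite (norm_eq (v := fun i => (x i - y i) + (y i - z i))) by (intros i; ring).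
  apply norm_triang.
Qed.

Lemma dist_sym x y : dist x y == dist y x.
Proof.
  unfold dist. assert (e : fin_sum (fun i => (x i - y i) * (x i - y i)) == fin_sum (fun i => (y i - x i) * (y i - x i))).
  { apply fin_sum_eq. intros i. ring. }
  split; (apply CRsquare_le_inv; [apply CRsqrt_pos|]);
    (rewrite !CRsqrt_sqrt; [apply e| |]; apply fin_sum_nonneg; intros; apply CRsquare_nonneg).
Qed.

Lemma dist_coord x y i : CRabs R (x i - y i) <= dist x y.
Proof. exact (@norm_coord (fun i => x i - y i) i). Qed.

(** The factor N is cruder than sqrt N, but it keeps a further square root out of the estimates. *)
Lemma dist_sup x y d : 0 <= d -> (forall i, CRabs R (x i - y i) <= d) -> dist x y <= (INR N * d)%ConstructiveReals.
Proof.
  intros hd h. apply CRsquare_le_inv; [apply CRmult_le0; [apply INR_pos|exact hd]|].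
  unfold dist. rewrite CRsqrt_sqrt by (apply fin_sum_nonneg; intros; apply CRsquare_nonneg).
  apply CRle_trans with (fin_sum (fun _ : Fin.t N => d * d)).
  - apply fin_sum_le. intros i. specialize (h i). pose proof (CRabs_pos (x i - y i)) as h0.
    rewrite <- (CRabs_right ((x i - y i) * (x i - y i))) by apply CRsquare_nonneg. rewrite CRabs_mult.
    apply CRle_trans with (CRabs R (x i - y i) * d); [apply CRmult_le_compat_l; assumption|].
    apply CRmult_le_compat_r; assumption.
  - rewrite fin_sum_const. assert (hN : 0 <= INR N * INR N - INR N).
    { destruct N as [|n]; [rewrite INR_0; lin|]. rewrite INR_S. pose proof (@INR_pos n) as h0.
      pose proof (CRmult_le0 h0 h0) as h1. lin (h0, h1). }
    assert (hh : 0 <= (INR N * INR N - INR N) * (d * d)) by (apply CRmult_le0; [exact hN|apply CRsquare_nonneg]).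
    lin hh.
Qed.

Lemma ucont_dist x : ucont (fun y => dist x y).
Proof.
  intros B e he. destruct (@hpow_below (INR N) e he) as [k hk].
  exists (hpow k). split; [apply hpow_pos|]. intros y z _ _ h.
  assert (hd : dist y z <= INR N * hpow k) by (apply dist_sup; [apply CRlt_asym, hpow_pos|exact h]).
  pose proof (@dist_triang x y z). pose proof (@dist_triang x z y). pose proof (dist_sym y z).
  apply CRabs_le_iff. split; lin (hd, hk, H, H0, H1).
Qed.

Definition cdist x : cfun := CFun (ucont_dist x).

(** * Compactness of balls of the sup norm, and test functions *)

Lemma ball_sup_ext B : forall x y : point R N, point_eq x y ->
  (forall i, CRabs R (x i) <= B) -> (forall i, CRabs R (y i) <= B).
Proof. intros x y e h i. rewrite <- (e i). apply h. Qed.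

Definition sup_ball B : subset R N := Subset (mem := fun x => forall i, CRabs R (x i) <= B) (@ball_sup_ext B).

Lemma sup_ball_complete B : complete (sup_ball B).
Proof.
  intros u hu hc.
  assert (hcau : forall i, CR_cauchy R (fun n => u n i)).
  { intros i p. destruct (hc (CR_of_Q R (1 # p))) as [n hn]; [apply CR_of_Q_lt; reflexivity|].
    exists n. intros a b ha hb. apply CRle_trans with (2 := hn a b ha hb). apply dist_coord. }
  set (L := (fun i => projT1 (CR_complete R _ (hcau i))) : point R N).
  assert (hL : forall i, CR_cv R (fun n => u n i) (L i)) by (intros i; exact (projT2 (CR_complete R _ (hcau i)))).
  exists L. split.
  - intros i. apply CRabs_le_iff. split.
    + apply (CR_cv_bound_down _ _ _ O) with (2 := hL i). intros n _. apply (proj1 (CRabs_le_iff _ _) (hu n i)).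
    + apply (CR_cv_bound_up _ _ _ O) with (2 := hL i). intros n _. apply (proj1 (CRabs_le_iff _ _) (hu n i)).
  - intros e he. destruct (@hpow_below (INR N) e he) as [k hk].
    destruct (hc (hpow k) (hpow_pos _)) as [n hn]. exists n. intros a ha.
    apply CRle_trans with (INR N * hpow k); [|lin hk]. apply dist_sup; [apply CRlt_asym, hpow_pos|].
    intros i.
    assert (hb : forall m, (n <= m)%nat -> CRabs R (u a i - u m i) <= hpow k).
    { intros m hm. apply CRle_trans with (2 := hn a m ha hm). apply dist_coord. }
    apply CRabs_le_iff. split.
    + assert (L i <= u a i + hpow k); [|lin H]. apply (CR_cv_bound_up _ _ _ n) with (2 := hL i).
      intros m hm. pose proof (proj1 (CRabs_le_iff _ _) (hb m hm)) as h. lin h.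
    + assert (u a i - hpow k <= L i); [|lin H]. apply (CR_cv_bound_down _ _ _ n) with (2 := hL i).
      intros m hm. pose proof (proj1 (CRabs_le_iff _ _) (hb m hm)) as h. lin h.
Qed.

Lemma clamp_approx B (t u d : CR) : 0 <= B -> CRabs R t <= B -> CRabs R (t - u) <= d -> CRabs R (t - clamp B u) <= d.
Proof.
  intros hB ht h. apply CRabs_le_iff in ht. rewrite <- (@clamp_id B t) at 1 by apply ht.
  apply CRle_trans with (2 := h). unfold clamp.
  apply CRle_trans with (1 := CRmax_contract _ _ _). apply CRmin_contract.
Qed.

(** The equally spaced points are clamped because a net must consist of points of the set; clamping
    fixes [t] and increases no distance. *)
Lemma interval_net B d : 0 <= B -> 0 < d ->
  {m : nat & {g : nat -> CR & (forall j, CRabs R (g j) <= B) *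
    (forall t, CRabs R t <= B -> {j : nat & (j < m)%nat /\ CRabs R (t - g j) <= d})}}%type.
Proof.
  intros hB hd. destruct (@hpow_below (CR_of_Q R 2) d hd) as [k hk].
  destruct (CRup_nat (CR_of_Q R 2 * B * tpow k)) as [m hm].
  exists (S m), (fun j => clamp B (hpow k * INR j - B)). split.
  - intros j. apply CRabs_le_iff. apply clamp_range. exact hB.
  - intros t ht. destruct (@approx_index ((t + B) * tpow k) m) as [j [hj hj']].
    + apply CRabs_le_iff in ht. apply CRmult_le0; [lin ht|apply CRlt_asym, tpow_pos].
    + apply CRabs_le_iff in ht. apply CRle_trans with (CR_of_Q R 2 * B * tpow k).
      * apply CRmult_le_compat_r; [apply CRlt_asym, tpow_pos|lin ht].
      * apply CRlt_asym. exact hm.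
    + exists j. split; [lia|]. apply clamp_approx; [exact hB|exact ht|].
      setoid_replace (t - (hpow k * INR j - B)) with (hpow k * ((t + B) * tpow k - INR j) + (1 - hpow k * tpow k) * (t + B)) by ring.
      rewrite hpow_tpow.
      setoid_replace (hpow k * ((t + B) * tpow k - INR j) + (1 - 1) * (t + B)) with (hpow k * ((t + B) * tpow k - INR j)) by ring.
      apply CRle_trans with (hpow k * CR_of_Q R 2); [|lin hk].
      apply CRabs_prod_le; [apply CRlt_asym, hpow_pos|exact hj'].
Qed.

Lemma cube_net n B d : 0 <= B -> 0 < d ->
  {m : nat & {g : nat -> Fin.t n -> CR & (forall j i, CRabs R (g j i) <= B) *
    (forall t, (forall i, CRabs R (t i) <= B) ->
      {j : nat & (j < m)%nat /\ forall i, CRabs R (t i - g j i) <= d})}}%type.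
Proof.
  intros hB hd. destruct (interval_net hB hd) as [m1 [g1 [h1 net1]]].
  induction n as [|n [m [g [h net]]]].
  - exists 1%nat, (fun _ _ => 0). split.
    + intros j i. inversion i.
    + intros t _. exists O. split; [lia|]. intros i. inversion i.
  (* An index encodes a pair: the quotient by [m] for the first coordinate, the remainder for the
     others. *)
  - exists (m1 * m)%nat, (fun j => fin_cons (g1 (j / m)%nat) (g (j mod m)%nat)). split.
    + intros j i. apply (Fin.caseS' i); [apply h1|]. intros p. apply h.
    + intros t ht. destruct (net1 (t F1) (ht F1)) as [a [ha ha']].
      destruct (net (fun i => t (FS i)) (fun i => ht (FS i))) as [b [hb hb']].
      exists (b + a * m)%nat. split; [nia|].
      rewrite Nat.div_add, Nat.Div0.mod_add, Nat.div_small, Nat.mod_small by lia.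
      intros i. apply (Fin.caseS' i); [exact ha'|exact hb'].
Qed.

Lemma sup_ball_totally_bounded B : 0 <= B -> totally_bounded (sup_ball B).
Proof.
  intros hB e he. destruct (@hpow_below (INR N) e he) as [k hk].
  destruct (@cube_net N B (hpow k) hB (hpow_pos _)) as [m [g [h net]]].
  exists m, (fun j => g (proj1_sig (Fin.to_nat j))). split.
  - intros j i. apply h.
  - intros x hx. destruct (net x hx) as [j [hj hj']]. exists (Fin.of_nat_lt hj).
    rewrite Fin.to_nat_of_nat. cbn [proj1_sig].
    apply CRle_lt_trans with (INR N * hpow k); [|lin hk].
    apply dist_sup; [apply CRlt_asym, hpow_pos|exact hj'].
Qed.

Lemma sup_ball_compact B : 0 <= B -> compact (sup_ball B).
Proof. intros hB. split; [apply sup_ball_complete|apply sup_ball_totally_bounded; exact hB]. Qed.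

(** Test functions are uniformly continuous on compact sets, and a bounded set lies in a compact
    ball of the sup norm. The radius is [CRmax B 0] because the sign of [B] is unknown. *)
Lemma test_ucont (f : point R N -> CR) : test_function f -> ucont f.
Proof.
  intros [_ hc _] B e he.
  destruct (hc (sup_ball (CRmax B 0)) (sup_ball_compact (CRmax_r B 0)) e he) as [d [hd H]].
  destruct (@hpow_below (INR N) d hd) as [k hk]. exists (hpow k). split; [apply hpow_pos|].
  intros x y hx hy hxy. pose proof (CRmax_l B 0) as hm. apply H.
  - intros i. specialize (hx i). lin (hx, hm).
  - intros i. specialize (hy i). lin (hy, hm).
  - apply CRle_trans with (INR N * hpow k); [|lin hk].
    apply dist_sup; [apply CRlt_asym, hpow_pos|exact hxy].
Qed.

(** A totally bounded set is bounded, by means of a net at scale 1, and this is what [ucont] asks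
    for. *)
Lemma ucont_test (f : point R N -> CR) M : 0 <= M -> ucont f ->
  (forall x i, M < CRabs R (x i) -> f x == 0) -> test_function f.
Proof.
  intros hM hf hs. split.
  - intros x y. apply ucont_ext. exact hf.
  - intros K [_ htb] e he. destruct (htb 1) as [n [a [_ hnet]]]; [lin|].
    destruct (fin_bound (fun k => dist (a k) (fun _ => 0))) as [B [h0 hB]].
    destruct (hf (B + 1) e he) as [d [hd H]]. exists d. split; [exact hd|].
    assert (hb : forall x, K x -> forall i, CRabs R (x i) <= B + 1).
    { intros x hx i. destruct (hnet x hx) as [k hk]. specialize (hB k). cbv beta in hB.
      pose proof (@dist_coord x (fun _ => 0) i) as h1. cbv beta in h1.
      setoid_replace (x i - 0) with (x i) in h1 by ring.
      pose proof (@dist_triang x (a k) (fun _ => 0)) as h3. lin (h1, h3, hk, hB). }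
    intros x y hx hy hxy. apply H; [apply hb; exact hx|apply hb; exact hy|].
    intros i. apply CRle_trans with (2 := hxy). apply dist_coord.
  - exists (sup_ball M). split; [apply sup_ball_compact; exact hM|].
    intros x [r [hr hx]].
    (* If f x were nonzero, no coordinate of [x] could exceed M, and [x] would be a point of the
       ball at positive distance from itself. *)
    assert (hall : (CRapart R (f x) 0) -> False).
    { intros hap. assert (hin : forall i, CRabs R (x i) <= M).
      { intros i hlt. specialize (hs x i hlt). destruct hap as [h|h]; rewrite hs in h; exact (CRle_refl _ h). }
      specialize (hx x hin). pose proof (dist_point_eq (x := x) (y := x) (fun i => CReq_refl (x i))) as h.
      lin (hr, hx, h). }
    split; intros h; apply hall; [left|right]; exact h.
Qed.

(** * Representations of integrable functions *)

(** A cube in arbitrary position is enclosed in some [-2^L, 2^L]^N that carries the whole integral,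
    and positivity discards the rest. *)
Lemma origin_subcube (f : cfun (N := N)) c J q v : (forall x, 0 <= f x) -> riemann_integral f v ->
  CRpow (hpow q * tpow (S J)) N * avg f c (hpow q * tpow (S J)) <= v.
Proof.
  intros hf hv. destruct (riemann_avg hv) as [J0 hJ0].
  set (l := hpow q * tpow (S J)).
  assert (hl : 0 < l) by (apply CRmult_lt_0_compat; [apply hpow_pos|apply tpow_pos]).
  destruct (fin_bound (fun i => CRabs R (c i))) as [B [h0 hB]].
  destruct (tpow_above (B + l)) as [k hk].
  set (L := (J0 + J + k)%nat).
  assert (hBL : B + l <= tpow L) by (pose proof (@tpow_le k L ltac:(unfold L; lia)) as h; lin (h, hk)).
  rewrite <- (hJ0 L) by (unfold L; lia).
  (* The ratio of the two sides is again a power of 1/2, as [avg_subcube] requires. *)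
  assert (el : hpow (q + (L - J)) * tpow (S L) == l).
  { unfold l. rewrite hpow_plus. replace (S L) with ((L - J) + S J)%nat by (unfold L; lia). rewrite (@tpow_plus).
    replace (L - J + S J - S J)%nat with (L - J)%nat by lia.
    setoid_replace (hpow q * hpow (L - J) * (tpow (L - J) * tpow (S J))) with
      (hpow q * tpow (S J) * (hpow (L - J) * tpow (L - J))) by ring.
    rewrite hpow_tpow. ring. }
  pose proof (@avg_subcube N f (origin_cube L) (tpow (S L)) (q + (L - J)) c (tpow_pos _) (fun x _ => hf x)) as h.
  assert (hin : forall i, origin_cube L i <= c i /\ c i + hpow (q + (L - J)) * tpow (S L) <= origin_cube L i + tpow (S L)).
  { intros i. unfold origin_cube. specialize (hB i). pose proof (CRabs_bound (c i)) as hc.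
    pose proof (@tpow_S L) as hS. split; lin (hB, hc, hBL, hl, el, hS). }
  specialize (h hin). rewrite (avg_point_eq f (fun i => CReq_refl (c i)) el) in h.
  apply (CRmult_le_compat_l (cube_vol (N := N) L)) in h; [|apply CRlt_asym, cube_vol_pos].
  apply CRle_trans with (2 := h). unfold cube_vol.
  rewrite <- CRmult_assoc, CRpow_mult, (CRpow_proper (tpow (S L) * hpow (q + (L - J))) l); [apply CRle_refl|].
  rewrite <- el. ring.
Qed.

(** What is kept of [has_integral], with integrals replaced by averages. [r_abs] concerns cubes in
    any position because tails are also integrated over images of homotheties. *)
Record rep (f : partial_function R N) (v : CR) : Type := {
  rf : nat -> cfun (N := N);
  rI : nat -> CR;
  rJ : nat -> CR;
  r_sum : CR;
  r_Icv : series_cv rI r_sum;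
  r_Jcv : series_cv rJ v;
  r_pt : forall x, series_converges (fun n => CRabs R (rf n x)) ->
    {hx : dom f x & series_cv (fun n => rf n x) (val hx)};
  r_abs : forall n c J q,
    CRpow (hpow q * tpow (S J)) N * avg (cabs (rf n)) c (hpow q * tpow (S J)) <= rI n;
  r_val : forall n, {J0 : nat & forall J, (J0 <= J)%nat ->
    cube_vol (N := N) J * avg (rf n) (origin_cube J) (tpow (S J)) == rJ n}
}.

Lemma has_integral_rep f v : has_integral f v -> rep f v.
Proof.
  intros [fn [I [J [[[[[ht hI] hJ] [s hs]] hpt] hv]]]].
  refine (@Build_rep f v (fun n => CFun (test_ucont (ht n))) I J s hs hv hpt _ _).
  - intros n c K q. apply origin_subcube; [intros x; apply CRabs_pos|exact (hI n)].
  - intros n. apply riemann_avg. exact (hJ n).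
Qed.

End Metric.

(** * Cubes are integrable *)

Section Trapezoid.

Definition pos_part (t : CR) : CR := CRmax t 0.

Lemma pos_of_pos t : 0 <= t -> pos_part t == t.
Proof. intros h. apply CRmax_left. exact h. Qed.
Lemma pos_of_neg t : t <= 0 -> pos_part t == 0.
Proof. intros h. apply CRmax_right. exact h. Qed.

(** Half the square of the positive part is a primitive of the positive part, which is nondecreasing
    and 1-Lipschitz; hence a nonnegative error, at most quadratic. *)
Lemma pos_primitive u v : u <= v ->
  0 <= half * (pos_part v * pos_part v) - half * (pos_part u * pos_part u) - pos_part u * (v - u) /\
  half * (pos_part v * pos_part v) - half * (pos_part u * pos_part u) - pos_part u * (v - u) <= half * ((v - u) * (v - u)).
Proof.
  intros h. split.
  - apply (CRle_by_cases (x := 0) (y := u)); intros hu.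
    + rewrite (pos_of_pos (t := u)), (pos_of_pos (t := v)); [|lin (h, hu)|lin hu].
      pose proof (@CRsquare_nonneg (v - u)) as hs. lin hs.
    + rewrite (pos_of_neg (t := u)) by exact hu. pose proof (@CRsquare_nonneg (pos_part v)) as hs. lin hs.
  - apply (CRle_by_cases (x := 0) (y := u)); intros hu.
    + rewrite (pos_of_pos (t := u)), (pos_of_pos (t := v)); [|lin (h, hu)|lin hu]. lin.
    + rewrite (pos_of_neg (t := u)) by exact hu.
      apply (CRle_by_cases (x := 0) (y := v)); intros hv.
      * rewrite (pos_of_pos (t := v)) by lin hv.
        assert (h1 : 0 <= (- u) * (v + v - u)) by (apply CRmult_le0; lin (hu, hv)). lin h1.
      * rewrite (pos_of_neg (t := v)) by exact hv. pose proof (@CRsquare_nonneg (v - u)) as hs. lin hs.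
Qed.

Variables (r e : CR).
Hypothesis hr : 0 < r.
Hypothesis he : 0 < e.

(* e times the trapezoid equal to 1 on [-r, r] and to 0 outside [-r-e, r+e], as a
   combination of positive parts so that it has an explicit primitive. *)
Definition trap t : CR := pos_part (t + r + e) - pos_part (t + r) - pos_part (t - r) + pos_part (t - r - e).
Definition trap_prim t : CR :=
  half * (pos_part (t + r + e) * pos_part (t + r + e)) - half * (pos_part (t + r) * pos_part (t + r))
  - half * (pos_part (t - r) * pos_part (t - r)) + half * (pos_part (t - r - e) * pos_part (t - r - e)).

Lemma trap_mid t : - r <= t -> t <= r -> trap t == e.
Proof.
  intros h1 h3. unfold trap.
  rewrite (pos_of_pos (t := t + r + e)), (pos_of_pos (t := t + r)), (pos_of_neg (t := t - r)), (pos_of_neg (t := t - r - e));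
    [ring|lin (h3, he)|lin h3|lin h1|lin (h1, he)].
Qed.
Lemma trap_left t : t <= - r - e -> trap t == 0.
Proof.
  intros h1. unfold trap.
  rewrite (pos_of_neg (t := t + r + e)), (pos_of_neg (t := t + r)), (pos_of_neg (t := t - r)), (pos_of_neg (t := t - r - e));
    [ring|lin (h1, he, hr)|lin (h1, he, hr)|lin (h1, he)|lin h1].
Qed.
Lemma trap_right t : r + e <= t -> trap t == 0.
Proof.
  intros h1. unfold trap.
  rewrite (pos_of_pos (t := t + r + e)), (pos_of_pos (t := t + r)), (pos_of_pos (t := t - r)), (pos_of_pos (t := t - r - e));
    [ring|lin h1|lin (h1, he)|lin (h1, he, hr)|lin (h1, he, hr)].
Qed.
Lemma trap_up t : - r - e <= t -> t <= - r -> trap t == t + r + e.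
Proof.
  intros h1 h3. unfold trap.
  rewrite (pos_of_pos (t := t + r + e)), (pos_of_neg (t := t + r)), (pos_of_neg (t := t - r)), (pos_of_neg (t := t - r - e));
    [ring|lin (h3, he, hr)|lin (h3, hr)|lin h3|lin h1].
Qed.
Lemma trap_down t : r <= t -> t <= r + e -> trap t == r + e - t.
Proof.
  intros h1 h3. unfold trap.
  rewrite (pos_of_pos (t := t + r + e)), (pos_of_pos (t := t + r)), (pos_of_pos (t := t - r)), (pos_of_neg (t := t - r - e));
    [ring|lin h3|lin h1|lin (h1, hr)|lin (h1, hr, he)].
Qed.

(** Since the goal is a weak inequality, the position of [t] may be distinguished although the order
    is undecidable. *)
Lemma trap_cases t (x y : CR) :
  (t <= - r - e -> trap t == 0 -> x <= y) ->
  (- r - e <= t -> t <= - r -> trap t == t + r + e -> x <= y) ->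
  (- r <= t -> t <= r -> trap t == e -> x <= y) ->
  (r <= t -> t <= r + e -> trap t == r + e - t -> x <= y) ->
  (r + e <= t -> trap t == 0 -> x <= y) -> x <= y.
Proof.
  intros k1 k2 k3 k4 k5.
  apply (CRle_by_cases (x := t) (y := - r - e)); intros a1.
  { apply k1; [lin a1|apply trap_left; lin a1]. }
  apply (CRle_by_cases (x := t) (y := - r)); intros a2.
  { apply k2; [lin a1|lin a2|apply trap_up; lin (a1, a2)]. }
  apply (CRle_by_cases (x := t) (y := r)); intros a3.
  { apply k3; [lin a2|lin a3|apply trap_mid; lin (a2, a3)]. }
  apply (CRle_by_cases (x := t) (y := r + e)); intros a4.
  { apply k4; [lin a3|lin a4|apply trap_down; lin (a3, a4)]. }
  apply k5; [lin a4|apply trap_right; lin a4].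
Qed.

Lemma trap_nonneg t : 0 <= trap t.
Proof. apply (trap_cases (t := t)); intros; lin (he, H, H0, H1) || lin (he, H, H0). Qed.

Lemma trap_le t : trap t <= e.
Proof. apply (trap_cases (t := t)); intros; lin (he, H, H0, H1) || lin (he, H, H0). Qed.

(** The conclusion is strict, so excluding |t| <= r is not enough. Cotransitivity is used together
    with the quantitative bound e - trap t <= max(0, |t| - r). [trap_pos] is proved in the same
    way. *)
Lemma trap_lt t : trap t < e -> r < CRabs R t.
Proof.
  intros h. destruct (@CRlt_or (trap t) e (CRabs R t - r + trap t) h) as [h1|h1]; [lin h1|].
  exfalso. pose proof (CRabs_bound t) as hb.
  assert (hk : e - trap t <= CRmax 0 (CRabs R t - r)).
  { pose proof (CRmax_l 0 (CRabs R t - r)) as m1. pose proof (CRmax_r 0 (CRabs R t - r)) as m2.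
    apply (trap_cases (t := t)); intros; lin (he, H, H0, H1, hb, m1, m2) || lin (he, H, H0, hb, m1, m2). }
  apply hk. apply CRmax_lub_lt; [lin h|lin h1].
Qed.

Lemma trap_pos t : 0 < trap t -> CRabs R t < r + e.
Proof.
  intros h. destruct (@CRlt_or 0 (trap t) (r + e - CRabs R t) h) as [h1|h1]; [lin h1|].
  exfalso. 
  assert (hk : trap t <= CRmax 0 (r + e - CRabs R t)).
  { pose proof (CRmax_l 0 (r + e - CRabs R t)) as m1. pose proof (CRmax_r 0 (r + e - CRabs R t)) as m2.
    apply (trap_cases (t := t)); intros.
    - lin (he, H0, m1).
    - rewrite (CRabs_left t) in m2 by lin (H0, hr). rewrite (CRabs_left t) by lin (H0, hr). lin (H1, m2).
    - assert (hb : CRabs R t <= r) by (apply CRabs_le_iff; split; [exact H|exact H0]). lin (H1, m2, hb).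
    - rewrite (CRabs_right t) in m2 by lin (H, hr). rewrite (CRabs_right t) by lin (H, hr). lin (H1, m2).
    - lin (he, H0, m1). }
  apply hk. apply CRmax_lub_lt; [exact h|exact h1].
Qed.

Lemma trap_out t : r + e <= CRabs R t -> trap t == 0.
Proof.
  intros h. split; [apply trap_nonneg|]. intros h1. apply trap_pos in h1. lin (h, h1).
Qed.

Lemma trap_prim_close u v : u <= v ->
  CRabs R (trap_prim v - trap_prim u - trap u * (v - u)) <= (v - u) * (v - u).
Proof.
  intros h.
  assert (h1 := @pos_primitive (u + r + e) (v + r + e) ltac:(lin h)).
  assert (h3 := @pos_primitive (u + r) (v + r) ltac:(lin h)).
  assert (h4 := @pos_primitive (u - r) (v - r) ltac:(lin h)).
  assert (h5 := @pos_primitive (u - r - e) (v - r - e) ltac:(lin h)).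
  unfold trap_prim, trap. apply CRabs_le_iff. split; lin (h1, h3, h4, h5).
Qed.

Lemma trap_prim_morph s t : s == t -> trap_prim s == trap_prim t.
Proof.
  intros h. unfold trap_prim, pos_part. rewrite h. reflexivity.
Qed.

Lemma trap_prim_total M : r + e <= M -> trap_prim M - trap_prim (- M) == CR_of_Q R 2 * e * r + e * e.
Proof.
  intros h. unfold trap_prim.
  rewrite (pos_of_pos (t := M + r + e)), (pos_of_pos (t := M + r)), (pos_of_pos (t := M - r)), (pos_of_pos (t := M - r - e));
    [|lin h|lin (h, he)|lin (h, hr, he)|lin (h, hr, he)].
  rewrite (pos_of_neg (t := - M + r + e)), (pos_of_neg (t := - M + r)), (pos_of_neg (t := - M - r)), (pos_of_neg (t := - M - r - e));
    [ring|lin (h, he, hr)|lin (h, he, hr)|lin (h, he)|lin h].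
Qed.

Lemma trap_lip s t : CRabs R (trap s - trap t) <= CR_of_Q R 4 * CRabs R (s - t).
Proof.
  assert (hp : forall a b, CRabs R (pos_part a - pos_part b) <= CRabs R (a - b)) by (intros; apply CRmax_contract).
  pose proof (hp (s + r + e) (t + r + e)) as h1. pose proof (hp (s + r) (t + r)) as h3.
  pose proof (hp (s - r) (t - r)) as h4. pose proof (hp (s - r - e) (t - r - e)) as h5.
  setoid_replace (s + r + e - (t + r + e)) with (s - t) in h1 by ring.
  setoid_replace (s + r - (t + r)) with (s - t) in h3 by ring.
  setoid_replace (s - r - (t - r)) with (s - t) in h4 by ring.
  setoid_replace (s - r - e - (t - r - e)) with (s - t) in h5 by ring.
  apply CRabs_le_iff in h1. apply CRabs_le_iff in h3. apply CRabs_le_iff in h4. apply CRabs_le_iff in h5.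
  unfold trap. apply CRabs_le_iff. split; lin (h1, h3, h4, h5).
Qed.

End Trapezoid.

(** With heights normalised to 1, the steeper trapezoid lies below the flatter one; this makes the
    approximations of the characteristic function of a box decrease. *)
Lemma trap_halve r e t : 0 < r -> 0 < e -> CR_of_Q R 2 * trap r (half * e) t <= trap r e t.
Proof.
  intros hr he. assert (he2 : 0 < half * e) by lin he.
  apply (trap_cases hr he2 (t := t)); intros.
  - pose proof (trap_nonneg hr he (t := t)) as h. lin (H0, h).
  - rewrite (@trap_up r e hr he t); lin (H, H0, H1, he).
  - rewrite (@trap_mid r e he t); lin (H, H0, H1, he).
  - rewrite (@trap_down r e hr he t); lin (H, H0, H1, he).
  - pose proof (trap_nonneg hr he (t := t)) as h. lin (H0, h).
Qed.

(** * Products over the coordinates *)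

Section Products.

Lemma fin_prod_mult n (u v : Fin.t n -> CR) : fin_prod (fun i => u i * v i) == fin_prod u * fin_prod v.
Proof. induction n as [|n IH]; simpl; [ring|]. rewrite IH. ring. Qed.

Lemma fin_prod_abs_bound n (u : Fin.t n -> CR) C : (forall i, CRabs R (u i) <= C) ->
  CRabs R (fin_prod u) <= CRpow C n.
Proof.
  induction n as [|n IH]; simpl; intros h.
  - rewrite CRabs_right; [apply CRle_refl|lin].
  - rewrite CRabs_mult. pose proof (CRabs_pos (u F1)) as h0. specialize (IH _ (fun i => h (FS i))). specialize (h F1).
    pose proof (CRabs_pos (fin_prod (fun i => u (FS i)))) as h1.
    apply CRle_trans with (C * CRabs R (fin_prod (fun i => u (FS i)))).
    + apply CRmult_le_compat_r; assumption.
    + apply CRmult_le_compat_l; [lin (h, h0)|exact IH].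
Qed.

Lemma fin_prod_close n C e : 0 <= C -> 0 < e ->
  {d : CR & (0 < d) * (forall u v : Fin.t n -> CR, (forall i, CRabs R (u i) <= C) -> (forall i, CRabs R (v i) <= C) ->
    (forall i, CRabs R (u i - v i) <= d) -> CRabs R (fin_prod u - fin_prod v) <= e)}%type.
Proof.
  intros hC. revert e. induction n as [|n IH]; simpl; intros e he.
  - exists 1. split; [lin|]. intros u v _ _ _. rewrite CRabs_right; lin he.
  - destruct (@hpow_below C (half * e)) as [k1 hk1]; [lin he|].
    destruct (@hpow_below (CRpow C n) (half * e)) as [k2 hk2]; [lin he|].
    destruct (IH (hpow k1) (hpow_pos _)) as [d [hd H]].
    exists (CRmin d (hpow k2)). split; [apply CRmin_pos; [exact hd|apply hpow_pos]|].
    intros u v hu hv huv. pose proof (CRmin_l d (hpow k2)) as m1. pose proof (CRmin_r d (hpow k2)) as m2.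
    assert (h1 := H (fun i => u (FS i)) (fun i => v (FS i)) (fun i => hu (FS i)) (fun i => hv (FS i))
      (fun i => CRle_trans _ _ _ (huv (FS i)) m1)).
    set (U := fin_prod (fun i => u (FS i))) in *. set (V := fin_prod (fun i => v (FS i))) in *.
    assert (h3 : CRabs R V <= CRpow C n) by (apply fin_prod_abs_bound; intros i; apply hv).
    setoid_replace (u F1 * U - v F1 * V) with (u F1 * (U - V) + (u F1 - v F1) * V) by ring.
    apply CRle_trans with (1 := CRabs_triang _ _). rewrite !CRabs_mult.
    assert (a1 : CRabs R (u F1) * CRabs R (U - V) <= C * hpow k1).
    { apply CRle_trans with (C * CRabs R (U - V)).
      - apply CRmult_le_compat_r; [apply CRabs_pos|apply hu].
      - apply CRmult_le_compat_l; [exact hC|exact h1]. }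
    assert (a2 : CRabs R (u F1 - v F1) * CRabs R V <= hpow k2 * CRpow C n).
    { apply CRle_trans with (hpow k2 * CRabs R V).
      - apply CRmult_le_compat_r; [apply CRabs_pos|]. apply (CRle_trans _ _ _ (huv F1) m2).
      - apply CRmult_le_compat_l; [apply CRlt_asym, hpow_pos|exact h3]. }
    lin (a1, a2, hk1, hk2).
Qed.

Lemma CRsum_mult_l (u : nat -> CR) a n : CRsum (fun j => a * u j) n == a * CRsum u n.
Proof.
  rewrite (CRmult_comm a), <- sum_scale. apply CRsum_eq. intros; apply CRmult_comm.
Qed.

Lemma grid_sum_prod n (d : Fin.t n -> nat) (w : Fin.t n -> nat -> CR) :
  grid_sum d (fun k => fin_prod (fun i => w i (k i))) == fin_prod (fun i => CRsum (w i) (d i)).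
Proof.
  induction n as [|n IH]; simpl; [reflexivity|].
  rewrite (CRsum_eq _ (fun j => fin_prod (fun i => CRsum (w (FS i)) (d (FS i))) * w F1 j)).
  - rewrite CRsum_mult_l. ring.
  - intros j _. rewrite grid_sum_scale, (IH (fun i => d (FS i)) (fun i => w (FS i))). ring.
Qed.

Lemma fin_prod_le_factor n (u : Fin.t n -> CR) i : (forall i, 0 <= u i /\ u i <= 1) -> fin_prod u <= u i.
Proof.
  revert u i. induction n as [|n IH]; intros u i h; [inversion i|]. simpl.
  destruct (@fin_prod_bounds n (fun i => u (FS i)) (fun _ => 1) (fun i => h (FS i))) as [b0 b1].
  rewrite fin_prod_const, CRpow_one in b1.
  destruct (h F1) as [h0 h1]. revert u h b0 b1 h0 h1. apply (Fin.caseS' i); intros.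
  - assert (k : 0 <= u F1 * (1 - fin_prod (fun i => u (FS i)))) by (apply CRmult_le0; [exact h0|lin b1]). lin k.
  - pose proof (IH (fun i => u (FS i)) p (fun i => h (FS i))) as hI. cbv beta in hI.
    assert (k : 0 <= (1 - u F1) * fin_prod (fun i => u (FS i))) by (apply CRmult_le0; [lin h1|exact b0]). lin (k, hI).
Qed.

(** It will locate a coordinate that is outside the box. No factor can be tested against 1, so
    cotransitivity is used, and (1 - a)(1 - b) >= 0 passes the defect on to the remaining
    factors. *)
Lemma fin_prod_lt1 n (u : Fin.t n -> CR) : (forall i, 0 <= u i /\ u i <= 1) -> fin_prod u < 1 -> {i : Fin.t n & u i < 1}.
Proof.
  induction n as [|n IH]; simpl; intros h hlt; [destruct (CRle_refl _ hlt)|].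
  destruct (@CRlt_or _ _ (u F1) hlt) as [h1|h1]; [|exists F1; exact h1].
  destruct (@fin_prod_bounds n (fun i => u (FS i)) (fun _ => 1) (fun i => h (FS i))) as [b0 b1].
  rewrite fin_prod_const, CRpow_one in b1. destruct (h F1) as [h3 h4].
  assert (k : 0 <= (1 - u F1) * (1 - fin_prod (fun i => u (FS i)))) by (apply CRmult_le0; [lin h4|lin b1]).
  destruct (IH (fun i => u (FS i)) (fun i => h (FS i))) as [i hi]; [lin (k, h1)|].
  exists (FS i). exact hi.
Qed.

Lemma fin_prod_zero n (u : Fin.t n -> CR) i : u i == 0 -> fin_prod u == 0.
Proof.
  revert u i. induction n as [|n IH]; intros u i; [inversion i|]. simpl.
  revert u. apply (Fin.caseS' i); intros; [rewrite H; ring|].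
  rewrite (IH (fun i => u (FS i)) p H). ring.
Qed.

End Products.

(** * Integrability of the box [-r, r]^N *)

Section Box.

Context {N : nat}.
Variable r : CR.
Hypothesis hr : 0 < r.
Implicit Types (x y : point R N).

(** The slopes have width 2^-k <= 1, so one cube serves for all the approximations. *)
Let M : CR := r + 1.

Definition trap1 (k : nat) (t : CR) : CR := tpow k * trap r (hpow k) t.

Lemma trap1_range k t : 0 <= trap1 k t /\ trap1 k t <= 1.
Proof.
  pose proof (@trap_nonneg r (hpow k) hr (hpow_pos k) t) as h0. pose proof (@trap_le r (hpow k) hr (hpow_pos k) t) as h1.
  unfold trap1. split; [apply CRmult_le0; [apply CRlt_asym, tpow_pos|exact h0]|].
  apply (CRmult_le_compat_l (tpow k)) in h1; [|apply CRlt_asym, tpow_pos].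
  rewrite (CRmult_comm (tpow k) (hpow k)), hpow_tpow in h1. exact h1.
Qed.

Lemma trap1_mid k t : CRabs R t <= r -> trap1 k t == 1.
Proof.
  intros h. apply CRabs_le_iff in h. unfold trap1. rewrite (@trap_mid r (hpow k) (hpow_pos k) t) by apply h.
  rewrite CRmult_comm. apply hpow_tpow.
Qed.

Lemma trap1_lt k t : trap1 k t < 1 -> r < CRabs R t.
Proof.
  intros h. apply (@trap_lt r (hpow k) hr (hpow_pos k)).
  apply (CRmult_lt_compat_l (hpow k)) in h; [|apply hpow_pos]. unfold trap1 in h.
  rewrite <- CRmult_assoc, hpow_tpow in h. lin h.
Qed.

Lemma trap1_pos k t : 0 < trap1 k t -> CRabs R t < r + hpow k.
Proof.
  intros h. apply (@trap_pos r (hpow k) hr (hpow_pos k)).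
  apply (CRmult_lt_compat_l (hpow k)) in h; [|apply hpow_pos]. unfold trap1 in h.
  rewrite <- CRmult_assoc, hpow_tpow in h. lin h.
Qed.

Lemma trap1_out k t : r + hpow k <= CRabs R t -> trap1 k t == 0.
Proof. intros h. unfold trap1. rewrite (@trap_out r (hpow k) hr (hpow_pos k) t h). ring. Qed.

Lemma trap1_S k t : trap1 (S k) t <= trap1 k t.
Proof.
  unfold trap1. pose proof (@trap_halve r (hpow k) t hr (hpow_pos k)) as h.
  apply (CRmult_le_compat_l (tpow k)) in h; [|apply CRlt_asym, tpow_pos].
  change (CR_of_Q R 2 * tpow k * trap r (half * hpow k) t <= tpow k * trap r (hpow k) t). lin h.
Qed.

Lemma trap1_lip k s t : CRabs R (trap1 k s - trap1 k t) <= tpow k * (CR_of_Q R 4 * CRabs R (s - t)).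
Proof.
  unfold trap1. setoid_replace (tpow k * trap r (hpow k) s - tpow k * trap r (hpow k) t) with
    (tpow k * (trap r (hpow k) s - trap r (hpow k) t)) by ring.
  apply CRabs_prod_le; [apply CRlt_asym, tpow_pos|]. apply trap_lip.
Qed.

Definition trap_prod (k : nat) x : CR := fin_prod (fun i => trap1 k (x i)).

Lemma trap_prod_ucont k : ucont (trap_prod k).
Proof.
  intros B e he. destruct (@fin_prod_close N 1 e) as [d [hd H]]; [lin|exact he|].
  destruct (@hpow_below (tpow k * CR_of_Q R 4) d hd) as [j hj]. exists (hpow j). split; [apply hpow_pos|].
  intros x y _ _ hxy. apply H.
  - intros i. pose proof (trap1_range k (x i)) as h. apply CRabs_le_iff. split; lin h.
  - intros i. pose proof (trap1_range k (y i)) as h. apply CRabs_le_iff. split; lin h.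
  - intros i. apply CRle_trans with (1 := @trap1_lip k (x i) (y i)).
    apply CRle_trans with (tpow k * (CR_of_Q R 4 * hpow j)); [|lin hj].
    apply CRmult_le_compat_l; [apply CRlt_asym, tpow_pos|]. apply CRmult_le_compat_l; [lin|apply hxy].
Qed.

Lemma trap_prod_range k x : 0 <= trap_prod k x /\ trap_prod k x <= 1.
Proof.
  unfold trap_prod. rewrite <- (CRpow_one N), <- fin_prod_const. apply fin_prod_bounds. intros i. apply trap1_range.
Qed.

Lemma trap_prod_S k x : trap_prod (S k) x <= trap_prod k x.
Proof. apply fin_prod_bounds. intros i. split; [apply trap1_range|apply trap1_S]. Qed.

Lemma trap_prod_out k x i : M < CRabs R (x i) -> trap_prod k x == 0.
Proof.
  intros h. apply (fin_prod_zero (i := i)). apply trap1_out. pose proof (@hpow_le1 k) as h1. unfold M in h. lin (h, h1).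
Qed.

Lemma part_range (P : Defs.partition (- M) M) j : (j <= S (part_last P))%nat -> - M <= part_pt P j /\ part_pt P j <= M.
Proof.
  intros hj. split.
  - apply CRle_trans with (part_pt P 0); [apply (part_first_pt P)|]. induction j as [|j IH]; [apply CRle_refl|].
    apply CRle_trans with (part_pt P j); [apply IH; lia|apply part_mono; lia].
  - apply CRle_trans with (part_pt P (S (part_last P))); [|apply (part_last_pt P)].
    assert (h : forall m, (j <= m)%nat -> (m <= S (part_last P))%nat -> part_pt P j <= part_pt P m).
    { intros m h. induction h as [|m h IH]; intros hm; [apply CRle_refl|].
      apply CRle_trans with (part_pt P m); [apply IH; lia|apply part_mono; lia]. }
    apply h; lia.
Qed.

Lemma part_total (P : Defs.partition (- M) M) :
  CRsum (fun j => part_pt P (S j) - part_pt P j) (part_last P) == CR_of_Q R 2 * M.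
Proof.
  assert (h : forall m, CRsum (fun j => part_pt P (S j) - part_pt P j) m == part_pt P (S m) - part_pt P 0).
  { induction m as [|m IH]; simpl; [reflexivity|]. rewrite IH. ring. }
  rewrite h. pose proof (part_first_pt P) as h0. pose proof (part_last_pt P) as h1. lin (h0, h1).
Qed.

Lemma trap1_sum_close k (P : Defs.partition (- M) M) d :
  (forall j, (j <= part_last P)%nat -> part_pt P (S j) - part_pt P j <= d) ->
  CRabs R (CRsum (fun j => trap1 k (part_pt P j) * (part_pt P (S j) - part_pt P j)) (part_last P) - (CR_of_Q R 2 * r + hpow k))
  <= d * (tpow k * (CR_of_Q R 2 * M)).
Proof.
  intros hd. set (p := part_pt P) in *.
  assert (h : forall m, (m <= part_last P)%nat ->
    CRabs R (CRsum (fun j => trap r (hpow k) (p j) * (p (S j) - p j)) m - (trap_prim r (hpow k) (p (S m)) - trap_prim r (hpow k) (p O)))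
    <= d * (p (S m) - p O)).
  { assert (hone : forall m, (m <= part_last P)%nat ->
      CRabs R (trap_prim r (hpow k) (p (S m)) - trap_prim r (hpow k) (p m) - trap r (hpow k) (p m) * (p (S m) - p m)) <= d * (p (S m) - p m)).
    { intros m hm. pose proof (part_mono hm) as hmono. fold p in hmono.
      apply CRle_trans with (1 := @trap_prim_close r (hpow k) (p m) (p (S m)) hmono).
      apply CRmult_le_compat_r; [lin hmono|apply hd; exact hm]. }
    induction m as [|m IH]; intros hm.
    - specialize (hone O hm). cbn [CRsum]. apply CRabs_le_iff in hone. apply CRabs_le_iff. split; lin hone.
    - specialize (hone (S m) hm). specialize (IH ltac:(lia)). cbn [CRsum].
      apply CRabs_le_iff in hone. apply CRabs_le_iff in IH. apply CRabs_le_iff. split; lin (hone, IH). }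
  specialize (h (part_last P) (le_n _)).
  assert (e1 : p (S (part_last P)) == M) by apply part_last_pt. assert (e0 : p O == - M) by apply part_first_pt.
  rewrite (trap_prim_morph r (hpow k) e1), (trap_prim_morph r (hpow k) e0) in h.
  rewrite (@trap_prim_total r (hpow k) hr (hpow_pos k) M) in h by (pose proof (@hpow_le1 k) as h1; unfold M; lin h1).
  rewrite e1, e0 in h.
  assert (eS : CRsum (fun j => trap1 k (p j) * (p (S j) - p j)) (part_last P) == tpow k * CRsum (fun j => trap r (hpow k) (p j) * (p (S j) - p j)) (part_last P)).
  { rewrite <- CRsum_mult_l. apply CRsum_eq. intros j _. unfold trap1. ring. }
  rewrite eS.
  set (s := CRsum (fun j => trap r (hpow k) (p j) * (p (S j) - p j)) (part_last P)) in *.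
  setoid_replace (tpow k * s - (CR_of_Q R 2 * r + hpow k)) with
    (tpow k * (s - (CR_of_Q R 2 * hpow k * r + hpow k * hpow k)) + (CR_of_Q R 2 * r + hpow k) * (hpow k * tpow k - 1)) by ring.
  rewrite hpow_tpow.
  setoid_replace (tpow k * (s - (CR_of_Q R 2 * hpow k * r + hpow k * hpow k)) + (CR_of_Q R 2 * r + hpow k) * (1 - 1)) with
    (tpow k * (s - (CR_of_Q R 2 * hpow k * r + hpow k * hpow k))) by ring.
  apply CRle_trans with (tpow k * (d * (M - - M))); [|lin].
  apply CRabs_prod_le; [apply CRlt_asym, tpow_pos|exact h].
Qed.

(** The limit clause of [riemann_integral] with the cube fixed, so that integrals can be
    subtracted. *)
Definition rint (f : point R N -> CR) (v : CR) : Type :=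
  forall eps, 0 < eps -> {d : CR & (0 < d) *
    (forall (P : Fin.t N -> Defs.partition (- M) M) xi, mesh_le P d -> tags P xi ->
       CRabs R (riemann_sum P xi f - v) <= eps)}%type.

Lemma hM : 0 < M.
Proof. unfold M. lin hr. Qed.

(** With tags at the lower corners the Riemann sum is a product of one-dimensional sums, which the
    primitive evaluates; uniform continuity accounts for other tags. *)
Lemma trap_prod_rint k : rint (trap_prod k) (CRpow (CR_of_Q R 2 * r + hpow k) N).
Proof.
  intros eps he. pose proof hM as hM.
  set (V := CRpow (CR_of_Q R 2 * M) N).
  destruct (@hpow_below V (half * eps)) as [k1 hk1]; [lin he|].
  destruct (trap_prod_ucont k M (hpow_pos k1)) as [d1 [hd1 H1]].
  destruct (@fin_prod_close N (CR_of_Q R 2 * r + CR_of_Q R 2) (half * eps)) as [d2 [hd2 H2]]; [lin hr|lin he|].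
  destruct (@hpow_below (tpow k * (CR_of_Q R 2 * M)) (CRmin d2 1)) as [j hj]; [apply CRmin_pos; [exact hd2|lin]|].
  pose proof (CRmin_l d2 1) as m1. pose proof (CRmin_r d2 1) as m2.
  exists (CRmin d1 (hpow j)). split; [apply CRmin_pos; [exact hd1|apply hpow_pos]|].
  pose proof (CRmin_l d1 (hpow j)) as m3. pose proof (CRmin_r d1 (hpow j)) as m4.
  intros P xi hmesh htag.
  set (corner := fun (q : Fin.t N -> nat) => (fun i => part_pt (P i) (q i)) : point R N).
  set (Si := fun i => CRsum (fun j => trap1 k (part_pt (P i) j) * (part_pt (P i) (S j) - part_pt (P i) j)) (part_last (P i))).
  assert (hSi : forall i, CRabs R (Si i - (CR_of_Q R 2 * r + hpow k)) <= hpow j * (tpow k * (CR_of_Q R 2 * M))).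
  { intros i. apply trap1_sum_close. intros j' hj'. specialize (hmesh i j' hj'). lin (hmesh, m4). }
  assert (hcorner : riemann_sum P corner (trap_prod k) == fin_prod Si).
  { unfold riemann_sum, Si. rewrite <- (grid_sum_prod (fun i => part_last (P i))
      (fun i j => trap1 k (part_pt (P i) j) * (part_pt (P i) (S j) - part_pt (P i) j))).
    apply grid_sum_eq. intros q _. rewrite fin_prod_mult. reflexivity. }
  assert (hvol : forall q, grid_index P q -> 0 <= cell_volume P q).
  { intros q hq. unfold cell_volume. refine (proj1 (@fin_prod_bounds N _ (fun i => part_pt (P i) (S (q i)) - part_pt (P i) (q i)) _)).
    intros i. pose proof (part_mono (hq i)) as h. split; [lin h|apply CRle_refl]. }
  assert (htot : grid_sum (fun i => part_last (P i)) (fun q => cell_volume P q) == V).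
  { unfold cell_volume, V. rewrite (grid_sum_prod (fun i => part_last (P i)) (fun i j => part_pt (P i) (S j) - part_pt (P i) j)).
    rewrite <- fin_prod_const. apply fin_prod_eq. intros i. apply part_total. }
  assert (hterm : forall q, grid_index P q -> CRabs R (trap_prod k (xi q) - trap_prod k (corner q)) <= hpow k1).
  { intros q hq.
    assert (hc : forall i, - M <= part_pt (P i) (q i) /\ part_pt (P i) (q i) <= M /\ - M <= part_pt (P i) (S (q i)) /\ part_pt (P i) (S (q i)) <= M).
    { intros i. specialize (hq i). pose proof (@part_range (P i) (q i) ltac:(lia)). pose proof (@part_range (P i) (S (q i)) ltac:(lia)). tauto. }
    apply H1; intros i; specialize (hc i); pose proof (htag q hq i) as ht; apply CRabs_le_iff.
    - split; lin (hc, ht).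
    - unfold corner. split; lin hc.
    - specialize (hmesh i (q i) (hq i)). unfold corner. split; lin (hc, ht, hmesh, m3, hd1). }
  assert (hRS : CRabs R (riemann_sum P xi (trap_prod k) - riemann_sum P corner (trap_prod k)) <= hpow k1 * V).
  { rewrite <- htot, <- grid_sum_scale. unfold riemann_sum. apply CRabs_le_iff.
    assert (hu : grid_sum (fun i => part_last (P i)) (fun q => trap_prod k (xi q) * cell_volume P q) <=
      grid_sum (fun i => part_last (P i)) (fun q => trap_prod k (corner q) * cell_volume P q + hpow k1 * cell_volume P q)).
    { apply grid_sum_le. intros q hq. specialize (hterm q hq). specialize (hvol q hq). apply CRabs_le_iff in hterm.
      assert (h : 0 <= (trap_prod k (corner q) + hpow k1 - trap_prod k (xi q)) * cell_volume P q) by (apply CRmult_le0; [lin hterm|exact hvol]). lin h. }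
    assert (hl : grid_sum (fun i => part_last (P i)) (fun q => trap_prod k (corner q) * cell_volume P q) <=
      grid_sum (fun i => part_last (P i)) (fun q => trap_prod k (xi q) * cell_volume P q + hpow k1 * cell_volume P q)).
    { apply grid_sum_le. intros q hq. specialize (hterm q hq). specialize (hvol q hq). apply CRabs_le_iff in hterm.
      assert (h : 0 <= (trap_prod k (xi q) + hpow k1 - trap_prod k (corner q)) * cell_volume P q) by (apply CRmult_le0; [lin hterm|exact hvol]). lin h. }
    rewrite grid_sum_plus in hu, hl. split; lin (hu, hl). }
  assert (hprod : CRabs R (fin_prod Si - CRpow (CR_of_Q R 2 * r + hpow k) N) <= half * eps).
  { rewrite <- fin_prod_const. pose proof (@hpow_le1 k) as hk. pose proof (@hpow_pos k) as hkp. apply H2.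
    - intros i. specialize (hSi i). apply CRabs_le_iff in hSi. apply CRabs_le_iff. split; lin (hSi, hj, m2, hk, hkp, hr).
    - intros i. apply CRabs_le_iff. split; lin (hk, hkp, hr).
    - intros i. specialize (hSi i). lin (hSi, hj, m1). }
  rewrite hcorner in hRS. apply CRabs_le_iff in hRS. apply CRabs_le_iff in hprod. apply CRabs_le_iff.
  split; lin (hRS, hprod, hk1).
Qed.

Lemma rint_sub f g v w : rint f v -> rint g w -> rint (fun x => f x - g x) (v - w).
Proof.
  intros hf hg eps he. destruct (hf (half * eps)) as [d1 [hd1 H1]]; [lin he|].
  destruct (hg (half * eps)) as [d2 [hd2 H2]]; [lin he|].
  exists (CRmin d1 d2). split; [apply CRmin_pos; assumption|]. intros P xi hmesh htag.
  pose proof (CRmin_l d1 d2) as m1. pose proof (CRmin_r d1 d2) as m2.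
  assert (h1 := H1 P xi (fun i j h => CRle_trans _ _ _ (hmesh i j h) m1) htag).
  assert (h3 := H2 P xi (fun i j h => CRle_trans _ _ _ (hmesh i j h) m2) htag).
  assert (e : riemann_sum P xi (fun x => f x - g x) == riemann_sum P xi f - riemann_sum P xi g).
  { unfold riemann_sum.
    rewrite (grid_sum_eq (G := fun q => f (xi q) * cell_volume P q + -(1) * (g (xi q) * cell_volume P q))) by (intros; ring).
    rewrite grid_sum_plus, grid_sum_scale. ring. }
  rewrite e. apply CRabs_le_iff in h1. apply CRabs_le_iff in h3. apply CRabs_le_iff. split; lin (h1, h3).
Qed.

Lemma rint_ext f g v : (forall x, f x == g x) -> rint f v -> rint g v.
Proof.
  intros h hf eps he. destruct (hf eps he) as [d [hd H]]. exists d. split; [exact hd|].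
  intros P xi hm ht. assert (e : riemann_sum P xi g == riemann_sum P xi f).
  { apply grid_sum_eq. intros q _. rewrite (h (xi q)). reflexivity. }
  rewrite e. apply (H P xi hm ht).
Qed.

Lemma rint_riemann f v : (forall x i, M < CRabs R (x i) -> f x == 0) -> rint f v -> riemann_integral f v.
Proof. intros h0 h. exists M. split; [split; [exact hM|exact h0]|exact h]. Qed.

(** A telescoping series whose terms after the first are all <= 0, so that the integrals of the
    absolute values telescope as well. *)
Definition box_term (n : nat) x : CR :=
  match n with O => trap_prod 0 x | S m => trap_prod (S m) x - trap_prod m x end.

Lemma box_term_sum n x : CRsum (fun k => box_term k x) n == trap_prod n x.
Proof. induction n as [|n IH]; simpl; [reflexivity|]. rewrite IH. ring. Qed.

Lemma box_term_out n x i : M < CRabs R (x i) -> box_term n x == 0.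
Proof.
  intros h. destruct n as [|n]; unfold box_term; [exact (@trap_prod_out O x i h)|].
  rewrite (@trap_prod_out (S n) x i h), (@trap_prod_out n x i h). ring.
Qed.

Lemma box_term_ucont n : ucont (box_term n).
Proof.
  destruct n as [|n]; [apply trap_prod_ucont|].
  apply (ucont_combine (trap_prod_ucont (S n)) (trap_prod_ucont n)). intros x y. unfold box_term.
  setoid_replace (trap_prod (S n) x - trap_prod n x - (trap_prod (S n) y - trap_prod n y)) with
    ((trap_prod (S n) x - trap_prod (S n) y) + - (trap_prod n x - trap_prod n y)) by ring.
  apply CRle_trans with (1 := CRabs_triang _ _). rewrite CRabs_opp. apply CRle_refl.
Qed.

Let A n : CR := CRpow (CR_of_Q R 2 * r + hpow n) N.
Let term_int n : CR := match n with O => A 0 | S m => A (S m) - A m end.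
Let term_abs_int n : CR := match n with O => A 0 | S m => A m - A (S m) end.

Lemma box_term_rint n : rint (box_term n) (term_int n).
Proof.
  destruct n as [|n]; [apply trap_prod_rint|].
  apply rint_sub; apply trap_prod_rint.
Qed.

Lemma box_term_abs_rint n : rint (fun x => CRabs R (box_term n x)) (term_abs_int n).
Proof.
  destruct n as [|n].
  - apply rint_ext with (2 := trap_prod_rint 0). intros x. symmetry. apply CRabs_right. apply trap_prod_range.
  - apply rint_ext with (2 := rint_sub (trap_prod_rint n) (trap_prod_rint (S n))). intros x. unfold box_term.
    pose proof (@trap_prod_S n x) as h. rewrite CRabs_left; [ring|lin h].
Qed.

Lemma box_volume_cv : CR_cv R A (CRpow (CR_of_Q R 2 * r) N).
Proof.
  apply Un_cv_real_nat. intros eps he.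
  destruct (@fin_prod_close N (CR_of_Q R 2 * r + 1) (half * eps)) as [d [hd H]]; [lin hr|lin he|].
  destruct (hpow_small hd) as [k hk]. exists k. intros i hi.
  apply CRle_lt_trans with (half * eps); [|lin he].
  unfold A. rewrite <- !fin_prod_const. pose proof (@hpow_le1 i) as h1. pose proof (@hpow_pos i) as h0.
  pose proof (@hpow_le k i hi) as h3.
  apply H; intros _; apply CRabs_le_iff; split; lin (h1, h0, h3, hk, hr).
Qed.

Lemma outside_ext : forall x y, point_eq x y -> {i : Fin.t N & r < CRabs R (x i)} -> {i : Fin.t N & r < CRabs R (y i)}.
Proof. intros x y e [i h]. exists i. rewrite <- (e i). exact h. Qed.

Lemma box_apart x y : sup_ball r x -> {i : Fin.t N & r < CRabs R (y i)} -> 0 < dist x y.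
Proof.
  intros hx [i hi]. specialize (hx i). apply CRlt_le_trans with (CRabs R (x i - y i)).
  - rewrite CRabs_minus_sym. pose proof (CRabs_triang (y i - x i) (x i)) as h.
    setoid_replace (y i - x i + x i) with (y i) in h by ring. lin (hx, hi, h).
  - apply dist_coord.
Qed.

Definition box : complemented_set R N :=
  @ComplementedSet R N (sup_ball r) (Subset outside_ext) box_apart.

(** Convergence alone must tell on which side [x] lies. The limit L satisfies 0 < L or L < 1: the
    former puts every |x i| below r + 2^-k for all k, the latter exhibits a coordinate beyond r. *)
Lemma box_pointwise x : series_converges (fun n => CRabs R (box_term n x)) ->
  {hx : dom (chi box) x & series_cv (fun n => box_term n x) (val hx)}.
Proof.
  intros [s hs].
  destruct (@series_cv_maj R (fun n => box_term n x) _ s (fun n => CRle_refl _) hs) as [L [hL _]].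
  assert (hcv : CR_cv R (fun n => trap_prod n x) L) by (apply CR_cv_eq with (2 := hL); intros n; apply box_term_sum).
  destruct (@CRlt_or 0 1 L ltac:(lin)) as [hl|hl].
  - assert (hin : sup_ball r x).
    { intros i. apply CRle_eps. intros e he. destruct (hpow_small he) as [k hk].
      assert (h : 0 < trap1 k (x i)).
      { apply CRlt_le_trans with (1 := hl). apply CRle_trans with (trap_prod k x).
        - apply (CR_cv_bound_up _ _ _ k) with (2 := hcv). intros n hn.
          induction hn as [|n hn IH]; [apply CRle_refl|]. apply CRle_trans with (2 := IH). apply trap_prod_S.
        - apply (fin_prod_le_factor (u := fun i => trap1 k (x i))). intros i'. apply trap1_range. }
      apply trap1_pos in h. lin (h, hk). }
    exists (inl hin). cbn [val chi chi_val].
    apply CR_cv_eq with (fun _ => 1); [|apply CR_cv_const].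
    intros n. rewrite box_term_sum. unfold trap_prod. rewrite <- (CRpow_one N), <- fin_prod_const.
    apply fin_prod_eq. intros i. symmetry. apply trap1_mid. apply hin.
  - destruct (CR_cv_open_above _ _ _ hcv hl) as [n hn]. specialize (hn n (le_n _)).
    destruct (@fin_prod_lt1 N (fun i => trap1 n (x i)) (fun i => trap1_range n (x i)) hn) as [i hi].
    apply trap1_lt in hi. exists (inr (existT _ i hi)). cbn [val chi chi_val].
    destruct (@hpow_small (CRabs R (x i) - r)) as [k hk]; [lin hi|].
    apply (CR_cv_shift (CRsum (fun n => box_term n x)) k).
    apply CR_cv_eq with (fun _ => 0); [|apply CR_cv_const].
    intros m. rewrite box_term_sum. symmetry. apply (fin_prod_zero (i := i)). apply trap1_out.
    pose proof (@hpow_le k (m + k) ltac:(lia)) as h. lin (h, hk).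
Qed.

Lemma box_integrable : integrable_set box.
Proof.
  exists (CRpow (CR_of_Q R 2 * r) N). exists box_term, term_abs_int, term_int.
  assert (hM0 : 0 <= M) by (apply CRlt_asym, hM).
  split; [split; [split; [split; [split|]|]|]|].
  - intros n. apply (ucont_test hM0); [apply box_term_ucont|]. intros x i. apply box_term_out.
  - intros n. apply rint_riemann; [|apply box_term_abs_rint].
    intros x i h. rewrite (@box_term_out n x i h). apply CRabs_right. apply CRle_refl.
  - intros n. apply rint_riemann; [|apply box_term_rint]. intros x i. apply box_term_out.
  - exists (CR_of_Q R 2 * A 0 - CRpow (CR_of_Q R 2 * r) N).
    apply CR_cv_eq with (fun n => CR_of_Q R 2 * A 0 - A n).
    + induction n as [|n IH]; cbn [CRsum term_abs_int]; [ring|]. rewrite <- IH. ring.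
    + apply CR_cv_minus; [apply CR_cv_const|apply box_volume_cv].
  - exact box_pointwise.
  - apply CR_cv_eq with A; [|apply box_volume_cv].
    induction n as [|n IH]; cbn [CRsum term_int]; [ring|]. rewrite <- IH. ring.
Qed.

End Box.

(** * Located convex sets *)

Arguments r_abs {N f v} r n c J q.
Arguments r_val {N f v} r n.
Arguments r_Icv {N f v} r.
Arguments r_Jcv {N f v} r.

(** * Tails of representing series *)

Section Tails.

Context {N : nat}.
Implicit Types (x y z c : point R N) (f : partial_function R N).

(** With [w] the volume of the cube, this is the positivity principle for integrals in place of
    means. *)
Lemma convergence_point_scaled (w : CR) (F : cfun (N := N)) (h : nat -> cfun) c l (u : nat -> CR) U :
  0 < w -> 0 <= l -> (forall n x, in_cube c l x -> 0 <= h n x) ->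
  (forall n, w * avg (h n) c l <= u n) -> series_cv u U -> U < w * avg F c l ->
  {x : point R N & in_cube c l x * {s : CR & series_cv (fun n => h n x) s * (s < F x)}}%type.
Proof.
  intros hw hl hh hu hU hlt.
  assert (hne : CRapart R w 0) by (right; exact hw).
  pose proof (CRinv_l R _ hne) as hi. pose proof (CRinv_0_lt_compat R _ hne hw) as hip.
  set (v := CRinv R w hne) in *.
  assert (e : forall t, v * (w * t) == t) by (intros t; rewrite <- CRmult_assoc, hi; ring).
  apply (convergence_point (F := F) (f := h) (c := c) (l := l) (u := fun n => u n * v) (U := U * v)); [exact hl|exact hh| | |].
  - intros n. specialize (hu n). apply (CRmult_le_compat_l v) in hu; [|exact (CRlt_asym _ _ hip)].
    pose proof (e (avg (h n) c l)) as en. rewrite en in hu. lin hu.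
  - apply series_cv_scale. exact hU.
  - apply (CRmult_lt_compat_l v) in hlt; [|exact hip]. pose proof (e (avg F c l)) as en. rewrite en in hlt. lin hlt.
Qed.

Lemma series_cv_split (a b : nat -> CR) s : (forall n, 0 <= a n) -> (forall n, 0 <= b n) ->
  series_cv (fun n => a n + b n) s ->
  {sa : CR & {sb : CR & series_cv a sa * series_cv b sb * (sa + sb == s)%ConstructiveReals * (0 <= sa) * (0 <= sb)}}%type.
Proof.
  intros ha hb hs.
  destruct (@series_cv_maj R a (fun n => a n + b n) s) with (2 := hs) as [sa [hsa _]].
  { intros n. rewrite (CRabs_right (a n)) by apply ha. specialize (hb n). lin hb. }
  destruct (@series_cv_maj R b (fun n => a n + b n) s) with (2 := hs) as [sb [hsb _]].
  { intros n. rewrite (CRabs_right (b n)) by apply hb. specialize (ha n). lin ha. }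
  exists sa, sb. repeat split; try assumption.
  - apply (series_cv_unique _ _ _ (series_cv_plus _ _ _ _ hsa hsb) hs).
  - apply (series_cv_unique _ _ _ (series_cv_plus _ _ _ _ hsa hsb) hs).
  - exact (series_cv_nonneg _ _ ha hsa).
  - exact (series_cv_nonneg _ _ hb hsb).
Qed.

Lemma series_tail (u : nat -> CR) U e : series_cv u U -> 0 < e ->
  {m : nat & forall m', (m <= m')%nat ->
    (CRabs R (CRsum u m' - U) <= e) * {T : CR & series_cv (fun n => u (S m' + n)%nat) T * (T <= e)}}%type.
Proof.
  intros hU he. destruct (Un_cv_nat_real _ _ hU e he) as [m hm]. exists m. intros m' hm'.
  specialize (hm m' hm'). pose proof (proj1 (CRabs_le_iff _ _) (CRlt_asym _ _ hm)) as hb.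
  split; [apply CRlt_asym; exact hm|]. exists (U - CRsum u m'). split; [|lin hb].
  apply series_cv_eq with (2 := series_cv_shift' u U (S m') hU). intros n. rewrite Nat.add_comm. reflexivity.
Qed.

Variables (f : partial_function R N) (v : CR) (rp : rep f v).

Lemma r_abs0 n J : cube_vol (N := N) J * avg (cabs (rf rp n)) (origin_cube J) (tpow (S J)) <= rI rp n.
Proof.
  apply CRle_trans with (2 := r_abs rp n (origin_cube J) J O).
  assert (e : hpow 0 * tpow (S J) == tpow (S J)) by (rewrite hpow_0; ring).
  rewrite (avg_point_eq (cabs (rf rp n)) (fun i => CReq_refl (origin_cube J i)) e).
  unfold cube_vol. rewrite (CRpow_proper _ _ N e). apply CRle_refl.
Qed.

Definition tail m n : cfun (N := N) := cabs (rf rp (S m + n)).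

Lemma tail_nonneg m n x : 0 <= tail m n x.
Proof. apply CRabs_pos. Qed.

(** Convergence of a tail of absolute values gives absolute convergence of the whole series, hence a
    point of the domain, and the tail bounds the remainder. *)
Lemma tail_point m x s : series_cv (fun n => tail m n x) s ->
  {hx : dom f x & CRabs R (csum (rf rp) m x - val hx) <= s}.
Proof.
  intros hs.
  assert (ha : series_cv (fun n => CRabs R (rf rp n x)) (s + CRsum (fun n => CRabs R (rf rp n x)) m)).
  { apply (series_cv_shift (fun n => CRabs R (rf rp n x)) m s). exact hs. }
  destruct (r_pt (r := rp) (x := x) (existT _ _ ha)) as [hx hv]. exists hx.
  rewrite csum_val. pose proof (series_cv_abs_remainder _ _ _ m hv ha) as h. cbv beta in h. lin h.
Qed.

Lemma csum_int m : {J0 : nat & forall J, (J0 <= J)%nat ->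
  cube_vol (N := N) J * avg (csum (rf rp) m) (origin_cube J) (tpow (S J)) == CRsum (rJ rp) m}.
Proof.
  induction m as [|m [J1 IH]].
  - exact (r_val rp 0).
  - destruct (r_val rp (S m)) as [J2 hJ2]. exists (J1 + J2)%nat. intros J hJ. cbn [csum CRsum].
    rewrite avg_plus, <- (IH J), <- (hJ2 J) by lia. ring.
Qed.

End Tails.

Arguments tail_nonneg {N f v} rp m n x.
Arguments r_abs0 {N f v} rp n J.
Arguments csum_int {N f v} rp m.
Arguments tail {N f v} rp m n.

(** * Deciding how near the set comes to a point *)

Section Decision.

Context {N : nat}.
Implicit Types (x y z c : point R N) (A B C : complemented_set R N).

(* Otherwise [convergence_point] would give a point where chi_C > chi_B. *)
Lemma neg_part_int B C vb vc (rb : rep (chi B) vb) (rc : rep (chi C) vc) m L Tb Tc : cs_lt C B ->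
  series_cv (fun n => rI rb (S m + n)%nat) Tb -> series_cv (fun n => rI rc (S m + n)%nat) Tc ->
  cube_vol (N := N) L * avg (cmax (csub (csum (rf rc) m) (csum (rf rb) m)) (cconst 0)) (origin_cube L) (tpow (S L)) <= Tb + Tc.
Proof.
  intros hCB hTb hTc hlt.
  destruct (@convergence_point_scaled N (cube_vol (N := N) L) (cmax (csub (csum (rf rc) m) (csum (rf rb) m)) (cconst 0))
    (fun n => cadd (tail rb m n) (tail rc m n)) (origin_cube L) (tpow (S L))
    (fun n => rI rb (S m + n)%nat + rI rc (S m + n)%nat) (Tb + Tc)) as [y [_ [s [hs hF]]]].
  - apply cube_vol_pos.
  - apply CRlt_asym, tpow_pos.
  - intros n y _. cbn [cadd cf]. pose proof (tail_nonneg rb m n y) as h1. pose proof (tail_nonneg rc m n y) as h3. lin (h1, h3).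
  - intros n. rewrite avg_plus. pose proof (r_abs0 rb (S m + n) L) as h1. pose proof (r_abs0 rc (S m + n) L) as h3.
    unfold tail. lin (h1, h3).
  - apply series_cv_plus; assumption.
  - exact hlt.
  - destruct (@series_cv_split (fun n => tail rb m n y) (fun n => tail rc m n y) s (fun n => tail_nonneg rb m n y) (fun n => tail_nonneg rc m n y) hs)
      as [sb [sc [[[[hb hc] hsum] hb0] hc0]]].
    destruct (tail_point hb) as [yB eB]. destruct (tail_point hc) as [yC eC].
    specialize (hCB y yC yB). apply CRabs_le_iff in eB. apply CRabs_le_iff in eC.
    cbn [cmax csub cadd cscale cconst cf] in hF.
    assert (hmax : CRmax (csum (rf rc) m y + -(1) * csum (rf rb) m y) 0 <= s).
    { apply CRmax_lub; [lin (hCB, eB, eC, hsum)|lin (hb0, hc0, hsum)]. }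
    lin (hmax, hF).
Qed.

Lemma lt_max_pos (s X : CR) : 0 <= s -> s < CRmax 0 X -> s < X.
Proof.
  intros h0 h. destruct (@CRlt_or s _ X h) as [h1|h1]; [exact h1|]. exfalso.
  assert (h3 : CRmax 0 X <= 0).
  { apply (CRle_by_cases (x := 0) (y := X)); intros hX.
    - rewrite CRmax_right in h1 by (apply CRlt_asym; exact hX). destruct (CRle_refl _ h1).
    - apply CRmax_lub; [apply CRle_refl|exact hX]. }
  lin (h0, h, h3).
Qed.

Lemma norm_scale (a : CR) (u : point R N) : 0 <= a -> norm (fun i => a * u i) == a * norm u.
Proof.
  intros ha. assert (e : fin_sum (fun i => a * u i * (a * u i)) == (a * norm u) * (a * norm u)).
  { rewrite (fin_sum_eq (v := fun i => (a * a) * (u i * u i))) by (intros; ring).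
    rewrite fin_sum_scale, <- norm_square. ring. }
  assert (hn : 0 <= a * norm u) by (apply CRmult_le0; [exact ha|apply norm_nonneg]).
  split; apply CRsquare_le_inv; try exact hn; try apply norm_nonneg; rewrite norm_square; apply e.
Qed.

(** Change of variables under the homothety, after which the image cube is enlarged to the cube of
    index L by positivity. *)
Lemma shrink_int (K : cfun (N := N)) q (s : point R N) J L : (forall x, 0 <= K x) -> (J <= L)%nat ->
  (forall i, origin_cube L i <= shrink q s (origin_cube J) i /\
     shrink q s (origin_cube J) i + hpow q * tpow (S J) <= origin_cube L i + tpow (S L)) ->
  CRpow (hpow q) N * (cube_vol (N := N) J * avg (cshrink q s K) (origin_cube J) (tpow (S J))) <=
  cube_vol (N := N) L * avg K (origin_cube L) (tpow (S L)).
Proof.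
  intros hK hJL hin. rewrite avg_shrink.
  assert (el : hpow (q + (L - J)) * tpow (S L) == hpow q * tpow (S J)).
  { rewrite hpow_plus. replace (S L) with ((L - J) + S J)%nat by lia. rewrite (@tpow_plus).
    replace (L - J + S J - S J)%nat with (L - J)%nat by lia.
    setoid_replace (hpow q * hpow (L - J) * (tpow (L - J) * tpow (S J))) with
      (hpow q * tpow (S J) * (hpow (L - J) * tpow (L - J))) by ring.
    rewrite hpow_tpow. ring. }
  assert (h := @avg_subcube N K (origin_cube L) (tpow (S L)) (q + (L - J)) (shrink q s (origin_cube J)) (tpow_pos _) (fun x _ => hK x)).
  assert (hin' : forall i, origin_cube L i <= shrink q s (origin_cube J) i /\
     shrink q s (origin_cube J) i + hpow (q + (L - J)) * tpow (S L) <= origin_cube L i + tpow (S L)).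
  { intros i. specialize (hin i). split; lin (hin, el). }
  specialize (h hin'). rewrite (avg_point_eq K (fun i => CReq_refl (shrink q s (origin_cube J) i)) el) in h.
  apply (CRmult_le_compat_l (cube_vol (N := N) L)) in h; [|apply CRlt_asym, cube_vol_pos].
  apply CRle_trans with (2 := h). unfold cube_vol.
  rewrite <- !CRmult_assoc, !CRpow_mult. apply CRmult_le_compat_r.
  - apply avg_nonneg; [|intros; apply hK]. apply CRmult_le0; apply CRlt_asym; [apply hpow_pos|apply tpow_pos].
  - rewrite (CRpow_proper (tpow (S L) * hpow (q + (L - J))) (hpow q * tpow (S J))); [apply CRle_refl|]. rewrite <- el. ring.
Qed.

(** With tau = v/2: the tail takes at most v/4, and the integral of the partial sum is within v/4 of
    v. The margin [tau] is what later estimates may spend. *)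
Lemma positive_core A v (rp : rep (chi A) v) : 0 < v ->
  {tau : CR & (0 < tau) * {m : nat & {J : nat & {Tt : CR & series_cv (fun n => rI rp (S m + n)%nat) Tt *
    (Tt + tau <= cube_vol (N := N) J * avg (csum (rf rp) m) (origin_cube J) (tpow (S J)))%ConstructiveReals}}}}%type.
Proof.
  intros hv. exists (half * v). split; [lin hv|].
  destruct (@series_tail _ _ (CR_of_Q R (1#4) * v) (r_Icv rp)) as [m1 hm1]; [lin hv|].
  destruct (@series_tail _ _ (CR_of_Q R (1#4) * v) (r_Jcv rp)) as [m2 hm2]; [lin hv|].
  set (m := (m1 + m2)%nat). exists m.
  destruct (hm1 m ltac:(unfold m; lia)) as [_ [Tt [hTt hle]]].
  destruct (hm2 m ltac:(unfold m; lia)) as [hcl _]. apply CRabs_le_iff in hcl.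
  destruct (csum_int rp m) as [J hJ]. exists J, Tt. split; [exact hTt|].
  rewrite (hJ J (le_n _)). lin (hle, hcl).
Qed.

Variables (A T : complemented_set R N) (vt : CR) (rt : rep (chi T) vt).
Hypothesis hTA : cs_lt T A.
Variables (gd : partial_function R N) (vd : CR) (rd : rep gd vd).
Hypothesis hgd : forall x, dom gd x -> chi_dom A x.

(** [cs_lt] compares values only where both characteristic functions are defined; [gd], from the
    fullness of the domain of chi_A, provides such points. *)
Lemma in_of_sub z (hz : cs1 T z) : dom gd z -> cs1 A z.
Proof.
  intros hd. destruct (hgd hd) as [h|h]; [exact h|]. exfalso.
  pose proof (@hTA z (inl hz) (inr h)) as hh. simpl in hh. lin hh.
Qed.

Variables (tau : CR) (mT J : nat) (Tt : CR).
Hypothesis htau : 0 < tau.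
Hypothesis hTt : series_cv (fun n => rI rt (S mT + n)%nat) Tt.
Hypothesis hcore : Tt + tau <= cube_vol (N := N) J * avg (csum (rf rt) mT) (origin_cube J) (tpow (S J)).

(** At the point found, the partial sum for T exceeds its tail, so chi_T is not 0 there. This gives
    inhabitedness. *)
Lemma core_point : {z : point R N & cs1 A z}.
Proof.
  destruct (@series_tail _ _ (half * tau) (r_Icv rd)) as [m hm]; [lin htau|].
  destruct (hm m (le_n _)) as [_ [Td [hTd hd]]].
  destruct (@convergence_point_scaled N (cube_vol (N := N) J) (csum (rf rt) mT)
    (fun n => cadd (tail rt mT n) (tail rd m n)) (origin_cube J) (tpow (S J))
    (fun n => rI rt (S mT + n)%nat + rI rd (S m + n)%nat) (Tt + Td)) as [z [_ [s [hs hF]]]].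
  - apply cube_vol_pos.
  - apply CRlt_asym, tpow_pos.
  - intros n y _. cbn [cadd cf]. pose proof (tail_nonneg rt mT n y) as h1. pose proof (tail_nonneg rd m n y) as h3. lin (h1, h3).
  - intros n. rewrite avg_plus. pose proof (r_abs0 rt (S mT + n) J) as h1. pose proof (r_abs0 rd (S m + n) J) as h3.
    unfold tail. lin (h1, h3).
  - apply series_cv_plus; assumption.
  - lin (hcore, hd, htau).
  - destruct (@series_cv_split (fun n => tail rt mT n z) (fun n => tail rd m n z) s (fun n => tail_nonneg rt mT n z) (fun n => tail_nonneg rd m n z) hs)
      as [st [sd [[[[ht hd'] hsum] ht0] hd0]]].
    destruct (tail_point ht) as [zT eT]. destruct (tail_point hd') as [zD _]. apply CRabs_le_iff in eT.
    exists z. destruct zT as [zT|zT].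
    + exact (in_of_sub zT zD).
    + exfalso. cbn [val chi chi_val] in eT. lin (eT, hsum, hd0, hF).
Qed.

Hypothesis hA : measurable A.
Hypothesis hconv : convex (cs1 A).

Lemma box_of_abs (r : CR) x (h : dom (chi (box r)) x) :
  (forall i, CRabs R (x i) <= r) -> val h == 1.
Proof.
  intros hx. destruct h as [h|[i hi]]; [reflexivity|]. exfalso. specialize (hx i). lin (hx, hi).
Qed.

(** All the data are chosen before any s is considered. The first alternative is a family of
    negations, so it is enough to refute each s with dist x s < a. *)
Lemma decide_near x (a b : CR) : a < b ->
  (forall s, cs1 A s -> a <= dist x s) + {s : point R N & cs1 A s * (dist x s < b)}%type.
Proof.
  intros hab.
  assert (hba : 0 < b - a) by lin hab.
  assert (hne : CRapart R (b - a) 0) by (right; exact hba).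
  pose proof (CRinv_l R _ hne) as hi. pose proof (CRinv_0_lt_compat R _ hne hba) as hip.
  set (iv := CRinv R (b - a) hne) in *.
  destruct (fin_bound (fun i => CRabs R (x i))) as [X [hX0 hX]].
  (* Bounds the distance to the points of the cube carrying T from any s closer to x than a; with
     this q the homothety moves s by at most (b - a)/2. *)
  set (D := a + INR N * (X + tpow J)).
  destruct (@hpow_below D (half * (b - a))) as [q hq]; [lin hba|].
  set (w := CRpow (hpow q) N). set (iw := CRpow (tpow q) N).
  assert (hw : 0 < w) by apply CRpow_gt_zero, hpow_pos.
  assert (hiw : 0 < iw) by apply CRpow_gt_zero, tpow_pos.
  assert (hwiw : iw * w == 1).
  { unfold w, iw. rewrite CRpow_mult, (CRpow_proper (tpow q * hpow q) 1); [apply CRpow_one|].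
    rewrite CRmult_comm. apply hpow_tpow. }
  assert (hw1 : w <= 1) by (apply CRpow_le1; [apply CRlt_asym, hpow_pos|apply hpow_le1]).
  (* Makes the box contain all points at distance at most b from x, hence all the homothetic
     images. *)
  set (r := X + CRabs R b + 1).
  assert (hr : 0 < r) by (pose proof (CRabs_pos b) as h; unfold r; lin (h, hX0)).
  (* The budget of the second case, in units of tau/64 after division by w: 8 for twice K, 20 for W
     (16 from [eps], 4 from [e1]), 1 for the tail of [gd], and 9 for three times the three tails at
     the image. The total 38 is less than 64. *)
  set (e1 := CR_of_Q R (1#64) * (w * tau)).
  assert (hwt : 0 < w * tau) by (apply CRmult_lt_0_compat; assumption).
  assert (he1 : 0 < e1) by (unfold e1; lin hwt).
  (* The definition of measurability uses one number twice: 1/4 is wanted for the values of g, and w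
     tau / 4 for the measure lost in passing from the box to C. *)
  set (eps := CRmin (CR_of_Q R (1#4)) (CR_of_Q R (1#4) * (w * tau))).
  assert (heps : 0 < eps) by (apply CRmin_pos; [lin|lin hwt]).
  assert (heps1 : eps <= CR_of_Q R (1#4)) by apply CRmin_l.
  assert (heps2 : eps <= CR_of_Q R (1#4) * (w * tau)) by apply CRmin_r.
  destruct hA as [_ hmeas].
  destruct (hmeas (box r) (box_integrable hr) eps heps) as [C [hC [g [[[hCB hmu] hg] hclose]]]].
  destruct (box_integrable (N := N) hr) as [vb hb]. destruct hC as [vc hc]. destruct hg as [vg hg].
  unfold mu, integral in hmu. cbn [projT1] in hmu.
  pose proof (has_integral_rep hb) as rb. pose proof (has_integral_rep hc) as rc. pose proof (has_integral_rep hg) as rg.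
  destruct (series_tail (r_Icv rb) he1) as [m1 hm1]. destruct (series_tail (r_Icv rc) he1) as [m2 hm2].
  destruct (series_tail (r_Icv rg) he1) as [m3 hm3]. destruct (series_tail (r_Icv rd) he1) as [m4 hm4].
  destruct (series_tail (r_Jcv rb) he1) as [m5 hm5]. destruct (series_tail (r_Jcv rc) he1) as [m6 hm6].
  set (m := (m1 + m2 + m3 + m4 + m5 + m6)%nat).
  destruct (hm1 m ltac:(unfold m; lia)) as [_ [Tb [hTb hTb1]]].
  destruct (hm2 m ltac:(unfold m; lia)) as [_ [Tc [hTc hTc1]]].
  destruct (hm3 m ltac:(unfold m; lia)) as [_ [Tg [hTg hTg1]]].
  destruct (hm4 m ltac:(unfold m; lia)) as [_ [Td [hTd hTd1]]].
  destruct (hm5 m ltac:(unfold m; lia)) as [hJb _]. destruct (hm6 m ltac:(unfold m; lia)) as [hJc _].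
  apply CRabs_le_iff in hJb. apply CRabs_le_iff in hJc.
  clear hm1 hm2 hm3 hm4 hm5 hm6.
  destruct (csum_int rb m) as [L1 hL1]. destruct (csum_int rc m) as [L2 hL2]. destruct (tpow_above r) as [L3 hL3].
  set (L := (L1 + L2 + L3 + J)%nat).
  assert (hrL : r <= tpow L) by (pose proof (@tpow_le L3 L ltac:(unfold L; lia)) as h; lin (h, hL3)).
  specialize (hL1 L ltac:(unfold L; lia)). specialize (hL2 L ltac:(unfold L; lia)).
  set (Bm := csum (rf rb) m) in *. set (Cm := csum (rf rc) m) in *. set (Gm := csum (rf rg) m) in *.
  (* psi >= 1 on the ball of radius (a + b) / 2 about x and psi < 0 outside the ball of radius b;
     K approximates the positive part of min(chi_C, g, psi) - 1/4 *)
  set (psi := cscale (CR_of_Q R 2 * iv) (csub (cconst b) (cdist x))).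
  assert (hpsi : forall y, psi y == CR_of_Q R 2 * iv * (b - dist x y)).
  { intros y. unfold psi. cbn [cscale csub cadd cconst cdist cf]. ring. }
  set (X0 := csub (cmin (cmin Cm Gm) psi) (cconst (CR_of_Q R (1#4)))).
  assert (hX0v : forall y, X0 y == CRmin (CRmin (Cm y) (Gm y)) (psi y) - CR_of_Q R (1#4)).
  { intros y. unfold X0. cbn [csub cadd cscale cmin cconst cf]. ring. }
  set (K := cmax (cconst 0) X0).
  assert (hKv : forall y, K y = CRmax 0 (X0 y)) by reflexivity.
  (* The lower threshold pays for the three tails of the first case; the upper one enters the budget
     of the second. *)
  destruct (@CRlt_or (CR_of_Q R 3 * e1) (CR_of_Q R 4 * e1) (cube_vol (N := N) L * avg K (origin_cube L) (tpow (S L)))) as [hbig|hsmall].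
  { lin he1. }
  - right.
    destruct (@convergence_point_scaled N (cube_vol (N := N) L) K
      (fun n => cadd (tail rc m n) (cadd (tail rg m n) (tail rd m n))) (origin_cube L) (tpow (S L))
      (fun n => rI rc (S m + n)%nat + (rI rg (S m + n)%nat + rI rd (S m + n)%nat)) (Tc + (Tg + Td))) as [y [_ [s [hs hF]]]].
    + apply cube_vol_pos.
    + apply CRlt_asym, tpow_pos.
    + intros n y _. cbn [cadd cf]. pose proof (tail_nonneg rc m n y) as h1. pose proof (tail_nonneg rg m n y) as h3.
      pose proof (tail_nonneg rd m n y) as h4. lin (h1, h3, h4).
    + intros n. rewrite !avg_plus. pose proof (r_abs0 rc (S m + n) L) as h1. pose proof (r_abs0 rg (S m + n) L) as h3.
      pose proof (r_abs0 rd (S m + n) L) as h4. unfold tail. lin (h1, h3, h4).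
    + apply series_cv_plus; [assumption|]. apply series_cv_plus; assumption.
    + lin (hbig, hTc1, hTg1, hTd1).
    + assert (hn3 : forall n, 0 <= tail rg m n y + tail rd m n y).
      { intros n. pose proof (tail_nonneg rg m n y) as h3. pose proof (tail_nonneg rd m n y) as h4. lin (h3, h4). }
      destruct (@series_cv_split (fun n => tail rc m n y) (fun n => tail rg m n y + tail rd m n y) s (fun n => tail_nonneg rc m n y) hn3 hs)
        as [sc [s' [[[[hsc hs'] hsum] hc0] hs0]]].
      destruct (@series_cv_split (fun n => tail rg m n y) (fun n => tail rd m n y) s' (fun n => tail_nonneg rg m n y) (fun n => tail_nonneg rd m n y) hs')
        as [sg [sd [[[[hsg hsd] hsum'] hg0] hd0]]].
      destruct (tail_point hsc) as [yC eC]. destruct (tail_point hsg) as [yG eG]. destruct (tail_point hsd) as [yD _].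
      apply CRabs_le_iff in eC. apply CRabs_le_iff in eG. fold Cm in eC. fold Gm in eG.
      (* Now C_m, g_m and psi each exceed 1/4 at y by more than the tails. So y is in C^1, g(y) >
         1/4 forces chi_S(y) > 0, and psi(y) > 0 gives dist x y < b. *)
      rewrite hKv in hF. apply lt_max_pos in hF; [|lin (hsum, hc0, hs0)]. rewrite hX0v in hF.
      pose proof (CRmin_l (CRmin (Cm y) (Gm y)) (psi y)) as n1. pose proof (CRmin_r (CRmin (Cm y) (Gm y)) (psi y)) as n2.
      pose proof (CRmin_l (Cm y) (Gm y)) as n3. pose proof (CRmin_r (Cm y) (Gm y)) as n4.
      destruct yC as [yC|yC]; [|exfalso; cbn [val chi chi_val] in eC; lin (eC, hF, n1, n3, hsum, hs0)].
      assert (hyA := hgd yD). specialize (hclose y yC hyA yG).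
      pose proof (proj1 (CRabs_le_iff _ _) (CRlt_asym _ _ hclose)) as hcl.
      assert (hpos : 0 < val (p := chi A) hyA) by lin (hcl, eG, hF, n1, n4, hsum, hsum', hc0, hd0, heps1).
      destruct hyA as [hyA|hyA]; [|exfalso; destruct (CRle_refl _ hpos)].
      exists y. split; [exact hyA|]. pose proof (hpsi y) as n5.
      assert (h0 : 0 < CR_of_Q R 2 * iv * (b - dist x y)) by lin (n2, n5, hF, hsum, hc0, hs0).
      rewrite <- (CRmult_0_r (CR_of_Q R 2 * iv)) in h0. apply CRmult_lt_reg_l in h0; [lin h0|lin hip].
  - left. intros s hs hlt.
    (* the homothety of centre s maps the cube into the ball of radius (a + b) / 2 about x *)
    assert (hcube : forall z, in_cube (origin_cube J) (tpow (S J)) z -> forall i, CRabs R (z i) <= tpow J).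
    { intros z hz i. specialize (hz i). unfold origin_cube in hz. pose proof (@tpow_S J) as h.
      apply CRabs_le_iff. split; lin (hz, h). }
    assert (hdist : forall z, in_cube (origin_cube J) (tpow (S J)) z -> dist x (shrink q s z) <= half * (a + b)).
    { intros z hz. pose proof (@dist_triang N x s (shrink q s z)) as h1.
      assert (h3 : dist s (shrink q s z) == hpow q * dist s z).
      { rewrite !dist_norm, <- norm_scale by (apply CRlt_asym, hpow_pos). apply norm_eq. intros i. unfold shrink. ring. }
      pose proof (@dist_triang N s x z) as h4. pose proof (@dist_sym N s x) as h5.
      assert (h6 : dist x z <= INR N * (X + tpow J)).
      { apply dist_sup; [pose proof (@tpow_pos J) as h; lin (h, hX0)|]. intros i. specialize (hcube z hz i). specialize (hX i).
        cbv beta in hX. apply CRle_trans with (1 := CRabs_triang _ _). rewrite CRabs_opp. lin (hcube, hX). }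
      assert (h7 : dist s z <= D) by (unfold D; lin (h4, h5, h6, hlt)).
      apply (CRmult_le_compat_l (hpow q)) in h7; [|apply CRlt_asym, hpow_pos].
      lin (h1, h3, h7, hq, hlt). }
    assert (hbox : forall z, in_cube (origin_cube J) (tpow (S J)) z -> forall i, CRabs R (shrink q s z i) <= r).
    { intros z hz i. specialize (hdist z hz). pose proof (@dist_coord N x (shrink q s z) i) as h1.
      pose proof (CRabs_bound b) as h3. specialize (hX i). cbv beta in hX. apply CRabs_le_iff in hX.
      pose proof (proj1 (CRabs_le_iff _ _) h1) as h4. apply CRabs_le_iff. unfold r. split; lin (h4, hdist, h3, hX, hab). }
    (* It suffices to look at the images of the two extreme corners, which lie in the box. *)
    assert (hin : forall i, origin_cube L i <= shrink q s (origin_cube J) i /\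
       shrink q s (origin_cube J) i + hpow q * tpow (S J) <= origin_cube L i + tpow (S L)).
    { intros i. pose proof (@tpow_pos (S J)) as hp.
      assert (c1 : in_cube (N := N) (origin_cube J) (tpow (S J)) (origin_cube J)) by (intros i'; split; lin hp).
      assert (c2 : in_cube (N := N) (origin_cube J) (tpow (S J)) (fun i => origin_cube J i + tpow (S J))) by (intros i'; split; lin hp).
      pose proof (hbox _ c1 i) as h1. pose proof (hbox _ c2 i) as h3.
      apply CRabs_le_iff in h1. apply CRabs_le_iff in h3. pose proof (@tpow_S L) as hS.
      unfold shrink, origin_cube in *. split; lin (h1, h3, hrL, hS). }
    assert (hJL : (J <= L)%nat) by (unfold L; lia).
    (* Detects the points of the box that fall in C^0, whose measure is below [eps]. *)
    set (W := cmax (csub Bm Cm) (cconst 0)).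
    assert (hK0 : forall y, 0 <= K y) by (intros y; apply CRmax_l).
    assert (hW0 : forall y, 0 <= W y) by (intros y; apply CRmax_r).
    pose proof (@shrink_int K q s J L hK0 hJL hin) as hKint.
    pose proof (@shrink_int W q s J L hW0 hJL hin) as hWint. fold w in hKint, hWint.
    set (kK := cube_vol (N := N) J * avg (cshrink q s K) (origin_cube J) (tpow (S J))) in *.
    set (kW := cube_vol (N := N) J * avg (cshrink q s W) (origin_cube J) (tpow (S J))) in *.
    (* From (B - C)^+ = (B - C) + (C - B)^+, whose last term is bounded by [neg_part_int]. *)
    assert (hWle : cube_vol (N := N) L * avg W (origin_cube L) (tpow (S L)) <= eps + CR_of_Q R 4 * e1).
    { assert (hneg := @neg_part_int _ _ _ _ rb rc m L Tb Tc hCB hTb hTc). fold Bm Cm in hneg.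
      set (Wn := cmax (csub Cm Bm) (cconst 0)) in hneg.
      assert (e : avg W (origin_cube L) (tpow (S L)) == avg (cadd (csub Bm Cm) Wn) (origin_cube L) (tpow (S L))).
      { apply avg_eq. intros y. unfold W, Wn. cbn [cmax csub cadd cscale cconst cf].
        set (p := Bm y). set (p' := Cm y).
        split; apply (CRle_by_cases (x := p) (y := p')); intros hpp.
        - rewrite (CRmax_right (p + -(1) * p') 0), (CRmax_left (p' + -(1) * p) 0) by lin hpp. lin.
        - rewrite (CRmax_left (p + -(1) * p') 0), (CRmax_right (p' + -(1) * p) 0) by lin hpp. lin.
        - rewrite (CRmax_right (p + -(1) * p') 0), (CRmax_left (p' + -(1) * p) 0) by lin hpp. lin.
        - rewrite (CRmax_left (p + -(1) * p') 0), (CRmax_right (p' + -(1) * p) 0) by lin hpp. lin. }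
      rewrite e, avg_plus, avg_sub. lin (hneg, hL1, hL2, hJb, hJc, hmu, hTb1, hTc1). }
    assert (hdiv : forall k k' : CR, w * k <= k' -> k <= iw * k').
    { intros k k' h. apply (CRmult_le_compat_l iw) in h; [|apply CRlt_asym; exact hiw].
      rewrite <- CRmult_assoc, hwiw in h. lin h. }
    assert (hie1 : iw * e1 == CR_of_Q R (1#64) * tau).
    { unfold e1. setoid_replace (iw * (CR_of_Q R (1#64) * (w * tau))) with (CR_of_Q R (1#64) * ((iw * w) * tau)) by ring. rewrite hwiw. ring. }
    assert (hieps : iw * eps <= CR_of_Q R (1#4) * tau).
    { apply (CRmult_le_compat_l iw) in heps2; [|apply CRlt_asym; exact hiw].
      setoid_replace (iw * (CR_of_Q R (1#4) * (w * tau))) with (CR_of_Q R (1#4) * ((iw * w) * tau)) in heps2 by ring.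
      rewrite hwiw in heps2. lin heps2. }
    assert (hkK : kK <= iw * (CR_of_Q R 4 * e1)) by (apply hdiv; lin (hKint, hsmall)).
    assert (hkW : kW <= iw * (eps + CR_of_Q R 4 * e1)) by (apply hdiv; lin (hWint, hWle)).
    set (E := fun n => cadd (tail rc m n) (cadd (tail rg m n) (tail rb m n))).
    (* Pulling a tail back through the homothety costs the factor 2^(qN), uniformly in s. *)
    assert (htl : forall f v (rp : rep (N := N) f v) n, cube_vol (N := N) J * avg (cshrink q s (tail rp m n)) (origin_cube J) (tpow (S J)) <= iw * rI rp (S m + n)%nat).
    { intros f v rp n. apply hdiv. rewrite avg_shrink.
      apply CRle_trans with (2 := r_abs rp (S m + n) (shrink q s (origin_cube J)) J q).
      unfold w, cube_vol, tail. rewrite <- CRmult_assoc, CRpow_mult. apply CRle_refl. }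
    (* The function is at most 0 up to the tails at any point of T^1 whose image is in C^1 (2K
       cancels 1) or in C^0 (W cancels 1). The weight 3 dominates the errors of these cancellations,
       which are at most 2(sc + sg) and sb + sc. *)
    destruct (@convergence_point_scaled N (cube_vol (N := N) J)
      (csub (csub (csum (rf rt) mT) (cscale (CR_of_Q R 2) (cshrink q s K))) (cshrink q s W))
      (fun n => cadd (tail rt mT n) (cadd (tail rd m n) (cscale (CR_of_Q R 3)
         (cadd (cshrink q s (tail rc m n)) (cadd (cshrink q s (tail rg m n)) (cshrink q s (tail rb m n)))))))
      (origin_cube J) (tpow (S J))
      (fun n => rI rt (S mT + n)%nat + (rI rd (S m + n)%nat +
         (rI rc (S m + n)%nat + (rI rg (S m + n)%nat + rI rb (S m + n)%nat)) * (CR_of_Q R 3 * iw)))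
      (Tt + (Td + (Tc + (Tg + Tb)) * (CR_of_Q R 3 * iw)))) as [z [hz [S0 [hS0 hF]]]].
    + apply cube_vol_pos.
    + apply CRlt_asym, tpow_pos.
    + intros n y _. cbn [cadd cscale cshrink cf]. set (y' := shrink q s y).
      pose proof (tail_nonneg rt mT n y) as h1. pose proof (tail_nonneg rd m n y) as h3.
      pose proof (tail_nonneg rc m n y') as h4. pose proof (tail_nonneg rg m n y') as h5. pose proof (tail_nonneg rb m n y') as h6.
      lin (h1, h3, h4, h5, h6).
    + intros n. rewrite !avg_plus, avg_scale, !avg_plus.
      pose proof (r_abs0 rt (S mT + n) J) as h1. pose proof (r_abs0 rd (S m + n) J) as h3.
      pose proof (htl _ _ rc n) as h4. pose proof (htl _ _ rg n) as h5. pose proof (htl _ _ rb n) as h6.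
      change (tail rt mT n) with (cabs (rf rt (S mT + n))). change (tail rd m n) with (cabs (rf rd (S m + n))).
      lin (h1, h3, h4, h5, h6).
    + apply series_cv_plus; [assumption|]. apply series_cv_plus; [assumption|]. apply series_cv_scale.
      apply series_cv_plus; [assumption|]. apply series_cv_plus; assumption.
    + rewrite !avg_sub, avg_scale. fold kK kW.
      assert (hT3 : Tc + (Tg + Tb) <= CR_of_Q R 3 * e1) by lin (hTc1, hTg1, hTb1).
      apply (CRmult_le_compat_l iw) in hT3; [|apply CRlt_asym; exact hiw].
      assert (he1t : e1 <= CR_of_Q R (1#64) * tau).
      { assert (h : 0 <= (1 - w) * tau) by (apply CRmult_le0; [lin hw1|apply CRlt_asym; exact htau]). unfold e1. lin h. }
      assert (goal' : Tt + (Td + (Tc + (Tg + Tb)) * (CR_of_Q R 3 * iw)) <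
        cube_vol (N := N) J * avg (csum (rf rt) mT) (origin_cube J) (tpow (S J)) - CR_of_Q R 2 * kK - kW).
      { lin (hcore, hTd1, hT3, he1t, hie1, hieps, hkK, hkW, htau). }
      unfold kK, kW in *. lin goal'.
    + cbn [cadd cscale cshrink cf] in hS0. set (z' := shrink q s z) in *.
      assert (p1 : forall n, 0 <= tail rc m n z' + (tail rg m n z' + tail rb m n z')).
      { intros n. pose proof (tail_nonneg rc m n z') as h4. pose proof (tail_nonneg rg m n z') as h5. pose proof (tail_nonneg rb m n z') as h6. lin (h4, h5, h6). }
      assert (p2 : forall n, 0 <= tail rg m n z' + tail rb m n z').
      { intros n. pose proof (tail_nonneg rg m n z') as h5. pose proof (tail_nonneg rb m n z') as h6. lin (h5, h6). }
      assert (p3 : forall n, 0 <= CR_of_Q R 3 * (tail rc m n z' + (tail rg m n z' + tail rb m n z'))) by (intros n; specialize (p1 n); lin p1).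
      assert (p4 : forall n, 0 <= tail rd m n z + CR_of_Q R 3 * (tail rc m n z' + (tail rg m n z' + tail rb m n z'))).
      { intros n. specialize (p3 n). pose proof (tail_nonneg rd m n z) as h4. lin (p3, h4). }
      destruct (series_cv_split (fun n => tail_nonneg rt mT n z) p4 hS0) as [st [S1 [[[[hst hS1] e0] q0] q1]]].
      destruct (series_cv_split (fun n => tail_nonneg rd m n z) p3 hS1) as [sd [S2 [[[[hsd hS2] e2] q2] q3]]].
      assert (hS2' : series_cv (fun n => tail rc m n z' + (tail rg m n z' + tail rb m n z')) (S2 * CR_of_Q R (1#3))).
      { apply series_cv_eq with (2 := series_cv_scale (CR_of_Q R (1#3)) _ _ hS2). intros n. ring. }
      destruct (series_cv_split (fun n => tail_nonneg rc m n z') p2 hS2') as [sc [S3 [[[[hsc hS3] e3] q4] q5]]].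
      destruct (series_cv_split (fun n => tail_nonneg rg m n z') (fun n => tail_nonneg rb m n z') hS3) as [sg [sb [[[[hsg hsb] e4] q6] q7]]].
      destruct (tail_point hst) as [zT eT]. destruct (tail_point hsd) as [zD _].
      destruct (tail_point hsc) as [zC eC]. destruct (tail_point hsg) as [zG eG]. destruct (tail_point hsb) as [zB eB].
      apply CRabs_le_iff in eT. apply CRabs_le_iff in eC. apply CRabs_le_iff in eG. apply CRabs_le_iff in eB.
      fold Cm in eC. fold Gm in eG. fold Bm in eB.
      rewrite (@box_of_abs r z' zB (hbox z hz)) in eB.
      assert (hFz : S0 < csum (rf rt) mT z - CR_of_Q R 2 * K z' - W z').
      { cbn [csub cadd cscale cshrink cf] in hF. fold z' in hF. lin hF. }
      pose proof (hK0 z') as k0. pose proof (hW0 z') as w0.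
      destruct zT as [zT|zT]; [|cbn [val chi chi_val] in eT; lin (eT, hFz, k0, w0, e0, e2, e3, q1)].
      cbn [val chi chi_val] in eT.
      assert (hzA : cs1 A z') by (apply (@hconv z s (hpow q) (in_of_sub zT zD) hs); [apply CRlt_asym, hpow_pos|apply hpow_le1]).
      assert (hW1 : Bm z' - Cm z' <= W z').
      { unfold W. cbn [cmax csub cadd cscale cconst cf]. pose proof (CRmax_l (Bm z' + -(1) * Cm z') 0) as h. lin h. }
      destruct zC as [zC|zC]; cbn [val chi chi_val] in eC.
      (* Image in C^1: g is within 1/4 of 1 and psi is at least 1, so after subtracting 1/4 the
         function K is at least 1/2 up to the tails. *)
      * specialize (hclose z' zC (inl hzA) zG). cbn [val chi chi_val] in hclose.
        pose proof (proj1 (CRabs_le_iff _ _) (CRlt_asym _ _ hclose)) as hcl.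
        assert (hpz : 1 <= psi z').
        { rewrite hpsi. specialize (hdist z hz). fold z' in hdist.
          assert (h : half * (b - a) <= b - dist x z') by lin hdist.
          apply (CRmult_le_compat_l (CR_of_Q R 2 * iv)) in h; [|lin hip].
          setoid_replace (CR_of_Q R 2 * iv * (half * (b - a))) with (iv * (b - a)) in h by ring. rewrite hi in h. exact h. }
        assert (hKz : half - sc - sg <= K z').
        { rewrite hKv. apply CRle_trans with (X0 z'); [|apply CRmax_r]. rewrite hX0v.
          assert (h : CR_of_Q R (3#4) - sc - sg <= CRmin (CRmin (Cm z') (Gm z')) (psi z')); [|lin h].
          apply CRmin_glb; [apply CRmin_glb|].
          - lin (eC, q6).
          - lin (eG, hcl, heps1, q4).
          - lin (hpz, q4, q6). }
        lin (eT, hFz, hKz, w0, e0, e2, e3, e4, q2, q7, q4, q6).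
      (* Image in C^0 but in the box: W is at least 1 up to the tails. *)
      * lin (eT, hFz, k0, hW1, eC, eB, e0, e2, e3, e4, q2, q7, q4, q6).
Qed.

End Decision.

(** * The infimum by trisection *)

Section Infimum.

Context {N : nat}.
Variables (S : subset R N) (x : point R N).
Hypothesis hdec : forall a b : CR, a < b ->
  (forall s, S s -> a <= dist x s) + {s : point R N & S s * (dist x s < b)}%type.

Definition bracket : Type :=
  {p : CR * CR & (fst p < snd p) * (forall s, S s -> fst p <= dist x s) * {s : point R N & S s * (dist x s < snd p)}}%type.

(** The alternatives are applied at one third and two thirds of the interval; either answer discards
    a third of it. *)
Lemma bracket_step (b : bracket) :
  {b' : bracket & fst (projT1 b) <= fst (projT1 b') /\ snd (projT1 b') <= snd (projT1 b) /\
    snd (projT1 b') - fst (projT1 b') <= CR_of_Q R (2#3) * (snd (projT1 b) - fst (projT1 b))}.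
Proof.
  destruct b as [[l u] [[hlu hl] hu]]. cbn [fst snd projT1] in *.
  destruct (hdec (a := CR_of_Q R (1#3) * (l + l + u)) (b := CR_of_Q R (1#3) * (l + u + u))) as [h|h]; [lin hlu| |].
  - unshelve eexists.
    + exists (CR_of_Q R (1#3) * (l + l + u), u). split; [split; [cbn [fst snd]; lin hlu|exact h]|exact hu].
    + cbn [fst snd projT1]. repeat split; lin hlu.
  - unshelve eexists.
    + exists (l, CR_of_Q R (1#3) * (l + u + u)). split; [split; [cbn [fst snd]; lin hlu|exact hl]|exact h].
    + cbn [fst snd projT1]. repeat split; lin hlu.
Qed.

(** Two trisections per step, because (2/3)^2 <= 1/2 yields the rate [hpow]. *)
Fixpoint bracket_seq (b0 : bracket) (k : nat) : bracket :=
  match k with O => b0 | Datatypes.S j => projT1 (bracket_step (projT1 (bracket_step (bracket_seq b0 j)))) end.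

Lemma distance_exists s0 : S s0 -> {m : CR & is_dist_to x S m}.
Proof.
  intros hs0.
  assert (b0 : bracket).
  { exists (0, dist x s0 + 1). pose proof (@dist_nonneg N x s0) as h0. split; [split|].
    - cbn [fst snd]. lin h0.
    - intros s _. apply dist_nonneg.
    - exists s0. split; [exact hs0|]. cbn [snd]. lin. }
  set (l := fun k => fst (projT1 (bracket_seq b0 k))). set (u := fun k => snd (projT1 (bracket_seq b0 k))).
  assert (hlu : forall k, l k < u k).
  { intros k. unfold l, u. destruct (bracket_seq b0 k) as [p [[h h'] h'']]. exact h. }
  assert (hstep : forall k, l k <= l (Datatypes.S k) /\ u (Datatypes.S k) <= u k /\
    u (Datatypes.S k) - l (Datatypes.S k) <= half * (u k - l k)).
  { intros k. unfold l, u. cbn [bracket_seq].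
    set (b1 := bracket_step (bracket_seq b0 k)). pose proof (projT2 b1) as h1. cbv beta in h1.
    pose proof (projT2 (bracket_step (projT1 b1))) as h3. cbv beta in h3.
    pose proof (hlu k) as h4. unfold l, u in h4. repeat split; lin (h1, h3, h4). }
  assert (hmono : forall k p, (k <= p)%nat -> l k <= l p /\ u p <= u k).
  { intros k p h. induction h as [|p h IH]; [split; apply CRle_refl|].
    pose proof (hstep p) as hp. split; lin (IH, hp). }
  assert (hw : forall k, u k - l k <= hpow k * (u 0%nat - l 0%nat)).
  { induction k as [|k IH]; [rewrite hpow_0; lin|]. pose proof (hstep k) as hk. rewrite hpow_S. lin (hk, IH). }
  assert (hcau : CR_cauchy R l).
  { intros p. destruct (@hpow_below (u 0%nat - l 0%nat) (CR_of_Q R (1 # p))) as [k hk]; [apply CR_of_Q_lt; reflexivity|].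
    exists k. intros i j hi hj. pose proof (hmono k i hi) as a1. pose proof (hmono k j hj) as a2.
    pose proof (hw k) as a3. pose proof (hlu i) as a4. pose proof (hlu j) as a5.
    apply CRabs_le_iff. split; lin (a1, a2, a3, a4, a5, hk). }
  destruct (CR_complete R l hcau) as [m hm]. exists m.
  assert (hlm : forall k, l k <= m).
  { intros k. apply (CR_cv_bound_down l (l k) m k) with (2 := hm). intros p hp. apply (hmono k p hp). }
  split.
  - intros s hs. apply (CR_cv_bound_up l (dist x s) m 0) with (2 := hm). intros k _. unfold l.
    destruct (bracket_seq b0 k) as [p [[h' h] h'']]. apply h. exact hs.
  - intros e he. destruct (@hpow_below (u 0%nat - l 0%nat) e he) as [k hk].
    assert (hs : {s : point R N & S s * (dist x s < u k)}%type).
    { unfold u. destruct (bracket_seq b0 k) as [p [h' h]]. exact h. }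
    destruct hs as [s [hs hd]]. exists s. split; [exact hs|].
    pose proof (hw k) as a1. pose proof (hlm k) as a2. lin (hd, a1, a2, hk).
Qed.

End Infimum.

End Development.

Theorem theorem1 (R : ConstructiveReals) (N : nat) (hN : (0 < N)%nat)
    (S : complemented_set R N)
    (hS : measurable S) (hpos : positive_measure S) (hconv : convex (cs1 S)) :
  located (cs1 S).
Proof.
  destruct hpos as [_ [T [[vt ht] [hTS hvt]]]].
  destruct (fst hS) as [g [[vd hd] hgd]].
  pose proof (has_integral_rep ht) as rt. pose proof (has_integral_rep hd) as rd.
  destruct (positive_core rt hvt) as [tau [htau [m [J [Tt [hTt hcore]]]]]].
  destruct (core_point hTS rd hgd htau hTt hcore) as [z hz].
  split; [exists z; exact hz|].
  intros x. refine (distance_exists _ hz). intros a b hab.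
  exact (decide_near hTS rd hgd htau hTt hcore hS hconv x hab).
Qed.
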